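(* Let $\Gamma$ be a discrete group and $\Delta\subseteq\Gamma$ a positivity domain. The following are equivalent: (i) The positivity domain $\Delta$ has the positive operator extension property (as a positivity domain). (ii) The positivity domain $\Delta$ has the bounded operator extension property (as a positivity domain). (iii) The positivity domain $\Delta$ has the complete factorisation property.
   Context: A positivity domain is a subset $\Delta\subseteq\Gamma$ with $e\in\Delta$ and $\Delta^{-1}=\Delta$. $\mathrm{C}^*(\Gamma)$ is the universal group C$^*$-algebra with canonical unitaries $\delta_s$, and $\mathrm{S}[D]=\mathrm{span}\{\delta_s\mid s\in D\}$. For a Hilbert space $H$, a function $u:\Delta\to\mathcal{B}(H)$ is positive semi-definite if $(u(st^{-1}))_{s,t\in\Sigma}$ is a positive operator on $\ell^2(\Sigma)\otimes H$ for every finite $\Sigma\subseteq\Gamma$ with $\Sigma\Sigma^{-1}\subseteq\Delta$. $\mathrm{B}(\Delta,H)$ is the linear span of the cone $\mathrm{B}(\Delta,H)^+$ of positive semi-definite functions (the case $\Delta=\Gamma$ gives $\mathrm{B}(\Gamma,H)$). Norms: for $u\in \mathrm{B}(\Gamma,H)$, $\|u\|_{\mathrm{B}(\Gamma,H)}=\|\phi_u\|_{\mathrm{cb}}$, where $\phi_u:\mathrm{C}^*(\Gamma)\to\mathcal{B}(H)$ is the unique completely bounded map with $\phi_u(\delta_s)=u(s)$. For $u\in \mathrm{B}(\Delta,H)$, $\|u\|_{\mathrm{B}(\Delta,H)}=\|\phi_u\|_{\mathrm{cb}}$ where $\phi_u:\mathrm{UOS}(\Delta)\to\mathcal{B}(H)$,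 $\phi_u(\delta_s)=u(s)$. Here $\mathrm{UOS}(\Delta)$ is the operator system (with its canonical operator space structure) with underlying $*$-vector space $\mathrm{S}[\Delta]$, unit $\delta_e$ and $n$-th positive cone $\{x\in \mathrm{M}_n(\mathrm{S}[\Delta])_{\mathrm h}\mid x+r\,\mathbf 1_n\otimes\delta_e\in\mathcal{U}_n(\Delta)\ \forall r>0\}$, where $\mathcal{U}_n(\Delta)$ is the convex cone generated by $\bigcup\{\mathcal{Q}_n(\Sigma)\mid\Sigma\subseteq\Gamma\text{ finite},\ \Sigma\Sigma^{-1}\subseteq\Delta\}$ and $\mathcal{Q}_n(\Sigma)=\{\sum_{i=1}^r y_iy_i^*\mid r\in\mathbb{N},\ y_i=\sum_{s\in\Sigma}A^i_s\otimes\delta_s,\ A^i_s\in \mathrm{M}_n(\mathbb{C})\}$. Positive operator extension property of $\Delta$: for every Hilbert space $H$ and every positive semi-definite $u:\Delta\to\mathcal{B}(H)$ there is a positive semi-definite $\tilde u:\Gamma\to\mathcal{B}(H)$ with $\tilde u|_\Delta=u$. Bounded operator extension property of $\Delta$: for every Hilbert space $H$ and every $u\in \mathrm{B}(\Delta,H)$ there is $\tilde u\in \mathrm{B}(\Gamma,H)$ with $\tilde u|_\Delta=u$ and $\|\tilde u\|_{\mathrm{B}(\Gamma,H)}=\|u\|_{\mathrm{B}(\Delta,H)}$. Complete factorisation property of $\Delta$: for every $n\in\mathbb{N}$, every $z\in \mathrm{M}_n(\mathrm{C}^*(\Gamma))^+$ with finite support inside $\Delta$ (i.e. $z\in \mathrm{M}_n(\mathrm{S}[\Delta])$)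 and every $\epsilon>0$, there are $r\in\mathbb{N}$, finite sets $\Sigma_i\subseteq\Gamma$ with $\Sigma_i\Sigma_i^{-1}\subseteq\Delta$, and $y_i=\sum_{s\in\Sigma_i}B^i_s\otimes\delta_s$ with $B^i_s\in \mathrm{M}_n(\mathbb{C})$, $i=1,\dots,r$, such that $z+\epsilon\,\mathbf 1_n\otimes\delta_e=\sum_{i=1}^r y_iy_i^*$. *)

(* Defs.v *)
From HB Require Import structures.
From mathcomp Require Import all_boot all_order all_algebra.
From mathcomp Require Import monoid sesquilinear finmap complex.
From mathcomp Require Import all_classical all_reals all_analysis.

Set Implicit Arguments.
Unset Strict Implicit.
Unset Printing Implicit Defensive.

Import Order.TTheory GRing.Theory Num.Theory numFieldNormedType.Exports.

Local Open Scope classical_set_scope.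
Local Open Scope ring_scope.
Local Open Scope complex_scope.

(* Complex Hilbert spaces.  The inner product is linear in its first argument
   and conjugate-linear in the second one. *)
Record hilbert (R : realType) := Hilbert {
  hspace :> completeNormedModType R[i];
  hdot : {dot hspace for (@Num.conj R[i])};
  hdotE : forall x : hspace, hdot x x = `|x| ^+ 2 }.

Arguments hdot {R h}.

(* [`|x|] is a nonnegative element of [R[i]]; this is the same number in [R]. *)
Definition hnorm (R : realType) (H : hilbert R) (x : H) : R :=
  complex.Re `|x|.

Definition is_bop (R : realType) (H : hilbert R) : {pred (H -> H)} :=
  fun f => `[< linear f /\ continuous f >].

(* B(H); the ring structure declared below has composition as product. *)
Record bop (R : realType) (H : hilbert R) := Bop {
  bop_fun :> H -> H;
  bop_subproof : bop_fun \in @is_bop R H }.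

Section bop_algebra.
Context {R : realType} {H : hilbert R}.
Implicit Types S T : bop H.

HB.instance Definition _ := [isSub for @bop_fun R H].
HB.instance Definition _ := gen_eqMixin (bop H).
HB.instance Definition _ := gen_choiceMixin (bop H).

Lemma bopP T : linear T /\ continuous T.
Proof. exact/asboolP/(bop_subproof T). Qed.

Lemma bop_ext S T : S =1 T -> S = T.
Proof. by move=> ST; apply/val_inj/funext. Qed.

Fact is_bop_submod : submod_closed (@is_bop R H).
Proof.
split=> [|a f g /asboolP[fl fc] /asboolP[gl gc]]; apply/asboolP; split.
- by move=> b x y; rewrite [LHS]/(0 : H) scaler0 addr0.
- by move=> x; exact: cst_continuous.
- move=> b x y; rewrite !fctE fl gl !scalerDr addrACA; congr (_ + _ + _).
  by rewrite !scalerA mulrC.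
- by move=> x; apply: cvgD (gc x); apply: cvgZr (fc x).
Qed.

HB.instance Definition _ :=
  GRing.isSubmodClosed.Build R[i] (H -> H) (@is_bop R H) is_bop_submod.
HB.instance Definition _ := [SubChoice_isSubLmodule of bop H by <:].

Fact bop1_subproof : idfun \in @is_bop R H.
Proof. by apply/asboolP; split=> // x; exact: cvg_id. Qed.
Definition bop1 : bop H := Bop bop1_subproof.

Fact bop_mul_subproof S T : S \o T \in @is_bop R H.
Proof.
have [Sl Sc] := bopP S; have [Tl Tc] := bopP T.
apply/asboolP; split=> [a x y|x]; first by rewrite /= Tl Sl.
by apply: continuous_comp; [exact: Tc|exact: Sc].
Qed.
Definition bop_mul S T : bop H := Bop (bop_mul_subproof S T).

Fact bop_mulA : associative bop_mul.
Proof. by move=> S T U; exact: bop_ext. Qed.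
Fact bop_mul1 : left_id bop1 bop_mul.
Proof. by move=> S; exact: bop_ext. Qed.
Fact bop_mulr1 : right_id bop1 bop_mul.
Proof. by move=> S; exact: bop_ext. Qed.
Fact bop_mulDl : left_distributive bop_mul +%R.
Proof. by move=> S T U; exact: bop_ext. Qed.
Fact bop_mulDr : right_distributive bop_mul +%R.
Proof.
move=> S T U; apply: bop_ext => x /=.
by have := (bopP S).1 1 (T x) (U x); rewrite !scale1r.
Qed.

HB.instance Definition _ := GRing.Zmodule_isPzRing.Build (bop H)
  bop_mulA bop_mul1 bop_mulr1 bop_mulDl bop_mulDr.

End bop_algebra.

Section operators.
Context {R : realType} {H : hilbert R}.

(* The adjoint, which exists (Riesz) and is unique, so that the default value
   of [xget] is never used *)
Definition adj (T : bop H) : bop H :=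
  xget 0 [set S : bop H | forall x y, hdot (T x) y = hdot x (S y)].

Definition opnorm (T : bop H) : \bar R :=
  ereal_sup [set (hnorm (T x))%:E | x in [set x | hnorm x <= 1]].

(* M_n(B(H)) = B(H^n) acts on families [xi : 'I_n -> H]. *)
Definition l2norm n (xi : 'I_n -> H) : R :=
  Num.sqrt (\sum_i hnorm (xi i) ^+ 2).

Definition mxop_act n (T : 'M[bop H]_n) (xi : 'I_n -> H) : 'I_n -> H :=
  fun i => \sum_j T i j (xi j).

Definition mxopnorm n (T : 'M[bop H]_n) : \bar R :=
  ereal_sup [set (l2norm (mxop_act T xi))%:E | xi in [set xi | l2norm xi <= 1]].

Definition mxadj n (T : 'M[bop H]_n) : 'M[bop H]_n := (map_mx adj T)^T.

(* Positivity of [(T i j)] as an operator on l^2(I) (x) H; the order of [R[i]]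
   makes the left-hand side below real. *)
Definition mxop_pos (I : finType) (T : I -> I -> bop H) :=
  forall xi : I -> H, 0 <= \sum_i \sum_j hdot (T i j (xi j)) (xi i).

(* The elementary tensor A (x) T in M_n(C) (x) B(H) = M_n(B(H)) *)
Definition mxtens n (A : 'M[R[i]]_n) (T : bop H) : 'M[bop H]_n :=
  map_mx (fun a => a *: T) A.

Definition mxin (D : set (bop H)) n (x : 'M[bop H]_n) := forall i j, D (x i j).

End operators.

Section group_algebra.
Context {R : realType} {G : groupType} {H : hilbert R}.

Definition unitary_rep (pi : G -> bop H) :=
  [/\ pi 1%g = 1, forall s t, pi (s * t)%g = pi s * pi t
    & forall s x y, hdot (pi s x) (pi s y) = hdot x y].

(* The image of the element \sum_(s in S) c_s s of C[G] *)
Definition lincomb (pi : G -> bop H) (S : {fset G}) (c : G -> R[i]) : bop H :=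
  \sum_(s <- S) c s *: pi s.

Definition mxlincomb (pi : G -> bop H) n (S : {fset G}) (A : G -> 'M[R[i]]_n) :
  'M[bop H]_n := \sum_(s <- S) mxtens (A s) (pi s).

End group_algebra.

(* The universal group C*-algebra C*(G), that is the completion of C[G] for the
   largest C*-norm ||x|| = sup_pi ||pi(x)||, pi ranging over all unitary
   representations, given as a concrete C*-algebra: [delta] is a unitary
   representation on some Hilbert space [gc_space] attaining this supremum, and
   C*(G) is the norm closure [cstar] of its linear span.  Thus M_n(C*(G)) is a
   C*-subalgebra of B(gc_space^n), with the norm [mxopnorm] and the positive
   cone given by [mxop_pos]. *)
Record group_cstar (R : realType) (G : groupType) := GroupCstar {
  gc_space : hilbert R;
  delta : G -> bop gc_space;
  delta_unitary : unitary_rep delta;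
  delta_universal : forall (H : hilbert R) (pi : G -> bop H),
    unitary_rep pi -> forall (S : {fset G}) (c : G -> R[i]),
    (opnorm (lincomb pi S c) <= opnorm (lincomb delta S c))%E }.

Section positivity_domains.
Context {R : realType} {G : groupType}.
Implicit Types (D : set G) (S : {fset G}).

Definition positivity_domain D := D 1%g /\ [set (s^-1)%g | s in D] = D.

Definition admissible D S :=
  forall s t, s \in S -> t \in S -> D (s * t^-1)%g.

(* A function D -> B(H) is represented by a total function G -> B(H) whose
   values outside D are never used. *)
Definition psd D (H : hilbert R) (u : G -> bop H) :=
  forall S, admissible D S ->
    mxop_pos (fun s t : S => u (val s * (val t)^-1)%g).

(* B(D, H), the complex linear span of the positive semi-definite functions *)
Definition BDH D (H : hilbert R) (u : G -> bop H) :=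
  exists (r : nat) (c : 'I_r -> R[i]) (v : 'I_r -> G -> bop H),
    (forall k, psd D (v k)) /\
    (forall s, D s -> u s = \sum_k c k *: v k s).

End positivity_domains.

Section group_operator_spaces.
Context {R : realType} {G : groupType} (A : group_cstar R G).
Implicit Types (D : set G) (S : {fset G}).

Local Notation K := (gc_space A).
Local Notation delta := (delta A).

Definition span_delta D : set (bop K) :=
  [set x | exists S (c : G -> R[i]),
     (forall s, s \in S -> D s) /\ x = lincomb delta S c].

Definition cstar : set (bop K) :=
  [set x | forall e : R, 0 < e ->
     exists2 y, span_delta setT y & (opnorm (x - y)%R < e%:E)%E].

Definition cstar_pos n : set 'M[bop K]_n :=
  [set x | mxin cstar x /\ mxop_pos (fun i j => x i j)].

Definition scalar_unit n (r : R) : 'M[bop K]_n := mxtens (r%:C)%:M (delta 1%g).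

Definition Qcone S n : set 'M[bop K]_n :=
  [set x | exists (r : nat) (B : 'I_r -> G -> 'M[R[i]]_n),
     x = \sum_i mxlincomb delta S (B i) *m mxadj (mxlincomb delta S (B i))].

(* The convex cone generated by the Qcone S, for admissible S *)
Definition Ucone D n : set 'M[bop K]_n :=
  [set x | exists (r : nat) (a : 'I_r -> R) (q : 'I_r -> 'M[bop K]_n),
     [/\ forall k, 0 <= a k,
         forall k, exists2 S, admissible D S & Qcone S (q k)
       & x = \sum_k map_mx (fun T => (a k)%:C *: T) (q k)]].

Definition UOS_pos D n : set 'M[bop K]_n :=
  [set x | [/\ mxin (span_delta D) x, mxadj x = x
    & forall r : R, 0 < r -> Ucone D (x + scalar_unit n r)]].

(* The n-th matrix norm of the operator system UOS(D): the infimum of the r > 0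
   such that [[r 1, x], [x^*, r 1]] is positive *)
Definition UOS_norm D n (x : 'M[bop K]_n) : \bar R :=
  ereal_inf [set r%:E | r in [set r : R | 0 < r /\
    UOS_pos D (block_mx (scalar_unit n r) x (mxadj x) (scalar_unit n r))]].

Section completely_bounded.
Context {H : hilbert R}.

Definition linear_on (E : set (bop K)) (phi : bop K -> bop H) :=
  forall a x y, E x -> E y -> phi (a *: x + y) = a *: phi x + phi y.

(* ||phi||_cb for phi defined on the operator space E with matrix norms N *)
Definition cbnorm (E : set (bop K)) (N : forall n, 'M[bop K]_n -> \bar R)
    (phi : bop K -> bop H) : \bar R :=
  ereal_sup [set c | exists (n : nat) (x : 'M[bop K]_n),
    [/\ mxin E x, (N n x <= 1)%E & c = mxopnorm (map_mx phi x)]].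

Definition cbnorm_cstar (phi : bop K -> bop H) : \bar R :=
  cbnorm cstar (@mxopnorm R K) phi.

Definition cbnorm_UOS D (phi : bop K -> bop H) : \bar R :=
  cbnorm (span_delta D) (@UOS_norm D) phi.

(* The map phi_u; it is unique on C*(G), resp. on UOS(D), and its (arbitrary)
   values elsewhere do not influence its cb-norm. *)
Definition phi_cstar (u : G -> bop H) : bop K -> bop H :=
  xget (fun=> 0) [set phi | [/\ linear_on cstar phi,
    (cbnorm_cstar phi < +oo)%E & forall s, phi (delta s) = u s]].

Definition phi_UOS D (u : G -> bop H) : bop K -> bop H :=
  xget (fun=> 0) [set phi | linear_on (span_delta D) phi /\
    forall s, D s -> phi (delta s) = u s].

Definition BGH_norm (u : G -> bop H) : \bar R := cbnorm_cstar (phi_cstar u).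

Definition BDH_norm D (u : G -> bop H) : \bar R := cbnorm_UOS D (phi_UOS D u).

End completely_bounded.

Definition bounded_extension_property D :=
  forall (H : hilbert R) (u : G -> bop H), BDH D u ->
    exists v : G -> bop H,
      [/\ BDH setT v, forall s, D s -> v s = u s & BGH_norm v = BDH_norm D u].

Definition complete_factorisation_property D :=
  forall (n : nat) (z : 'M[bop K]_n) (e : R),
    cstar_pos z -> mxin (span_delta D) z -> 0 < e ->
    exists (r : nat) (S : 'I_r -> {fset G}) (B : 'I_r -> G -> 'M[R[i]]_n),
      (forall i, admissible D (S i)) /\
      z + scalar_unit n e =
        \sum_i mxlincomb delta (S i) (B i) *m
               mxadj (mxlincomb delta (S i) (B i)).

End group_operator_spaces.

Definition positive_extension_property (R : realType) (G : groupType)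
    (D : set G) :=
  forall (H : hilbert R) (u : G -> bop H), psd D u ->
    exists v : G -> bop H, psd setT v /\ forall s, D s -> v s = u s.

(* Main.v *)
(* A positive semi-definite function [u] on [D] is the compression of one with [u 1 = 1]
   (Kolmogorov), and one on [G] is a coefficient of a unitary representation (GNS).

   (ii) => (i): for unital [u], the map [phi_u] is a complete contraction on UOS(D); an
   extension of the same norm is a unital complete contraction on C^*(G), hence positive.

   The other implications extend positive functionals by M. Riesz' theorem.  A family of
   sesquilinear forms [B s] on [V], hermitian in [s], is a real functional on
   C[G] (x) V (x) V^*, and it is positive semi-definite on [D] when it is nonnegative on the
   cone generated by the squares supported on sets [S] with [S S^-1] in [D].

   (i) => (iii): if [z + e] is not a sum of squares, a functional on the tests with
   [V = C^n] is nonnegative on the squares and negative on [z]; it extends from [D] to [G],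
   which contradicts the positivity of [z].

   (iii) => (i): the functional of [u] on the tests supported on [D] is nonnegative on those
   that are positive in matrices over C^*(G), and therefore extends to all tests.

   (i) => (ii): this is Paulsen's 2 x 2 matrix trick.  With [V = H * H] and
   [c = ||u||_B(D, H)], the functional given by the blocks [[c 1, u], [u^*, c 1]] is positive
   on the tests in the corners that are sums of squares, because [phi_u] has cb-norm [c].
   Its extension is a positive semi-definite family on [D], thus comes from one on [G], that
   is from a representation [pi] and [J1, J2] with [||J1||^2 = ||J2||^2 = c], and
   [v s = J1^* (pi s) J2] is the required extension of [u]. *)
Require Import Defs.
From HB Require Import structures.
From mathcomp Require Import all_boot all_order all_algebra.
From mathcomp Require Import monoid sesquilinear finmap complex.
From mathcomp Require Import all_classical all_reals all_analysis.
From mathcomp Require Import ring lra.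

Set Implicit Arguments.
Unset Strict Implicit.
Unset Printing Implicit Defensive.

Import Order.TTheory GRing.Theory Num.Theory numFieldNormedType.Exports.

Local Open Scope classical_set_scope.
Local Open Scope ring_scope.
Local Open Scope complex_scope.

Local Notation "z ^*" := (conjc z) : ring_scope.
Local Notation "''i'" := (Complex 0 1) : ring_scope.
Local Notation normc := (@Normc.normc _).

(** * Complex numbers and Hilbert spaces *)

(** Three obstacles shape the development. First, [delta_universal] compares the norms of single
    elements of C[G], whereas matrices over C[G] are needed throughout. [mxbound_universal] bridges
    the gap with high powers of self-adjoint matrices, and positivity follows because T >= 0 can be
    read off from the norm of r - T. Second, tests have to be compared and added for an arbitrary,
    possibly infinite-dimensional V. They are therefore realised as functions on the set of
    hermitian families, and finitely many vectors at a time are turned into matrices with the help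
    of a dual family. Such functions see real parts only, which is why matrices are symmetrised and
    imaginary parts recovered separately. Third, the cone of squares is not known to be closed. In
    place of a topological separation theorem, the negative of the given element is added to the
    cone and a functional on the line of the unit is extended; the summand e then turns a weak
    inequality into a strict one. All Hilbert spaces are built as spaces of functions with a
    reproducing kernel, so that neither quotients nor completions are formed. *)

Section complex_numbers.
Variable R : realType.
Local Notation C := R[i].
Implicit Types (z w : C) (x y : R).

Lemma normc_ge0 z : 0 <= normc z.
Proof. by case: z => a b; exact: sqrtr_ge0. Qed.

Lemma normcr x : normc x%:C = `|x|.
Proof. by rewrite /= expr0n addr0 sqrtr_sqr. Qed.

Lemma normc_conj z : normc z^* = normc z.
Proof. by case: z => a b /=; rewrite sqrrN. Qed.

Lemma sqr_normcE z : normc z ^+ 2 = complex.Re z ^+ 2 + complex.Im z ^+ 2.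
Proof. by case: z => a b /=; rewrite sqr_sqrtr // addr_ge0 ?sqr_ge0. Qed.

Lemma conj1 : (1 : C)^* = 1.
Proof. exact: conjc1. Qed.

Lemma conjN1 : (- 1 : C)^* = - 1.
Proof. by rewrite /conjc /= oppr0. Qed.

Lemma mul_conjc z : z * z^* = (normc z ^+ 2)%:C.
Proof.
rewrite sqr_normcE; case: z => a b; apply/eqP; rewrite eq_complex /=.
by apply/andP; split; apply/eqP; ring.
Qed.

Lemma conjc_mul z : z^* * z = (normc z ^+ 2)%:C.
Proof. by rewrite -mul_conjc mulrC. Qed.

Lemma normr_Re_le z : `|complex.Re z| <= normc z.
Proof.
rewrite -(@ler_pXn2r _ 2) ?nnegrE ?normc_ge0// sqr_normcE real_normK ?num_real//.
by rewrite lerDl sqr_ge0.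
Qed.

Lemma Re_le_normc z : complex.Re z <= normc z.
Proof. exact: le_trans (ler_norm _) (normr_Re_le _). Qed.

Lemma normr_Im_le z : `|complex.Im z| <= normc z.
Proof.
rewrite -(@ler_pXn2r _ 2) ?nnegrE ?normc_ge0// sqr_normcE real_normK ?num_real//.
by rewrite lerDr sqr_ge0.
Qed.

Lemma normc_le_ReIm z : normc z <= `|complex.Re z| + `|complex.Im z|.
Proof.
rewrite -(@ler_pXn2r _ 2) ?nnegrE ?normc_ge0 ?addr_ge0// sqr_normcE.
rewrite -[complex.Re z ^+ 2]real_normK ?num_real//.
rewrite -[complex.Im z ^+ 2]real_normK ?num_real// sqrrD.
by rewrite lerD2r lerDl mulrn_wge0 ?mulr_ge0.
Qed.

Lemma ReD z w : complex.Re (z + w) = complex.Re z + complex.Re w.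
Proof. by case: z w => [? ?] []. Qed.
Lemma ReN z : complex.Re (- z) = - complex.Re z.
Proof. by case: z. Qed.
Lemma ReB z w : complex.Re (z - w) = complex.Re z - complex.Re w.
Proof. by rewrite ReD ReN. Qed.
Lemma ImD z w : complex.Im (z + w) = complex.Im z + complex.Im w.
Proof. by case: z w => [? ?] []. Qed.
Lemma ImN z : complex.Im (- z) = - complex.Im z.
Proof. by case: z. Qed.
Lemma Re_conjc z : complex.Re z^* = complex.Re z.
Proof. by case: z. Qed.
Lemma Im_conjc z : complex.Im z^* = - complex.Im z.
Proof. by case: z. Qed.
Lemma Re_scale x z : complex.Re (x%:C * z) = x * complex.Re z.
Proof. by case: z => a b /=; rewrite mul0r subr0. Qed.
Lemma Im_scale x z : complex.Im (x%:C * z) = x * complex.Im z.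
Proof. by case: z => a b /=; rewrite mul0r addr0. Qed.
Lemma Re_sum (I : Type) (r : seq I) (P : pred I) (F : I -> C) :
  complex.Re (\sum_(i <- r | P i) F i) = \sum_(i <- r | P i) complex.Re (F i).
Proof. exact: (big_morph (@complex.Re R) ReD (erefl _)). Qed.

Lemma ge0_complexE z : (0 <= z) = (complex.Im z == 0) && (0 <= complex.Re z).
Proof. by rewrite lecE. Qed.

Lemma complex_eq z w :
  complex.Re z = complex.Re w -> complex.Im z = complex.Im w -> z = w.
Proof. by case: z w => [? ?] [? ?] /= -> ->. Qed.

Lemma ge0_ReE z : 0 <= z -> z = (complex.Re z)%:C.
Proof. by rewrite ge0_complexE => /andP[/eqP Iz _]; apply: complex_eq. Qed.

Lemma mul_imag : ('i : C) * 'i = -1.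
Proof. by rewrite -expr2 sqr_i. Qed.

Lemma conj_imag : ('i : C)^* = - 'i.
Proof. by apply: complex_eq; rewrite //= oppr0. Qed.

Lemma Re_imag z : complex.Re ('i * z) = - complex.Im z.
Proof.
by case: z => a b /=; rewrite mul0r sub0r mul1r.
Qed.

Lemma normc_eq0 z : normc z = 0 -> z = 0.
Proof. exact: Normc.eq0_normc. Qed.

(** The common core of the Cauchy-Schwarz inequalities below. Only the multiples w = - t z^* matter,
    and t = 1 / c is the optimal one. *)
Lemma discriminant_le (a c : R) z : 0 <= c ->
  (forall w, 0 <= a + 2 * complex.Re (w * z) + normc w ^+ 2 * c) ->
  normc z ^+ 2 <= a * c.
Proof.
move=> c0 h.
have hz (t : R) : 0 <= a - 2 * t * normc z ^+ 2 + t ^+ 2 * normc z ^+ 2 * c.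
  have := h ((- t)%:C * z^*); rewrite -[_ * _ * z]mulrA conjc_mul.
  rewrite Re_scale/= Normc.normcM normcr normc_conj exprMn real_normK ?num_real//.
  by rewrite sqrrN mulNr mulrN mulrA.
have [c_eq0|c_neq0] := eqVneq c 0.
  rewrite c_eq0 mulr0 leNgt; apply/negP => z0.
  (* For c = 0 the expression is affine in t; at this t it equals -1. *)
  have := hz ((a + 1) / (2 * normc z ^+ 2)); rewrite c_eq0 mulr0 addr0.
  have -> : 2 * ((a + 1) / (2 * normc z ^+ 2)) * normc z ^+ 2 = a + 1.
    by field; rewrite -sqrf_eq0 gt_eqF.
  by lra.
have cp : 0 < c by rewrite lt_def c_neq0.
have := hz c^-1.
have -> : a - 2 * c^-1 * normc z ^+ 2 + c^-1 ^+ 2 * normc z ^+ 2 * c =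
          (a * c - normc z ^+ 2) / c by field.
by move=> {}h; rewrite -subr_ge0 -(pmulr_lge0 _ (_ : 0 < c^-1)) ?invr_gt0.
Qed.

Lemma le_sqr x y : 0 <= x -> 0 <= y -> (x ^+ 2 <= y ^+ 2) = (x <= y).
Proof. by move=> x0 y0; rewrite ler_pXn2r. Qed.

(** The intervals of radius [r n] around [x n] meet pairwise, so the supremum of their left ends
    lies in all of them. *)
Lemma real_nested (x r : nat -> R) :
  (forall m n, `|x m - x n| <= r m + r n) ->
  exists y, forall n, `|x n - y| <= r n.
Proof.
move=> h; pose A := [set x n - r n | n in [set: nat]].
have A0 : A !=set0 by exists (x 0%N - r 0%N), 0%N.
have ub m : ubound A (x m + r m).
  move=> _ [n _ <-]; have := h n m; rewrite ler_norml => /andP[_].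
  by rewrite lerBlDr lerBlDr; lra.
have hA : has_sup A by split=> //; exists (x 0%N + r 0%N); exact: ub.
exists (sup A) => n; rewrite ler_norml; apply/andP; split.
- have : sup A <= x n + r n by apply: ge_sup => //; exact: ub.
  lra.
- have : x n - r n <= sup A by apply: ub_le_sup; [exact: hA.2|exists n].
  lra.
Qed.

Lemma complex_nested (x : nat -> C) (r : nat -> R) :
  (forall m n, normc (x m - x n) <= r m + r n) ->
  exists z, forall n, normc (x n - z) <= 2 * r n.
Proof.
move=> h.
have [a ha] : exists a, forall n, `|complex.Re (x n) - a| <= r n.
  by apply: real_nested => m n; rewrite -ReB (le_trans (normr_Re_le _)).
have [b hb] : exists b, forall n, `|complex.Im (x n) - b| <= r n.
  by apply: real_nested => m n; rewrite -ImN -ImD (le_trans (normr_Im_le _)).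
exists (a +i* b) => n; apply: le_trans (normc_le_ReIm _) _.
by rewrite ReB ImD ImN mulr_natl mulr2n lerD.
Qed.

Lemma le_of_forall_eps (x y : R) :
  (forall e, 0 < e -> x <= y + e) -> x <= y.
Proof.
by move=> h; rewrite leNgt; apply/negP => yx; have := h ((x - y) / 2); lra.
Qed.

Lemma exists_invS_lt (e : R) : 0 < e -> exists n : nat, n.+1%:R^-1 < e.
Proof.
move=> e0; have [n hn] := @ltr_add_invr R 0 e e0; exists n.
by rewrite add0r in hn.
Qed.

End complex_numbers.

Local Arguments conjc : simpl never.
Local Arguments Normc.normc : simpl never.

Section hilbert_spaces.
Context {R : realType}.
Implicit Types (H L : hilbert R).
Local Notation C := R[i].

Section inner_product.
Context {H : hilbert R}.
Implicit Types (x y z : H) (a : C).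

Lemma hdotDl x y z : hdot (x + y) z = hdot x z + hdot y z.
Proof. exact: linearDl. Qed.
Lemma hdotDr x y z : hdot z (x + y) = hdot z x + hdot z y.
Proof. exact: linearDr. Qed.
Lemma hdotZl a x y : hdot (a *: x) y = a * hdot x y.
Proof. exact: linearZl_LR. Qed.
Lemma hdotZr a x y : hdot x (a *: y) = a^* * hdot x y.
Proof. exact: linearZr_LR. Qed.
Lemma hdotNl x y : hdot (- x) y = - hdot x y.
Proof. exact: linearNl. Qed.
Lemma hdotBl x y z : hdot (x - y) z = hdot x z - hdot y z.
Proof. exact: linearBl. Qed.
Lemma hdotBr x y z : hdot z (x - y) = hdot z x - hdot z y.
Proof. exact: linearBr. Qed.
Lemma hdot0l y : hdot 0 y = 0.
Proof. exact: linear0l. Qed.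
Lemma hdot0r y : hdot y 0 = 0.
Proof. exact: linear0r. Qed.
Lemma hdot_suml I (r : seq I) (P : pred I) (F : I -> H) y :
  hdot (\sum_(i <- r | P i) F i) y = \sum_(i <- r | P i) hdot (F i) y.
Proof. exact: linear_sumlz. Qed.
Lemma hdot_sumr I (r : seq I) (P : pred I) (F : I -> H) y :
  hdot y (\sum_(i <- r | P i) F i) = \sum_(i <- r | P i) hdot y (F i).
Proof. exact: linear_sumr. Qed.
Lemma hdotC x y : hdot y x = (hdot x y)^*.
Proof. by rewrite hermC /= expr0 mul1r. Qed.

Lemma hnormE x : `|x| = (hnorm x)%:C.
Proof. by rewrite /hnorm -ge0_ReE. Qed.

Lemma hdotxx x : hdot x x = (hnorm x ^+ 2)%:C.
Proof. by rewrite hdotE hnormE rmorphXn. Qed.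

Lemma hnorm_ge0 x : 0 <= hnorm x.
Proof. by rewrite -ler0c -hnormE. Qed.
Lemma hnorm0 : hnorm (0 : H) = 0.
Proof. by rewrite /hnorm normr0. Qed.
Lemma hnorm0_eq0 x : hnorm x = 0 -> x = 0.
Proof. by move=> h; apply/eqP; rewrite -normr_eq0 hnormE h. Qed.
Lemma hnormZ a x : hnorm (a *: x) = normc a * hnorm x.
Proof. by apply: (@complexI R); rewrite rmorphM/= -!hnormE normrZ. Qed.
Lemma ler_hnormD x y : hnorm (x + y) <= hnorm x + hnorm y.
Proof. by rewrite -lecR rmorphD/= -!hnormE ler_normD. Qed.
Lemma hnorm_opp x : hnorm (- x) = hnorm x.
Proof. by rewrite /hnorm normrN. Qed.
Lemma hnormBC x y : hnorm (x - y) = hnorm (y - x).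
Proof. by rewrite -hnorm_opp opprB. Qed.
Lemma sqr_hnorm x : hnorm x ^+ 2 = complex.Re (hdot x x).
Proof. by rewrite hdotxx. Qed.

Lemma sqr_hnormD x y :
  hnorm (x + y) ^+ 2 = hnorm x ^+ 2 + 2 * complex.Re (hdot x y) + hnorm y ^+ 2.
Proof.
rewrite !sqr_hnorm hdotDl !hdotDr [hdot y x]hdotC !ReD Re_conjc; lra.
Qed.

Lemma Cauchy_Schwarz x y : normc (hdot x y) <= hnorm x * hnorm y.
Proof.
rewrite -(@ler_pXn2r _ 2) ?nnegrE ?normc_ge0 ?mulr_ge0 ?hnorm_ge0// exprMn.
apply: discriminant_le; rewrite ?sqr_ge0// => w.
have := sqr_ge0 (hnorm (x + w^* *: y)).
by rewrite sqr_hnormD hdotZr conjcK hnormZ normc_conj exprMn.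
Qed.

Lemma hdot_injl x y : (forall z, hdot x z = hdot y z) -> x = y.
Proof.
move=> h; apply/eqP; rewrite -subr_eq0; apply/eqP/hnorm0_eq0/eqP.
by rewrite -sqrf_eq0 sqr_hnorm hdotBl h subrr.
Qed.

Lemma hdot_injr x y : (forall z, hdot z x = hdot z y) -> x = y.
Proof. by move=> h; apply: hdot_injl => z; rewrite hdotC h -hdotC. Qed.

(** Completeness with an explicit rate that the limit inherits; with it, [Riesz] and the extension
    of maps to C^*(G) need no filters. *)
Lemma hilbert_nested (x : nat -> H) :
  (forall m n, hnorm (x m - x n) <= m.+1%:R^-1 + n.+1%:R^-1) ->
  exists l, forall n, hnorm (x n - l) <= n.+1%:R^-1.
Proof.
move=> h.
have xcvg : cvg (x @ \oo).
  apply/cauchy_cvgP/cauchy_exP => e egt0.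
  have e0 : 0 < complex.Re e :> R by move: egt0; rewrite ltcE => /andP[].
  have eE : e = (complex.Re e)%:C by exact/ge0_ReE/ltW.
  have [N hN] := exists_invS_lt (divr_gt0 e0 (ltr0n R 2)).
  exists (x N); exists N => // n /= Nn.
  rewrite -ball_normE/= hnormE eE ltcR (le_lt_trans (h N n))//.
  have : n.+1%:R^-1 <= N.+1%:R^-1 :> R by rewrite lef_pV2 ?posrE// ler_nat.
  by move: hN; set a : R := N.+1%:R^-1; set b : R := n.+1%:R^-1; lra.
exists (lim (x @ \oo)) => n; apply: le_of_forall_eps => e e0.
have e20 : 0 < e / 2 by rewrite divr_gt0.
have ec : 0 < (e / 2)%:C :> C by rewrite ltcR.
have /cvgrPdist_lt/(_ _ ec)[N _ hN] := xcvg.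
have [N' hN'] := exists_invS_lt e20.
pose m := maxn N N'.
have := hN m (leq_maxl _ _); rewrite /= hnormE ltcR => hm.
have hN'm : m.+1%:R^-1 <= N'.+1%:R^-1 :> R.
  by rewrite lef_pV2 ?posrE// ler_nat ltnS leq_maxr.
rewrite -(subrK (x m) (x n)) -addrA (le_trans (ler_hnormD _ _))//.
rewrite (le_trans (lerD (h n m) (lexx _)))// hnormBC.
move: hN' hN'm hm; set a : R := N'.+1%:R^-1; set b : R := m.+1%:R^-1.
set c : R := n.+1%:R^-1; lra.
Qed.

End inner_product.

Section bounded_operators.
Context {H : hilbert R}.
Implicit Types (S T : bop H) (x y : H) (a : C).

Lemma bop_linear T a x y : T (a *: x + y) = a *: T x + T y.
Proof. exact: (bopP T).1. Qed.
Lemma bopDr T x y : T (x + y) = T x + T y.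
Proof. by have := bop_linear T 1 x y; rewrite !scale1r. Qed.
Lemma bop0r T : T 0 = 0.
Proof. by have := bopDr T 0 0; rewrite addr0 => /esym/eqP; rewrite -subr_eq0 addrK => /eqP. Qed.
Lemma bopZr T a x : T (a *: x) = a *: T x.
Proof. by have := bop_linear T a x 0; rewrite bop0r !addr0. Qed.
Lemma bopNr T x : T (- x) = - T x.
Proof. by rewrite -scaleN1r bopZr scaleN1r. Qed.
Lemma bopBr T x y : T (x - y) = T x - T y.
Proof. by rewrite bopDr bopNr. Qed.
Lemma bop_sumr T I (r : seq I) (P : pred I) (F : I -> H) :
  T (\sum_(i <- r | P i) F i) = \sum_(i <- r | P i) T (F i).
Proof. exact: (big_morph _ (bopDr T) (bop0r T)). Qed.

Lemma bopDE S T x : (S + T) x = S x + T x. Proof. by []. Qed.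
Lemma bopBE S T x : (S - T) x = S x - T x. Proof. by []. Qed.
Lemma bopNE T x : (- T) x = - T x. Proof. by []. Qed.
Lemma bopZE a T x : (a *: T) x = a *: T x. Proof. by []. Qed.
Lemma bopME S T x : (S * T) x = S (T x). Proof. by []. Qed.
Lemma bop1E x : (1 : bop H) x = x. Proof. by []. Qed.
Lemma bop0E x : (0 : bop H) x = 0. Proof. by []. Qed.
Lemma bop_sumE I (r : seq I) (P : pred I) (F : I -> bop H) x :
  (\sum_(i <- r | P i) F i) x = \sum_(i <- r | P i) F i x.
Proof. exact: (big_morph (fun T : bop H => T x) (fun _ _ => erefl) erefl). Qed.

Lemma bop_bounded T : exists2 M : R, 0 <= M & forall x, hnorm (T x) <= M * hnorm x.
Proof.
have [Tl Tc] := bopP T.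
pose f : {linear H -> H} := HB.pack (bop_fun T)
  (GRing.isLinear.Build _ _ _ _ (bop_fun T) Tl).
have /linear_boundedP[M [Mr hM]] : bounded_near f (nbhs 0).
  by apply/linear_bounded_continuous => x; exact: Tc.
(* [linear_boundedP] gives the bound only for numbers strictly above [M], hence the [+ 1]; the
   absolute value makes [M'] nonnegative. *)
pose M' := `|complex.Re M| + 1.
exists M'; first by rewrite addr_ge0.
move=> x; have := hM M'%:C; rewrite -lecR rmorphM/= -!hnormE; apply.
rewrite (_ : M = (complex.Re M)%:C); last by rewrite RRe_real.
by rewrite ltcR ltr_pwDr// ler_norm.
Qed.

Lemma bounded_bop (f : H -> H) (M : R) : linear f ->
  (forall x, hnorm (f x) <= M * hnorm x) -> exists T : bop H, forall x, T x = f x.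
Proof.
move=> fl hf.
pose F : {linear H -> H} := HB.pack f (GRing.isLinear.Build _ _ _ _ f fl).
have Fc : continuous F.
  apply: bounded_linear_continuous; apply/linear_boundedP.
  exists M%:C; split; first by apply/complex_realP; exists M.
  move=> r; rewrite ltcE => /andP[/eqP Ir hr] x.
  have -> : r = (complex.Re r)%:C by apply: complex_eq.
  rewrite !hnormE -rmorphM lecR (le_trans (hf x))// ler_wpM2r ?hnorm_ge0//.
  exact: ltW.
have sf : f \in @is_bop R H by apply/asboolP.
by exists (Bop sf).
Qed.

End bounded_operators.

End hilbert_spaces.

(** * Reproducing kernel Hilbert spaces *)

Section kernels.
Context {R : realType} {X : Type}.
Local Notation C := R[i].
Implicit Types (k : X -> X -> C) (f : X -> C) (v w : seq (C * X)) (a : C).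

(* Formal linear combinations of points of [X] are represented by lists;
   [lin_ext f] is the conjugate-linear extension of [f]. *)
Definition lin_ext f v : C := \sum_(p <- v) p.1^* * f p.2.

Definition scale_comb a v : seq (C * X) := [seq (a * p.1, p.2) | p <- v].

Definition kform k v w : C := \sum_(p <- v) \sum_(q <- w) p.1 * q.1^* * k p.2 q.2.

Definition psd_kernel k := forall v, 0 <= kform k v v.

Definition kbounded k f (M : R) :=
  forall v, normc (lin_ext f v) ^+ 2 <= M * complex.Re (kform k v v).

Lemma lin_ext_cat f v w : lin_ext f (v ++ w) = lin_ext f v + lin_ext f w.
Proof. exact: big_cat. Qed.

Lemma lin_ext_scale a f v : lin_ext f (scale_comb a v) = a^* * lin_ext f v.
Proof.
rewrite /lin_ext big_map mulr_sumr; apply: eq_bigr => p _ /=.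
by rewrite rmorphM mulrA.
Qed.

Lemma lin_extD f g v : lin_ext (f \+ g) v = lin_ext f v + lin_ext g v.
Proof. by rewrite -big_split; apply: eq_bigr => p _; rewrite mulrDr. Qed.

Lemma lin_extZ a f v : lin_ext (fun x => a * f x) v = a * lin_ext f v.
Proof. by rewrite mulr_sumr; apply: eq_bigr => p _; rewrite mulrCA. Qed.

Lemma lin_extB f g v : lin_ext (fun x => f x - g x) v = lin_ext f v - lin_ext g v.
Proof. by rewrite -sumrB; apply: eq_bigr => p _; rewrite mulrBr. Qed.

Lemma kformE k v w :
  kform k v w = lin_ext (fun y => \sum_(p <- v) p.1 * k p.2 y) w.
Proof.
rewrite /kform exchange_big; apply: eq_bigr => q _; rewrite mulr_sumr.
by apply: eq_bigr => p _; rewrite mulrAC mulrC mulrA.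
Qed.

Lemma kform_catl k v1 v2 w : kform k (v1 ++ v2) w = kform k v1 w + kform k v2 w.
Proof. exact: big_cat. Qed.

Lemma kform_catr k v w1 w2 : kform k v (w1 ++ w2) = kform k v w1 + kform k v w2.
Proof. by rewrite !kformE lin_ext_cat. Qed.

Lemma kform_scaler k a v w : kform k v (scale_comb a w) = a^* * kform k v w.
Proof. by rewrite !kformE lin_ext_scale. Qed.

Lemma kform_scalel k a v w : kform k (scale_comb a v) w = a * kform k v w.
Proof.
rewrite /kform big_map mulr_sumr; apply: eq_bigr => p _ /=.
by rewrite mulr_sumr; apply: eq_bigr => q _; rewrite !mulrA.
Qed.

(** The quadratic form is real at the combination of x and c y for every complex c; c = 1 and c = 'i
    give the two real equations. *)
Lemma psd_kernel_herm k : psd_kernel k -> forall x y, k y x = (k x y)^*.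
Proof.
move=> kp x y.
have real_k z : complex.Im (k z z) = 0.
  have := kp [:: (1, z)]; rewrite /kform !big_seq1 /= ge0_complexE.
  by rewrite conj1 !mul1r => /andP[/eqP].
have h (c : C) : complex.Im (c^* * k x y + c * k y x) = 0.
  have := kp [:: (1, x); (c, y)]; rewrite ge0_complexE => /andP[/eqP + _].
  rewrite /kform !big_cons !big_nil !addr0 /= conj1 mulr1 !mul1r mulr1.
  by rewrite mul_conjc !ImD Im_scale !real_k mulr0; lra.
have := h 1; have := h 'i; rewrite conj1 !mul1r.
case: (k x y) (k y x) => a b [c d] /= h1 h2; apply: complex_eq => /=; lra.
Qed.

Lemma kform_herm k v w : psd_kernel k -> kform k w v = (kform k v w)^*.
Proof.
move=> kp; rewrite /kform exchange_big rmorph_sum/=; apply: eq_bigr => p _.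
rewrite rmorph_sum/=; apply: eq_bigr => q _.
by rewrite !rmorphM/= conjcK -psd_kernel_herm// [q.1 * _]mulrC.
Qed.

Lemma Re_kform_ge0 k v : psd_kernel k -> 0 <= complex.Re (kform k v v).
Proof. by move=> kp; have := kp v; rewrite ge0_complexE => /andP[]. Qed.

Lemma kform_CS k v w : psd_kernel k ->
  normc (kform k v w) ^+ 2 <= complex.Re (kform k v v) * complex.Re (kform k w w).
Proof.
move=> kp; apply: discriminant_le; first exact: Re_kform_ge0.
move=> c; have := Re_kform_ge0 (v ++ scale_comb c^* w) kp.
rewrite kform_catl !kform_catr !kform_scaler !kform_scalel conjcK.
rewrite mulrA [c * c^*]mul_conjc !ReD Re_scale.
have -> : complex.Re (c^* * kform k w v) = complex.Re (c * kform k v w).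
  by rewrite (kform_herm _ _ kp) -rmorphM Re_conjc.
set A := complex.Re _; set B := complex.Re _; set D := complex.Re _; lra.
Qed.

(* Minimising [|v|^2 - 2 Re (f v)] over the formal combinations [v]: at an
   [e]-almost minimiser the first variation is small. *)
Lemma kernel_approx k f M (e : R) : psd_kernel k -> kbounded k f M -> 0 < e ->
  exists v, forall w,
    normc (kform k v w - lin_ext f w) ^+ 2 <= e * complex.Re (kform k w w).
Proof.
move=> kp fM e0.
pose J v := complex.Re (kform k v v) - 2 * complex.Re (lin_ext f v).
(* With n = |f v| and q the form at v, the inequality n^2 <= |M| q implies 2 n <= q + |M|
   (arithmetic and geometric means). *)
have Jge v : - `|M| <= J v.
  have q0 := Re_kform_ge0 v kp; have n0 := normc_ge0 (lin_ext f v).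
  have := fM v; have := Re_le_normc (lin_ext f v); rewrite /J.
  move: q0 n0; set q := complex.Re (kform _ _ _); set n := normc _.
  set r := complex.Re _ => q0 n0 rn nM.
  have MM : M * q <= `|M| * q by rewrite ler_wpM2r// ler_norm.
  have := sqr_ge0 (q - `|M|); have := normr_ge0 M; set m := `|M| in MM * => m0.
  rewrite leNgt => h; apply/negP => h'.
  have : n ^+ 2 <= m * q by lra.
  have : q + m < 2 * n by lra.
  move=> h1 h2; have : (q + m) ^+ 2 < (2 * n) ^+ 2.
    by rewrite ltr_pXn2r// nnegrE; lra.
  by move: h; rewrite sqrrB sqrrD exprMn; nra.
pose A := [set - J v | v in [set: seq (C * X)]].
have hA : has_sup A.
  split; first by exists (- J [::]), [::].
  by exists `|M| => _ [v _ <-]; rewrite lerNl.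
have [_ [v _ <-] hv] := sup_adherent e0 hA; exists v => w.
apply: discriminant_le; first exact: Re_kform_ge0.
move=> c; have : - J (v ++ scale_comb c^* w) <= sup A.
  by apply: ub_le_sup; [exact: hA.2|exists (v ++ scale_comb c^* w)].
move=> h; have {}h := le_lt_trans h (_ : sup A < - J v + e).
have {h} : - J (v ++ scale_comb c^* w) < - J v + e by apply: h; lra.
rewrite /J kform_catl !kform_catr !kform_scaler !kform_scalel conjcK lin_ext_cat.
rewrite lin_ext_scale conjcK.
rewrite [_ * (_ * kform k w w)]mulrA [c * c^*]mul_conjc mulrBr !ReD ReN Re_scale.
have -> : complex.Re (c^* * kform k w v) = complex.Re (c * kform k v w).
  by rewrite (kform_herm _ _ kp) -rmorphM Re_conjc.
set a1 := complex.Re _; set a2 := complex.Re _; set a3 := complex.Re _.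
set a4 := complex.Re _; set a5 := complex.Re _; lra.
Qed.

End kernels.

(** * The Riesz representation theorem and adjoints *)

Section Riesz.
Context {R : realType} {H : hilbert R}.
Local Notation C := R[i].

Lemma kform_hdot (v w : seq (C * H)) :
  kform (fun x y => hdot x y) v w =
  hdot (\sum_(p <- v) p.1 *: p.2) (\sum_(p <- w) p.1 *: p.2).
Proof.
rewrite hdot_suml; apply: eq_bigr => p _; rewrite hdot_sumr.
by apply: eq_bigr => q _; rewrite hdotZl hdotZr mulrA.
Qed.

Lemma psd_hdot : psd_kernel (fun x y : H => hdot x y).
Proof. by move=> v; rewrite kform_hdot hdotxx ler0c sqr_ge0. Qed.

(** The inner product is itself a positive kernel on H, so [kernel_approx] yields vectors
    representing f up to 1 / (n + 1). They form a Cauchy sequence, because the squared norm of a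
    difference is its pairing with itself. *)
Lemma Riesz (f : H -> C) (M : R) :
  (forall a x y, f (a *: x + y) = a^* * f x + f y) ->
  (forall x, normc (f x) <= M * hnorm x) ->
  exists v, forall x, f x = hdot v x.
Proof.
move=> fl fM.
have f0 : f 0 = 0.
  by apply: normc_eq0; apply: le_anti; rewrite normc_ge0 (le_trans (fM _))// hnorm0 mulr0.
have fD x y : f (x + y) = f x + f y by have := fl 1 x y; rewrite scale1r conj1 mul1r.
have fZ a x : f (a *: x) = a^* * f x by have := fl a x 0; rewrite f0 !addr0.
have fE v : lin_ext f v = f (\sum_(p <- v) p.1 *: p.2).
  by rewrite (big_morph f fD f0); apply: eq_bigr => p _; rewrite fZ.
have fb : kbounded (fun x y => hdot x y) f (M ^+ 2).
  move=> v; rewrite fE kform_hdot -sqr_hnorm -exprMn ler_pXn2r ?nnegrE ?normc_ge0//.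
  by apply: le_trans (fM _); exact: normc_ge0.
have hap (n : nat) : exists y, forall x, normc (hdot y x - f x) <= n.+1%:R^-1 * hnorm x.
  have e0 : 0 < (n.+1%:R^-1 : R) ^+ 2 by rewrite exprn_gt0.
  have [v hv] := kernel_approx psd_hdot fb e0.
  exists (\sum_(p <- v) p.1 *: p.2) => x.
  have := hv [:: (1, x)]; rewrite fE !kform_hdot !big_seq1 /= !scale1r -sqr_hnorm.
  rewrite -exprMn ler_pXn2r ?nnegrE ?normc_ge0 ?mulr_ge0 ?hnorm_ge0//.
have [y hy] := choice hap.
have [l hl] : exists l, forall n, hnorm (y n - l) <= n.+1%:R^-1.
  apply: hilbert_nested => m n; set d := y m - y n.
  have [->|d0] := eqVneq (hnorm d) 0; first by rewrite addr_ge0.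
  have dp : 0 < hnorm d by rewrite lt_def d0 hnorm_ge0.
  rewrite -(ler_pM2r dp) -expr2 sqr_hnorm {1}/d hdotBl.
  have -> : hdot (y m) d - hdot (y n) d = (hdot (y m) d - f d) - (hdot (y n) d - f d) by ring.
  rewrite (le_trans (Re_le_normc _))// (le_trans (le_normcD _ _))// normcN mulrDl.
  by rewrite lerD.
exists l => x; apply/eqP; rewrite -subr_eq0; apply/eqP/normc_eq0.
apply: le_anti; rewrite normc_ge0 andbT; apply: le_of_forall_eps => e e0.
have [n hn] : exists n : nat, n.+1%:R^-1 < e / (2 * (hnorm x + 1)).
  by apply: exists_invS_lt; rewrite divr_gt0// mulr_gt0// ltr_wpDl ?hnorm_ge0.
have -> : f x - hdot l x = hdot (y n - l) x - (hdot (y n) x - f x) by rewrite hdotBl; ring.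
rewrite (le_trans (le_normcD _ _))// normcN add0r.
have h1 := hy n x.
have h2 : normc (hdot (y n - l) x) <= n.+1%:R^-1 * hnorm x.
  by rewrite (le_trans (Cauchy_Schwarz _ _))// ler_wpM2r ?hnorm_ge0.
rewrite (le_trans (lerD h2 h1))//.
have hx := hnorm_ge0 x; have hx1 : 0 < 2 * (hnorm x + 1) by lra.
move: hn; rewrite ltr_pdivlMr//; set a := n.+1%:R^-1 => hn.
have a0 : 0 < a by rewrite invr_gt0.
lra.
Qed.

Lemma form_bop (B : H -> H -> C) (M : R) : 0 <= M ->
  (forall a x y z, B (a *: x + y) z = a * B x z + B y z) ->
  (forall a x y z, B z (a *: x + y) = a^* * B z x + B z y) ->
  (forall x y, normc (B x y) <= M * hnorm x * hnorm y) ->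
  exists T : bop H, forall x y, hdot (T x) y = B x y.
Proof.
move=> M0 Bl Br Bb.
have hf x : exists v, forall y, B x y = hdot v y.
  by apply: (@Riesz _ (M * hnorm x)) => // a y z; exact: Br.
have [f {}hf] := choice hf.
have fl : linear f.
  by move=> a x y; apply: hdot_injl => z; rewrite hdotDl hdotZl -!hf Bl.
have fb x : hnorm (f x) <= M * hnorm x.
  have [->|d0] := eqVneq (hnorm (f x)) 0; first by rewrite mulr_ge0 ?hnorm_ge0.
  have dp : 0 < hnorm (f x) by rewrite lt_def d0 hnorm_ge0.
  rewrite -(ler_pM2r dp) -expr2 sqr_hnorm -hf.
  by rewrite (le_trans (Re_le_normc _)).
have [T hT] := bounded_bop fl fb.
by exists T => x y; rewrite hT -hf.
Qed.

Lemma adjP (T : bop H) x y : hdot (T x) y = hdot x (adj T y).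
Proof.
have [M M0 hM] := bop_bounded T.
have [S hS] : exists S : bop H, forall x y, hdot (S x) y = hdot x (T y).
  apply: (@form_bop _ M) => //.
  - by move=> a u v z; rewrite hdotDl hdotZl.
  - by move=> a u v z; rewrite bop_linear hdotDr hdotZr.
  - move=> u v; rewrite (le_trans (Cauchy_Schwarz _ _))// -mulrA mulrCA.
    by rewrite ler_wpM2l ?hnorm_ge0.
have : [set S : bop H | forall x y, hdot (T x) y = hdot x (S y)] (adj T).
  by apply: xgetPex; exists S => u v; rewrite hdotC -hS -hdotC.
exact.
Qed.

End Riesz.

Section rkhs.
Context {R : realType} {X : Type} (k : X -> X -> R[i]).
Local Notation C := R[i].

Definition knorm v : R := Num.sqrt (complex.Re (kform k v v)).
Local Notation q := knorm.

Lemma sqr_knorm v : psd_kernel k -> q v ^+ 2 = complex.Re (kform k v v).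
Proof. by move=> kp; rewrite sqr_sqrtr// Re_kform_ge0. Qed.

(** The Hilbert space of a kernel is realised as the dual of the formal combinations: the functions
    whose conjugate-linear extension is bounded for the seminorm of [k]. Null vectors disappear and
    completeness is that of a dual. *)
Definition is_kbounded : {pred X -> C^o} :=
  fun f => `[< exists M, kbounded k f M >].

(* Without the positivity of [k] the norm below would not be one. *)
Record rkhs (kp : psd_kernel k) := Rkhs {
  rkhs_fun :> X -> C^o;
  rkhs_subproof : rkhs_fun \in is_kbounded }.

Context {kp : psd_kernel k}.

HB.instance Definition _ := [isSub for @rkhs_fun kp].
HB.instance Definition _ := gen_eqMixin (rkhs kp).
HB.instance Definition _ := gen_choiceMixin (rkhs kp).

Lemma kboundedP f (M : R) : 0 <= M ->
  kbounded k f (M ^+ 2) <-> forall v, normc (lin_ext f v) <= M * q v.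
Proof.
have E v : 0 <= M -> (normc (lin_ext f v) ^+ 2 <= M ^+ 2 * complex.Re (kform k v v)) =
           (normc (lin_ext f v) <= M * q v).
  move=> M0; rewrite -[RHS]le_sqr ?normc_ge0 ?mulr_ge0 ?sqrtr_ge0//.
  by rewrite exprMn (sqr_knorm _ kp).
by move=> M0; split=> h v; [rewrite -E|rewrite E].
Qed.

Lemma kbounded_ge0 f M : kbounded k f M -> exists2 M', 0 <= M' & kbounded k f (M' ^+ 2).
Proof.
move=> h; exists (Num.sqrt `|M|) => // v; rewrite sqr_sqrtr//.
by rewrite (le_trans (h v))// ler_wpM2r ?Re_kform_ge0// ler_norm.
Qed.

Lemma is_kboundedP (f : X -> C^o) : f \in is_kbounded <->
  exists2 M, 0 <= M & forall v, normc (lin_ext f v) <= M * q v.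
Proof.
split=> [/asboolP[M /kbounded_ge0[M' M'0]]|[M M0 /(kboundedP _ M0) h]].
  by move=> /(kboundedP _ M'0); exists M'.
by apply/asboolP; exists (M ^+ 2).
Qed.

Fact is_kbounded_submod : submod_closed is_kbounded.
Proof.
split=> [|a f g /is_kboundedP[M M0 hM] /is_kboundedP[N N0 hN]]; apply/is_kboundedP.
  exists 0 => // v; rewrite mul0r (_ : lin_ext _ _ = 0) ?Normc.normc0//.
  by rewrite /lin_ext big1// => p _; rewrite mulr0.
exists (normc a * M + N); first by rewrite addr_ge0 ?mulr_ge0 ?normc_ge0.
move=> v; rewrite lin_extD (lin_extZ a f) (le_trans (le_normcD _ _))//.
by rewrite Normc.normcM mulrDl -mulrA lerD// ler_wpM2l ?normc_ge0.
Qed.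

HB.instance Definition _ :=
  GRing.isSubmodClosed.Build R[i] (X -> C^o) is_kbounded is_kbounded_submod.
HB.instance Definition _ := [SubChoice_isSubLmodule of rkhs kp by <:].

Implicit Types (f g : rkhs kp) (v w : seq (C * X)).

Lemma rkhs_ext f g : f =1 g -> f = g.
Proof. by move=> fg; apply/val_inj/funext. Qed.

Definition rkhs_norm f : R :=
  inf [set M : R | 0 <= M /\ forall v, normc (lin_ext f v) <= M * q v].

Let bounds f : has_inf [set M : R | 0 <= M /\ forall v, normc (lin_ext f v) <= M * q v].
Proof.
split; last by exists 0 => M [].
by have /is_kboundedP[M M0 hM] := rkhs_subproof f; exists M.
Qed.

Lemma rkhs_norm_ge0 f : 0 <= rkhs_norm f.
Proof. by apply: lb_le_inf; [exact: (bounds f).1|move=> M []]. Qed.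

Lemma rkhs_norm_le f M : 0 <= M -> (forall v, normc (lin_ext f v) <= M * q v) ->
  rkhs_norm f <= M.
Proof. by move=> M0 hM; apply: ge_inf => //; exact: (bounds f).2. Qed.

Lemma rkhs_normP f v : normc (lin_ext f v) <= rkhs_norm f * q v.
Proof.
(* Where the seminorm vanishes one cannot divide by it, but any single bound already makes the
   left-hand side vanish. *)
have [qv0|qv0] := eqVneq (q v) 0.
  have /is_kboundedP[M M0 hM] := rkhs_subproof f.
  by have := hM v; rewrite qv0 !mulr0.
have qp : 0 < q v by rewrite lt_def qv0 sqrtr_ge0.
rewrite -ler_pdivrMr//; apply: lb_le_inf; first exact: (bounds f).1.
by move=> M [M0 hM] ; rewrite ler_pdivrMr.
Qed.

Lemma rkhs_normD f g : rkhs_norm (f + g) <= rkhs_norm f + rkhs_norm g.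
Proof.
apply: rkhs_norm_le => [|v]; first by rewrite addr_ge0 ?rkhs_norm_ge0.
rewrite (_ : lin_ext _ _ = lin_ext f v + lin_ext g v); last exact: lin_extD.
by rewrite (le_trans (le_normcD _ _))// mulrDl lerD ?rkhs_normP.
Qed.

Let normZ_le a f : rkhs_norm (a *: f) <= normc a * rkhs_norm f.
Proof.
apply: rkhs_norm_le => [|v]; first by rewrite mulr_ge0 ?normc_ge0 ?rkhs_norm_ge0.
rewrite (_ : lin_ext _ _ = a * lin_ext f v); last exact: lin_extZ.
by rewrite Normc.normcM -mulrA ler_wpM2l ?normc_ge0 ?rkhs_normP.
Qed.

Lemma rkhs_normZ a f : rkhs_norm (a *: f) = normc a * rkhs_norm f.
Proof.
apply/le_anti; rewrite normZ_le/=.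
have [->|a0] := eqVneq a 0; first by rewrite Normc.normc0 mul0r rkhs_norm_ge0.
have na : 0 < normc a.
  by rewrite lt_def normc_ge0 andbT; apply: contra_neq a0; exact: normc_eq0.
rewrite -ler_pdivlMl//; have := normZ_le a^-1 (a *: f).
by rewrite scalerA mulVf// scale1r Normc.normcV.
Qed.

Let lin_ext1 f x : lin_ext f [:: (1, x)] = f x.
Proof. by rewrite /lin_ext big_seq1 conj1 mul1r. Qed.

Lemma rkhs_norm0_eq0 f : rkhs_norm f = 0 -> f = 0.
Proof.
move=> f0; apply: rkhs_ext => x; apply: normc_eq0.
by apply: le_anti; rewrite normc_ge0 -lin_ext1 (le_trans (rkhs_normP _ _))// f0 mul0r.
Qed.

Let normC_D f g :
  (rkhs_norm (f + g))%:C <= (rkhs_norm f)%:C + (rkhs_norm g)%:C :> C.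
Proof. by rewrite -rmorphD lecR rkhs_normD. Qed.

Let normC_Z (a : C) f : (rkhs_norm (a *: f))%:C = `|a| * (rkhs_norm f)%:C :> C.
Proof. by rewrite rkhs_normZ rmorphM. Qed.

Let normC_eq0 f : (rkhs_norm f)%:C = 0 :> C -> f = 0.
Proof. by move=> /complexI/rkhs_norm0_eq0. Qed.

HB.instance Definition _ :=
  @Lmodule_isNormed.Build R[i] (rkhs kp) _ normC_D normC_Z normC_eq0.

Lemma rkhs_normrE f : `|f| = (rkhs_norm f)%:C. Proof. by []. Qed.

Lemma rkhs_normBC f g : rkhs_norm (f - g) = rkhs_norm (g - f).
Proof. by apply: (@complexI R); rewrite -!rkhs_normrE distrC. Qed.

Let lin_ext0 f : lin_ext f [::] = 0. Proof. exact: big_nil. Qed.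

Lemma rkhs_nested (f : nat -> rkhs kp) :
  (forall m n, rkhs_norm (f m - f n) <= m.+1%:R^-1 + n.+1%:R^-1) ->
  exists l, forall n, rkhs_norm (f n - l) <= n.+1%:R^-1.
Proof.
move=> h.
have hv m n v : normc (lin_ext (f m) v - lin_ext (f n) v) <=
    (m.+1%:R^-1 + n.+1%:R^-1) * q v.
  have -> : lin_ext (f m) v - lin_ext (f n) v = lin_ext (f m - f n) v.
    by rewrite -lin_extB.
  by rewrite (le_trans (rkhs_normP _ _))// ler_wpM2r ?sqrtr_ge0.
have hz x : exists z, forall n, normc (f n x - z) <= 2 * (n.+1%:R^-1 * q [:: (1, x)]).
  by apply: complex_nested => m n; rewrite -!lin_ext1 -mulrDl.
have [z {}hz] := choice hz.
(* These constants depend on [v] and are not the final ones: they only allow m to tend to infinity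
   in [hv], which gives the uniform bound [fz]. *)
have zv v : exists2 K : R, 0 <= K &
    forall n, normc (lin_ext (f n) v - lin_ext z v) <= K * n.+1%:R^-1.
  elim: v => [|p v [K K0 hK]].
    by exists 0 => // n; rewrite lin_ext0 /lin_ext big_nil subrr Normc.normc0 mul0r.
  exists (normc p.1 * (2 * q [:: (1, p.2)]) + K).
    by rewrite addr_ge0 ?mulr_ge0 ?normc_ge0 ?sqrtr_ge0.
  move=> n; rewrite /lin_ext !big_cons -/(lin_ext _ _) -/(lin_ext z v).
  have -> : p.1^* * f n p.2 + lin_ext (f n) v - (p.1^* * z p.2 + lin_ext z v) =
            p.1^* * (f n p.2 - z p.2) + (lin_ext (f n) v - lin_ext z v) by ring.
  rewrite (le_trans (le_normcD _ _))// mulrDl lerD// Normc.normcM normc_conj.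
  by rewrite -!mulrA ler_wpM2l ?normc_ge0// (le_trans (hz _ _))// [_^-1 * _]mulrC.
have fz n v : normc (lin_ext (f n) v - lin_ext z v) <= n.+1%:R^-1 * q v.
  have [K K0 hK] := zv v; apply: le_of_forall_eps => e e0.
  have [m hm] : exists m : nat, m.+1%:R^-1 < e / (K + q v + 1).
    by apply: exists_invS_lt; rewrite divr_gt0// ltr_wpDl// addr_ge0 ?sqrtr_ge0.
  have -> : lin_ext (f n) v - lin_ext z v = (lin_ext (f n) v - lin_ext (f m) v) +
     (lin_ext (f m) v - lin_ext z v) by ring.
  rewrite (le_trans (le_normcD _ _))// (le_trans (lerD (hv n m v) (hK m)))//.
  rewrite mulrDl -addrA lerD2l.
  have q0 : 0 <= q v by exact: sqrtr_ge0.
  move: hm; rewrite ltr_pdivlMr; last by rewrite ltr_wpDl// addr_ge0.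
  set a := m.+1%:R^-1; have a0 : 0 < a by rewrite invr_gt0.
  move=> hm; nra.
have zb : (z : X -> C^o) \in is_kbounded.
  apply/is_kboundedP; exists (rkhs_norm (f 0%N) + 1); first by rewrite addr_ge0 ?rkhs_norm_ge0.
  move=> v; have -> : lin_ext z v = lin_ext (f 0%N) v - (lin_ext (f 0%N) v - lin_ext z v) by ring.
  rewrite (le_trans (le_normcD _ _))// normcN mulrDl lerD ?rkhs_normP//.
  by rewrite (le_trans (fz _ _))// invr1.
exists (Rkhs kp zb) => n; apply: rkhs_norm_le => [|v]; first by rewrite invr_ge0.
rewrite (le_trans _ (fz n v))//.
by rewrite (_ : lin_ext (f n - _) v = lin_ext (f n) v - lin_ext z v)// -lin_extB.
Qed.

Lemma rkhs_complete (F : set_system (rkhs kp)) : ProperFilter F -> cauchy F -> cvg F.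
Proof.
move=> FF /cauchyP Fc.
have hf (n : nat) : exists f : rkhs kp, F [set g | rkhs_norm (f - g) < n.+1%:R^-1].
  have e0 : 0 < (n.+1%:R^-1)%:C :> C by rewrite ltcR.
  have [f Ff] := Fc _ e0; exists f.
  by apply: filterS Ff => g; rewrite -ball_normE/= rkhs_normrE ltcR.
have [f {}hf] := choice hf.
have [l hl] : exists l, forall n, rkhs_norm (f n - l) <= n.+1%:R^-1.
  apply: rkhs_nested => m n.
  have [g [/= gm gn]] := @filter_ex _ _ FF _ (filterI (hf m) (hf n)).
  have -> : f m - f n = (f m - g) + (g - f n) by rewrite addrA subrK.
  rewrite (le_trans (rkhs_normD _ _))// lerD ?(ltW gm)//.
  by rewrite rkhs_normBC ltW.
apply/cvg_ex; exists l; apply/cvg_ballP => e egt0.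
have e0 : 0 < complex.Re e :> R by move: egt0; rewrite ltcE => /andP[].
have eE : e = (complex.Re e)%:C by exact/ge0_ReE/ltW.
have [n hn] := exists_invS_lt (divr_gt0 e0 (ltr0n R 2)).
near=> g; rewrite -ball_normE/= rkhs_normrE eE ltcR.
have gn : rkhs_norm (f n - g) < n.+1%:R^-1 by near: g; exact: hf.
have -> : l - g = (l - f n) + (f n - g) by rewrite addrA subrK.
rewrite (le_lt_trans (rkhs_normD _ _))// [rkhs_norm (l - _)]rkhs_normBC.
move: gn (hl n) hn; set a := n.+1%:R^-1; set b := rkhs_norm _; set c := rkhs_norm _.
lra.
Unshelve. all: by end_near. Qed.

HB.instance Definition _ := Uniform_isComplete.Build (rkhs kp) rkhs_complete.

End rkhs.

Section rkhs_dot.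
Context {R : realType} {X : Type} (k : X -> X -> R[i]) (kp : psd_kernel k).
Local Notation C := R[i].
Local Notation q := (knorm k).
Implicit Types (f g : rkhs kp) (v w : seq (C * X)).

Let lim_unique (x : nat -> C) (y z : C) (K L : R) : 0 <= K -> 0 <= L ->
  (forall n, normc (x n - y) <= K * n.+1%:R^-1) ->
  (forall n, normc (x n - z) <= L * n.+1%:R^-1) -> y = z.
Proof.
move=> K0 L0 xy xz; apply/eqP; rewrite -subr_eq0; apply/eqP/normc_eq0.
apply: le_anti; rewrite normc_ge0 andbT; apply: le_of_forall_eps => e e0.
have [n hn] : exists n : nat, n.+1%:R^-1 < e / (K + L + 1).
  by apply: exists_invS_lt; rewrite divr_gt0// ltr_wpDl// addr_ge0.
have -> : y - z = (x n - z) - (x n - y) by ring.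
rewrite (le_trans (le_normcD _ _))// normcN add0r.
rewrite (le_trans (lerD (xz n) (xy n)))//.
move: hn; rewrite ltr_pdivlMr; last by rewrite ltr_wpDl// addr_ge0.
set a := n.+1%:R^-1; have a0 : 0 < a by rewrite invr_gt0.
move=> hn; nra.
Qed.

Let approx f n : exists v, forall w,
  normc (kform k v w - lin_ext f w) <= n.+1%:R^-1 * q w.
Proof.
have /asboolP[M hM] := rkhs_subproof f.
have e0 : 0 < (n.+1%:R^-1 : R) ^+ 2 by rewrite exprn_gt0.
have [v hv] := kernel_approx kp hM e0.
exists v => w; rewrite -le_sqr ?normc_ge0 ?mulr_ge0 ?sqrtr_ge0 ?invr_ge0//.
by rewrite exprMn (sqr_knorm _ kp).
Qed.

Let apx f n : seq (C * X) := sval (cid (approx f n)).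

Let apxP f n w : normc (kform k (apx f n) w - lin_ext f w) <= n.+1%:R^-1 * q w.
Proof. exact: (svalP (cid (approx f n))). Qed.

Let q_ge0 v : 0 <= q v. Proof. exact: sqrtr_ge0. Qed.

Let q_lt v (M : R) : 0 <= M -> (forall w, normc (kform k v w) <= M * q w) -> q v <= M.
Proof.
move=> M0 h; have [->//|qn0] := eqVneq (q v) 0.
have qp : 0 < q v by rewrite lt_def qn0 q_ge0.
by rewrite -(ler_pM2r qp) -expr2 (sqr_knorm _ kp) (le_trans (Re_le_normc _)).
Qed.

Let apx_norm f n : q (apx f n) <= rkhs_norm f + n.+1%:R^-1.
Proof.
apply: q_lt => [|w]; first by rewrite addr_ge0 ?rkhs_norm_ge0.
have -> : kform k (apx f n) w = (kform k (apx f n) w - lin_ext f w) + lin_ext f w by ring.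
by rewrite (le_trans (le_normcD _ _))// addrC mulrDl lerD ?rkhs_normP ?apxP.
Qed.

Let norm_apx f n : rkhs_norm f <= q (apx f n) + n.+1%:R^-1.
Proof.
apply: rkhs_norm_le => [|w]; first by rewrite addr_ge0.
have -> : lin_ext f w = kform k (apx f n) w - (kform k (apx f n) w - lin_ext f w) by ring.
rewrite (le_trans (le_normcD _ _))// normcN mulrDl lerD ?apxP//.
by rewrite -le_sqr ?normc_ge0 ?mulr_ge0// exprMn !(sqr_knorm _ kp) kform_CS.
Qed.

Let lin_ext_sub f v w : lin_ext f (v ++ scale_comb (-1) w) = lin_ext f v - lin_ext f w.
Proof. by rewrite lin_ext_cat lin_ext_scale conjN1 mulN1r. Qed.

Let kform_sub v v' w : kform k (v ++ scale_comb (-1) v') w = kform k v w - kform k v' w.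
Proof. by rewrite kform_catl kform_scalel mulN1r. Qed.

Let dot_exists f g : exists z, forall n,
  normc (lin_ext f (apx g n) - z) <= 2 * rkhs_norm f * n.+1%:R^-1.
Proof.
have [z hz] : exists z, forall n,
    normc (lin_ext f (apx g n) - z) <= 2 * (rkhs_norm f * n.+1%:R^-1).
  apply: complex_nested => m n; rewrite -lin_ext_sub (le_trans (rkhs_normP _ _))//.
  rewrite -mulrDr ler_wpM2l ?rkhs_norm_ge0//.
  apply: q_lt => [|w]; first by rewrite addr_ge0.
  rewrite kform_sub.
  have -> : kform k (apx g m) w - kform k (apx g n) w = (kform k (apx g m) w - lin_ext g w) -
     (kform k (apx g n) w - lin_ext g w) by ring.
  by rewrite (le_trans (le_normcD _ _))// normcN mulrDl lerD ?apxP.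
by exists z => n; rewrite -mulrA.
Qed.

(** By the reproducing property, [lin_ext f] is the pairing of f with a combination of kernel
    functions. The combinations [apx g n] tend to g, and the product is the limit of these numbers;
    it exists by [dot_exists], so the default 0 is never taken as such. *)
Definition rkhs_dot f g : C := xget 0 [set z | forall n,
  normc (lin_ext f (apx g n) - z) <= 2 * rkhs_norm f * n.+1%:R^-1].

Let dotP f g n :
  normc (lin_ext f (apx g n) - rkhs_dot f g) <= 2 * rkhs_norm f * n.+1%:R^-1.
Proof.
have : [set z | forall n,
    normc (lin_ext f (apx g n) - z) <= 2 * rkhs_norm f * n.+1%:R^-1] (rkhs_dot f g).
  by apply: xgetPex; exact: dot_exists.
exact.
Qed.

Let dot_eq f g z (K : R) : 0 <= K ->
  (forall n, normc (lin_ext f (apx g n) - z) <= K * n.+1%:R^-1) -> rkhs_dot f g = z.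
Proof.
by move=> K0 h; apply: lim_unique (dotP f g) h => //; rewrite mulr_ge0 ?rkhs_norm_ge0.
Qed.

Lemma rkhs_dot_linear (a : C) f f' g :
  rkhs_dot (a *: f + f') g = a * rkhs_dot f g + rkhs_dot f' g.
Proof.
apply: (@dot_eq _ _ _ (normc a * (2 * rkhs_norm f) + 2 * rkhs_norm f')).
  by rewrite addr_ge0 ?mulr_ge0 ?normc_ge0 ?rkhs_norm_ge0.
move=> n; set v := apx g n.
have -> : lin_ext (a *: f + f') v = a * lin_ext f v + lin_ext f' v.
  by rewrite -lin_extZ -lin_extD.
have -> : a * lin_ext f v + lin_ext f' v - (a * rkhs_dot f g + rkhs_dot f' g) =
  a * (lin_ext f v - rkhs_dot f g) + (lin_ext f' v - rkhs_dot f' g) by ring.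
rewrite (le_trans (le_normcD _ _))// Normc.normcM mulrDl lerD ?dotP//.
by rewrite -mulrA ler_wpM2l ?normc_ge0 ?dotP.
Qed.

(** Approximating both arguments gives an expression that is visibly hermitian, which the definition
    of [rkhs_dot] is not. Symmetry and the value at f, f follow from it. *)
Let dot_kform f g n :
  normc (kform k (apx f n) (apx g n) - rkhs_dot f g) <=
  (2 * rkhs_norm f + rkhs_norm g + 1) * n.+1%:R^-1.
Proof.
have -> : kform k (apx f n) (apx g n) - rkhs_dot f g =
   (kform k (apx f n) (apx g n) - lin_ext f (apx g n)) +
   (lin_ext f (apx g n) - rkhs_dot f g) by ring.
rewrite (le_trans (le_normcD _ _))// addrC -addrA mulrDl lerD ?dotP//.
rewrite (le_trans (apxP _ _ _))// mulrC ler_wpM2r// (le_trans (apx_norm g n))//.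
by rewrite lerD2l invf_le1// ler1n.
Qed.

Lemma rkhs_dotC f g : rkhs_dot g f = (rkhs_dot f g)^*.
Proof.
apply: (lim_unique _ _ (dot_kform g f)
  (fun n => _ : _ <= (2 * rkhs_norm f + rkhs_norm g + 1) * _)).
- by rewrite !addr_ge0 ?mulr_ge0 ?rkhs_norm_ge0.
- by rewrite !addr_ge0 ?mulr_ge0 ?rkhs_norm_ge0.
- by move=> n; rewrite (kform_herm _ _ kp) -rmorphB normc_conj dot_kform.
Qed.

Lemma rkhs_dotxx f : rkhs_dot f f = (rkhs_norm f ^+ 2)%:C.
Proof.
apply: (lim_unique _ _ (dot_kform f f)
  (fun n => _ : _ <= (2 * rkhs_norm f + 1) * _)).
- by rewrite !addr_ge0 ?mulr_ge0 ?rkhs_norm_ge0.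
- by rewrite !addr_ge0 ?mulr_ge0 ?rkhs_norm_ge0.
move=> n; rewrite [kform _ _ _]ge0_ReE// -(sqr_knorm _ kp) -rmorphB normcr.
rewrite subr_sqr normrM mulrC [X in X * _]ger0_norm ?addr_ge0 ?rkhs_norm_ge0//.
have n1 : n.+1%:R^-1 <= 1 :> R by rewrite invf_le1// ler1n.
have := apx_norm f n; have := norm_apx f n; have := rkhs_norm_ge0 f.
have := q_ge0 (apx f n); move: n1; have : 0 <= n.+1%:R^-1 :> R by [].
set r := n.+1%:R^-1; set N := rkhs_norm f; set t := q _ => r0 r1 t0 N0 h1 h2.
rewrite ler_pM ?addr_ge0//; first by lra.
by rewrite ler_norml; apply/andP; split; lra.
Qed.

Let dot_lmod_linear : forall g, GRing.linear_for *%R (rkhs_dot^~ g).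
Proof. by move=> g a f f'; exact: rkhs_dot_linear. Qed.

Let dot_linear_r : forall f, GRing.linear_for (conjc \; *%R) (rkhs_dot f).
Proof.
by move=> f a g g'; rewrite rkhs_dotC rkhs_dot_linear rmorphD rmorphM/= -!rkhs_dotC.
Qed.

Let dot_gt0 f : f != 0 -> 0 < rkhs_dot f f.
Proof.
move=> f0; rewrite rkhs_dotxx ltcR exprn_gt0// lt_def rkhs_norm_ge0 andbT.
by apply: contra_neq f0; exact: rkhs_norm0_eq0.
Qed.

Let dot_herm f g : rkhs_dot f g = (-1) ^+ false * (rkhs_dot g f)^*.
Proof. by rewrite expr0 mul1r -rkhs_dotC. Qed.

Definition rkhs_form : {dot rkhs kp for (@Num.conj R[i])} :=
  HB.pack rkhs_dot
    (@bilinear_isBilinear.Build _ _ _ _ _ _ _ (dot_lmod_linear, dot_linear_r))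
    (@isHermitianSesquilinear.Build _ _ false _ _ dot_herm)
    (@isDotProduct.Build _ _ _ dot_gt0).

Let point_bounded x : (fun y => k x y : C^o) \in is_kbounded k.
Proof.
apply/(is_kboundedP (kp := kp)); exists (q [:: (1, x)]) => [|v]; first exact: q_ge0.
have -> : lin_ext (fun y => k x y) v = kform k [:: (1, x)] v.
  by rewrite kformE; apply: eq_bigr => p _; rewrite big_seq1 mul1r.
by rewrite -le_sqr ?normc_ge0 ?mulr_ge0// exprMn !(sqr_knorm _ kp) kform_CS.
Qed.

Definition rkhs_point x : rkhs kp := Rkhs kp (point_bounded x).

Lemma rkhs_dot_point f x : rkhs_dot f (rkhs_point x) = f x.
Proof.
apply: (@dot_eq _ _ _ (rkhs_norm f)) => [|n]; first exact: rkhs_norm_ge0.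
have <- : lin_ext f [:: (1, x)] = f x by rewrite /lin_ext big_seq1 conj1 mul1r.
rewrite -lin_ext_sub (le_trans (rkhs_normP _ _))// ler_wpM2l ?rkhs_norm_ge0//.
apply: q_lt => // w; rewrite kform_sub.
have -> : kform k [:: (1, x)] w = lin_ext (rkhs_point x) w.
  by rewrite kformE; apply: eq_bigr => p _; rewrite big_seq1 mul1r.
exact: apxP.
Qed.

Let rkhs_dotE f : rkhs_form f f = `|f| ^+ 2.
Proof. by rewrite rkhs_normrE -rmorphXn; exact: rkhs_dotxx. Qed.

Definition rkhs_hilbert : hilbert R := @Hilbert R (rkhs kp) rkhs_form rkhs_dotE.

End rkhs_dot.

Section reproducing_kernel.
Context {R : realType} {X : Type}.
Local Notation C := R[i].

(** This is the only access to the construction. The third clause produces vectors from prescribed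
    values and a bound, the second makes them unique; operators are built in this way in [GNS] and
    [Kolmogorov]. *)
Theorem reproducing_kernel (k : X -> X -> C) : psd_kernel k ->
  exists (L : hilbert R) (j : X -> L),
  [/\ forall x y, hdot (j x) (j y) = k x y,
      forall f g : L, (forall x, hdot f (j x) = hdot g (j x)) -> f = g
    & forall (f : X -> C) (M : R), 0 <= M ->
      (forall v, normc (lin_ext f v) <= M * knorm k v) ->
      exists2 g : L, hnorm g <= M & forall x, hdot g (j x) = f x].
Proof.
move=> kp; exists (rkhs_hilbert kp), (@rkhs_point R X k kp).
split=> [x y|f g fg|f M M0 hM]; first exact: rkhs_dot_point.
  apply: rkhs_ext => x; rewrite -[LHS]rkhs_dot_point -[RHS]rkhs_dot_point.
  exact: fg.
have fb : (f : X -> C^o) \in is_kbounded k by apply/(is_kboundedP (kp := kp)); exists M.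
exists (Rkhs kp fb) => [|x]; last exact: rkhs_dot_point.
exact: rkhs_norm_le.
Qed.

End reproducing_kernel.

(** * Positive semi-definite families of forms and their dilations *)

Section forms.
Context {R : realType} {V : lmodType R[i]}.
Local Notation C := R[i].
Implicit Types (b : V -> V -> C).

Definition sesquiform b :=
  (forall a x y z, b (a *: x + y) z = a * b x z + b y z) /\
  (forall a x y z, b z (a *: x + y) = a^* * b z x + b z y).

Variable b : V -> V -> C.
Hypothesis bs : sesquiform b.

Lemma sesquiDl x y z : b (x + y) z = b x z + b y z.
Proof. by have := bs.1 1 x y z; rewrite scale1r mul1r. Qed.
Lemma sesquiDr x y z : b z (x + y) = b z x + b z y.
Proof. by have := bs.2 1 x y z; rewrite scale1r conj1 mul1r. Qed.
Lemma sesqui0l z : b 0 z = 0.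
Proof. by have := sesquiDl 0 0 z; rewrite addr0 => /esym/eqP; rewrite -subr_eq0 addrK => /eqP. Qed.
Lemma sesqui0r z : b z 0 = 0.
Proof. by have := sesquiDr 0 0 z; rewrite addr0 => /esym/eqP; rewrite -subr_eq0 addrK => /eqP. Qed.
Lemma sesquiZl a x z : b (a *: x) z = a * b x z.
Proof. by have := bs.1 a x 0 z; rewrite sesqui0l !addr0. Qed.
Lemma sesquiZr a x z : b z (a *: x) = a^* * b z x.
Proof. by have := bs.2 a x 0 z; rewrite sesqui0r !addr0. Qed.
Lemma sesqui_suml I (r : seq I) (P : pred I) (F : I -> V) z :
  b (\sum_(i <- r | P i) F i) z = \sum_(i <- r | P i) b (F i) z.
Proof. exact: (big_morph (b^~ z) (fun x y => sesquiDl x y z) (sesqui0l z)). Qed.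
Lemma sesqui_sumr I (r : seq I) (P : pred I) (F : I -> V) z :
  b z (\sum_(i <- r | P i) F i) = \sum_(i <- r | P i) b z (F i).
Proof. exact: (big_morph (b z) (fun x y => sesquiDr x y z) (sesqui0r z)). Qed.

End forms.

Section positive_forms.
Context {R : realType} {G : groupType} {V : lmodType R[i]}.
Local Notation C := R[i].
Implicit Types (D : set G) (B : G -> V -> V -> C).

(* A family indexed by a list instead of a finite set: repetitions in the first
   components are harmless, by sesquilinearity. *)
Definition fpsd D B := forall l : seq (G * V),
  (forall p q, p \in l -> q \in l -> D (p.1 * q.1^-1)%g) ->
  0 <= \sum_(p <- l) \sum_(q <- l) B (p.1 * q.1^-1)%g q.2 p.2.

(** The map [g] marks points whose quotients all lie in D: two points in [pt_D], the whole group in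
    [GNS]. *)
Lemma fpsd_kernel D B (I : eqType) (g : I -> G) :
  (forall s, D s -> sesquiform (B s)) -> fpsd D B ->
  (forall i j, D (g i * (g j)^-1)%g) ->
  psd_kernel (fun x y : I * V => B (g y.1 * (g x.1)^-1)%g x.2 y.2).
Proof.
move=> Bs Bp gD v.
have := Bp [seq (g p.2.1, p.1 *: p.2.2) | p <- v].
rewrite /kform exchange_big big_map => h; rewrite (le_trans (h _))//.
  by move=> p1 q1 /mapP[p _ ->] /mapP[q _ ->]; exact: gD.
rewrite le_eqVlt; apply/orP; left; apply/eqP; apply: eq_bigr => p _.
rewrite big_map; apply: eq_bigr => q _ /=.
by rewrite (sesquiZl (Bs _ (gD _ _))) (sesquiZr (Bs _ (gD _ _))) mulrA.
Qed.

Section two_points.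
Variables (D : set G) (B : G -> V -> V -> C).
Hypotheses (hD : positivity_domain D) (Bs : forall s, D s -> sesquiform (B s)).
Hypothesis Bp : fpsd D B.

Lemma domain_inv s : D s -> D (s^-1)%g.
Proof. by move=> Ds; rewrite -hD.2; exists s. Qed.

(** Since D contains 1, s and s^-1, the pair {1, s} is admissible; hermitian symmetry and
    Cauchy-Schwarz need nothing more. *)
Let pt_D s : D s -> forall i j : bool,
  D ((if i then s else 1) * (if j then s else 1)^-1)%g.
Proof.
move=> Ds [] []; rewrite ?mulgV ?invg1 ?mulg1 ?mul1g//; [exact: hD.1|exact: domain_inv|exact: hD.1].
Qed.

Lemma fpsd_herm s x y : D s -> B (s^-1)%g y x = (B s x y)^*.
Proof.
move=> Ds; have := psd_kernel_herm (fpsd_kernel Bs Bp (pt_D Ds)) (false, x) (true, y).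
by rewrite /= mul1g invg1 mulg1.
Qed.

Lemma fpsd_CS s x y : D s ->
  normc (B s x y) ^+ 2 <= complex.Re (B 1%g x x) * complex.Re (B 1%g y y).
Proof.
move=> Ds; have := kform_CS [:: (1, (false, x))] [:: (1, (true, y))]
  (fpsd_kernel Bs Bp (pt_D Ds)).
by rewrite /kform !big_seq1/= conj1 !mul1r invg1 mulgV !mulg1.
Qed.

Lemma fpsd1_ge0 x : 0 <= B 1%g x x.
Proof.
have := Bp (l := [:: (1%g, x)]); rewrite !big_seq1 /= mulgV; apply=> p q.
by rewrite !inE => /eqP-> /eqP->; rewrite /= mulgV; exact: hD.1.
Qed.

End two_points.

Lemma sum_by_fst (T : Type) (l : seq (G * T)) (S : {fset G}) (M : nmodType)
    (F : G * T -> M) : all (fun p => p.1 \in S) l ->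
  \sum_(p <- l) F p = \sum_(s : S) \sum_(p <- l | p.1 == val s) F p.
Proof.
move=> lS; under [RHS]eq_bigr do rewrite big_mkcond.
rewrite exchange_big/=; elim: l lS => [|p l ih]; first by rewrite !big_nil.
move=> /= /andP[pS lS]; rewrite !big_cons ih//; congr (_ + _).
rewrite -big_mkcond (big_pred1 [` pS]%fset)// => s.
Qed.

End positive_forms.

Section operator_forms.
Context {R : realType} {G : groupType} {H : hilbert R}.
Local Notation C := R[i].
Implicit Types (D : set G) (u : G -> bop H).

Definition bform u s (x y : H) : C := hdot (u s x) y.

Lemma bform_sesqui u s : sesquiform (bform u s).
Proof.
split=> a x y z; first by rewrite /bform bop_linear hdotDl hdotZl.
by rewrite /bform hdotDr hdotZr.
Qed.

Lemma psdP D u : psd D u <-> fpsd D (bform u).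
Proof.
split=> [up l hl|up S hS xi].
- pose S := [fset s in [seq p.1 | p <- l]]%fset.
  have lS : all (fun p => p.1 \in S) l.
    by apply/allP => p pl; rewrite !inE/=; apply/mapP; exists p.
  have aS : admissible D S.
    by move=> s t; rewrite !inE/= => /mapP[p pl ->] /mapP[q ql ->]; exact: hl.
  have := up S aS (fun s => \sum_(p <- l | p.1 == val s) p.2).
  rewrite (sum_by_fst _ lS) => h; rewrite (le_trans h)// le_eqVlt; apply/orP; left.
  apply/eqP; apply: eq_bigr => s _.
  transitivity (\sum_(p <- l | p.1 == val s) \sum_(t : S)
     hdot (u (val s * (val t)^-1)%g (\sum_(q <- l | q.1 == val t) q.2)) p.2).
    by rewrite exchange_big/=; apply: eq_bigr => t _; rewrite hdot_sumr.
  apply: eq_bigr => p /eqP ps; rewrite (sum_by_fst _ lS); apply: eq_bigr => t _.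
  rewrite bop_sumr hdot_suml; apply: eq_bigr => q /eqP qt.
  by rewrite /bform ps qt.
- have := up [seq (val s, xi s) | s <- index_enum (fset_sub_type S)]; rewrite big_map.
  move=> h; rewrite (le_trans (h _))//.
    by move=> p1 q1 /mapP[s _ ->] /mapP[t _ ->]; apply: hS; exact: fsvalP.
  rewrite le_eqVlt; apply/orP; left; apply/eqP; apply: eq_bigr => s _.
  by rewrite big_map.
Qed.

End operator_forms.

Section kernel_points.
Context {R : realType} {X : Type} (k : X -> X -> R[i]) (L : hilbert R) (j : X -> L).
Hypotheses (kp : psd_kernel k) (jk : forall x y, hdot (j x) (j y) = k x y).

Lemma hnorm_kernel_comb v : hnorm (\sum_(p <- v) p.1 *: j p.2) = knorm k v.
Proof.
apply/eqP; rewrite -(@eqrXn2 _ 2) ?hnorm_ge0 ?sqrtr_ge0// sqr_knorm// sqr_hnorm.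
rewrite hdot_suml /kform; apply/eqP; congr complex.Re.
apply: eq_bigr => p _; rewrite hdot_sumr; apply: eq_bigr => q _.
by rewrite hdotZl hdotZr jk mulrA.
Qed.

Lemma lin_ext_hdot (f : L) v :
  lin_ext (fun x => hdot f (j x)) v = hdot f (\sum_(p <- v) p.1 *: j p.2).
Proof. by rewrite hdot_sumr; apply: eq_bigr => p _; rewrite hdotZr. Qed.

Lemma lin_ext_hdot_le (f : L) v :
  normc (lin_ext (fun x => hdot f (j x)) v) <= hnorm f * knorm k v.
Proof. by rewrite lin_ext_hdot -hnorm_kernel_comb Cauchy_Schwarz. Qed.

End kernel_points.

Section unitary_representations.
Context {R : realType} {G : groupType}.
Local Notation C := R[i].

Section properties.
Context (L : hilbert R) (pi : G -> bop L) (piU : unitary_rep pi).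

Lemma rep1 x : pi 1%g x = x.
Proof. by have [-> _ _] := piU. Qed.

Lemma repM s t x : pi (s * t)%g x = pi s (pi t x).
Proof. by have [_ -> _] := piU. Qed.

Lemma rep_dotV s x y : hdot (pi s x) y = hdot x (pi (s^-1)%g y).
Proof.
have [_ _ h] := piU.
by rewrite -[y in LHS]rep1 -(mulgV s) repM h.
Qed.

Lemma rep_fpsd (V : lmodType C) (J : V -> L) :
  fpsd setT (fun s x y => hdot (pi s (J x)) (J y)).
Proof.
move=> l _.
have -> : \sum_(p <- l) \sum_(q <- l) hdot (pi (p.1 * q.1^-1)%g (J q.2)) (J p.2) =
  hdot (\sum_(q <- l) pi (q.1^-1)%g (J q.2)) (\sum_(p <- l) pi (p.1^-1)%g (J p.2)).
  rewrite hdot_sumr; apply: eq_bigr => p _; rewrite hdot_suml.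
  by apply: eq_bigr => q _; rewrite repM rep_dotV.
by rewrite hdotxx ler0c sqr_ge0.
Qed.

End properties.

Theorem GNS (V : lmodType C) (B : G -> V -> V -> C) :
  (forall s, sesquiform (B s)) -> fpsd setT B ->
  exists (L : hilbert R) (pi : G -> bop L) (J : V -> L),
  [/\ unitary_rep pi, linear J
    & forall s x y, hdot (pi s (J x)) (J y) = B s x y].
Proof.
move=> Bs Bp.
pose k (x y : G * V) : C := B (y.1 * x.1^-1)%g x.2 y.2.
have kp : psd_kernel k.
  by apply: (fpsd_kernel (D := setT) (g := id)) => // s _; exact: Bs.
have [L [j [jk jtot jrep]]] := reproducing_kernel kp.
(* Right translation cancels in [y.1 * x.1^-1] and so preserves [k]. The representation is
   composition with it, and V embeds through the points over 1. *)
pose sh (g : G) (x : G * V) := ((x.1 * g)%g, x.2).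
have ksh g x y : k (sh g x) (sh g y) = k x y.
  by rewrite /k/= mulgKA.
have hU g : exists U : bop L, forall f x, hdot (U f) (j x) = hdot f (j (sh g x)).
  have hf f : exists f', hnorm f' <= hnorm f /\ forall x, hdot f' (j x) = hdot f (j (sh g x)).
    have [||f' f'1 f'2] := jrep (fun x => hdot f (j (sh g x))) (hnorm f); last by exists f'.
      exact: hnorm_ge0.
    move=> v; pose v' := [seq (p.1, sh g p.2) | p <- v].
    have -> : knorm k v = knorm k v'.
      rewrite /knorm /kform big_map; congr (Num.sqrt (complex.Re _)).
      by apply: eq_bigr => p _; rewrite big_map; apply: eq_bigr => q _; rewrite ksh.
    have := lin_ext_hdot_le kp jk f v'; rewrite /lin_ext big_map; exact.
  have [F hF] := choice hf.
  have Fl : linear F.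
    by move=> a x y; apply: jtot => z; rewrite (hF _).2 !hdotDl !hdotZl !(hF _).2.
  have [U hU] := bounded_bop (M := 1) Fl (fun x => ltac:(rewrite mul1r; exact: (hF x).1)).
  by exists U => f x; rewrite hU (hF _).2.
have [U {}hU] := choice hU.
have Uj g x : U g (j x) = j (sh (g^-1)%g x).
  apply: jtot => y; rewrite hU !jk -(ksh (g^-1)%g _ (sh g y)).
  by congr k; case: y => y1 y2; rewrite /sh/= mulgK.
have UM g h f : U (g * h)%g f = U g (U h f).
  by apply: jtot => x; rewrite !hU /sh/= mulgA.
have U1 f : U 1%g f = f.
  by apply: jtot => -[x1 x2]; rewrite !hU /sh/= mulg1.
have Uadj g f f' : hdot (U g f) f' = hdot f (U (g^-1)%g f').
  rewrite adjP (_ : adj (U g) f' = U (g^-1)%g f')//; apply: jtot => x.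
  by rewrite hdotC -adjP Uj hU -hdotC.
exists L, U, (fun x => j (1%g, x)); split.
- split=> [|g h|g x y]; first by apply: bop_ext => f; rewrite U1.
    by apply: bop_ext => f; rewrite UM.
  by rewrite Uadj -UM mulVg U1.
- move=> a x y; apply: jtot => -[s z]; rewrite hdotDl hdotZl !jk /k /=.
  exact: (Bs _).1.
- by move=> s x y; rewrite hU jk /k/= mul1g invg1 mulg1.
Qed.

End unitary_representations.

Section approximation.
Context {R : realType} {H : hilbert R}.
Local Notation C := R[i].

Lemma ge0_of_approx (z : C) (K : R) : 0 <= K ->
  (forall n : nat, exists2 w : C, 0 <= w & normc (z - w) <= K * n.+1%:R^-1) -> 0 <= z.
Proof.
move=> K0 h.
have he (e : R) : 0 < e -> exists2 w : C, 0 <= w & normc (z - w) <= e.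
  move=> e0; have [n hn] : exists n : nat, n.+1%:R^-1 < e / (K + 1).
    by apply: exists_invS_lt; rewrite divr_gt0// ltr_wpDl.
  have [w w0 hw] := h n; exists w => //; rewrite (le_trans hw)//.
  move: hn; rewrite ltr_pdivlMr; last by rewrite ltr_wpDl.
  set a := n.+1%:R^-1; have a0 : 0 < a by rewrite invr_gt0.
  by move=> hn; nra.
rewrite ge0_complexE; apply/andP; split.
- rewrite -normr_le0; apply: le_of_forall_eps => e /he[w].
  rewrite ge0_complexE => /andP[/eqP Iw _]; rewrite add0r; apply: le_trans.
  by have := normr_Im_le (z - w); rewrite ImD ImN Iw subr0.
- apply: le_of_forall_eps => e /he[w]; rewrite ge0_complexE => /andP[_ Rw] zw.
  have := le_trans (normr_Re_le (z - w)) zw; rewrite ReB ler_norml => /andP[+ _].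
  lra.
Qed.

Lemma bform_approx (T : bop H) (x y : H) : exists2 K : R, 0 <= K &
  forall (n : nat) (x' y' : H),
    hnorm (x - x') <= n.+1%:R^-1 -> hnorm (y - y') <= n.+1%:R^-1 ->
    normc (hdot (T x) y - hdot (T x') y') <= K * n.+1%:R^-1.
Proof.
have [M M0 hM] := bop_bounded T.
exists (M * (hnorm x + 1 + hnorm y)); first by rewrite mulr_ge0// !addr_ge0 ?hnorm_ge0.
move=> n x' y' hx hy.
have -> : hdot (T x) y - hdot (T x') y' = hdot (T (x - x')) y + hdot (T x') (y - y').
  by rewrite bopBr hdotBl hdotBr; ring.
have n1 : n.+1%:R^-1 <= 1 :> R by rewrite invf_le1// ler1n.
have hx' : hnorm x' <= hnorm x + 1.
  have -> : x' = x - (x - x') by rewrite subKr.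
  by rewrite (le_trans (ler_hnormD _ _))// hnorm_opp lerD2l (le_trans hx).
have r0 : 0 <= n.+1%:R^-1 :> R by [].
rewrite (le_trans (le_normcD _ _))//.
have h1 : normc (hdot (T (x - x')) y) <= M * n.+1%:R^-1 * hnorm y.
  rewrite (le_trans (Cauchy_Schwarz _ _))// ler_wpM2r ?hnorm_ge0//.
  by rewrite (le_trans (hM _))// ler_wpM2l.
have h2 : normc (hdot (T x') (y - y')) <= M * (hnorm x + 1) * n.+1%:R^-1.
  rewrite (le_trans (Cauchy_Schwarz _ _))// ler_pM ?hnorm_ge0//.
  by rewrite (le_trans (hM _))// ler_wpM2l.
rewrite (le_trans (lerD h1 h2))// le_eqVlt; apply/orP; left; apply/eqP; ring.
Qed.

(** For [Kolmogorov], where the inequality is known only for vectors in the image of V, which is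
    dense. *)
Lemma mxop_pos_dense (I : finType) (T : I -> I -> bop H) (P : set H) :
  (forall x (n : nat), exists2 y, P y & hnorm (x - y) <= n.+1%:R^-1) ->
  (forall xi : I -> H, (forall i, P (xi i)) ->
     0 <= \sum_i \sum_j hdot (T i j (xi j)) (xi i)) ->
  mxop_pos T.
Proof.
move=> dense h xi.
have hK (ij : I * I) := bform_approx (T ij.1 ij.2) (xi ij.2) (xi ij.1).
have {}hK (ij : I * I) : exists K : R, 0 <= K /\ forall (n : nat) (x' y' : H),
    hnorm (xi ij.2 - x') <= n.+1%:R^-1 -> hnorm (xi ij.1 - y') <= n.+1%:R^-1 ->
    normc (hdot (T ij.1 ij.2 (xi ij.2)) (xi ij.1) - hdot (T ij.1 ij.2 x') y') <=
      K * n.+1%:R^-1.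
  by have [K K0 hK'] := hK ij; exists K.
have [K {}hK] := choice hK.
apply: (@ge0_of_approx _ (\sum_i \sum_j K (i, j))).
  by apply: sumr_ge0 => i _; apply: sumr_ge0 => j _; exact: (hK _).1.
move=> n; have hx x : exists y, P y /\ hnorm (x - y) <= n.+1%:R^-1.
  by have [y Py xy] := dense x n; exists y.
have [a ha] := choice hx.
exists (\sum_i \sum_j hdot (T i j (a (xi j))) (a (xi i))).
  by apply: h => i; exact: (ha _).1.
rewrite -sumrB.
have normc_sum (J : finType) (F : J -> C) : normc (\sum_i F i) <= \sum_i normc (F i).
  elim/big_ind2 : _ => [|x a1 y b1 xa yb|//]; first by rewrite Normc.normc0.
  by rewrite (le_trans (le_normcD _ _))// lerD.
rewrite (le_trans (normc_sum _ _))// mulr_suml ler_sum// => i _.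
rewrite -sumrB (le_trans (normc_sum _ _))// mulr_suml ler_sum// => j _.
by apply: (hK (i, j)).2; exact: (ha _).2.
Qed.

End approximation.

Section Kolmogorov.
Context {R : realType} {G : groupType} {V : lmodType R[i]}.
Local Notation C := R[i].

Theorem Kolmogorov (D : set G) (B : G -> V -> V -> C) : positivity_domain D ->
  (forall s, D s -> sesquiform (B s)) -> fpsd D B ->
  exists (L : hilbert R) (j : V -> L) (u : G -> bop L),
  [/\ linear j, psd D u, u 1%g = 1
    & forall s, D s -> forall x y, hdot (u s (j x)) (j y) = B s x y].
Proof.
move=> hD Bs Bp; have D1 := hD.1; have B1 := Bs _ D1.
pose k := B 1%g.
have kE (v w : seq (C * V)) : kform k v w =
    k (\sum_(p <- v) p.1 *: p.2) (\sum_(p <- w) p.1 *: p.2).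
  rewrite /kform /k (sesqui_suml B1); apply: eq_bigr => p _; rewrite (sesqui_sumr B1).
  by apply: eq_bigr => q _; rewrite (sesquiZl B1) (sesquiZr B1) mulrA.
have kp : psd_kernel k by move=> v; rewrite kE (fpsd1_ge0 hD).
have [L [j [jk jtot jrep]]] := reproducing_kernel kp.
have jl : linear j.
  by move=> a x y; apply: jtot => z; rewrite hdotDl hdotZl !jk /k B1.1.
have jsum (v : seq (C * V)) : j (\sum_(p <- v) p.1 *: p.2) = \sum_(p <- v) p.1 *: j p.2.
  have j0 : j 0 = 0 by have := jl (-1) 0 0; rewrite scaler0 addr0 scaleN1r addNr.
  elim: v => [|p v ih]; first by rewrite !big_nil.
  by rewrite !big_cons jl ih.
have knormE v : knorm k v = hnorm (j (\sum_(p <- v) p.1 *: p.2)).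
  by rewrite jsum (hnorm_kernel_comb kp jk).
have lin_extB s v x : D s -> lin_ext (B s x) v = B s x (\sum_(p <- v) p.1 *: p.2).
  move=> Ds; rewrite (sesqui_sumr (Bs _ Ds)); apply: eq_bigr => p _.
  by rewrite (sesquiZr (Bs _ Ds)).
have dense (f : L) (n : nat) : exists2 g, range j g & hnorm (f - g) <= n.+1%:R^-1.
  have e0 : 0 < (n.+1%:R^-1 : R) ^+ 2 by rewrite exprn_gt0.
  have fb : kbounded k (fun x => hdot f (j x)) (hnorm f ^+ 2).
    by apply/(kboundedP (kp := kp)) => [|v]; [exact: hnorm_ge0|exact: lin_ext_hdot_le].
  have [v hv] := kernel_approx kp fb e0.
  exists (j (\sum_(p <- v) p.1 *: p.2)); first by exists (\sum_(p <- v) p.1 *: p.2).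
  set y := j _.
  have [||g gn gE] := jrep (fun x => hdot (f - y) (j x)) n.+1%:R^-1 => //.
    move=> w; rewrite -le_sqr ?normc_ge0 ?mulr_ge0 ?sqrtr_ge0 ?invr_ge0//.
    rewrite exprMn sqr_knorm//; have := hv w.
    rewrite -normcN opprB !lin_ext_hdot kE -jk -/y -jsum hdotBl; exact.
  by rewrite (_ : f - y = g)//; apply: jtot => x; rewrite gE.
(* The identity operator already represents [B 1], since the inner product of L is built from it; it
   is selected explicitly to have [u 1 = 1]. Outside D the value 0 is a mere filler. *)
have hu s : exists T : bop L, (s = 1%g -> T = 1) /\
    (D s -> forall x y, hdot (T (j x)) (j y) = B s x y).
  have [->|s1] := eqVneq s 1%g.
    by exists 1; split=> // _ x y; exact: jk.
  have [Ds|nDs] := pselect (D s); last by exists 0; split=> // h; rewrite h eqxx in s1.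
  have ht x : exists f : L, hnorm f <= hnorm (j x) /\ forall y, hdot f (j y) = B s x y.
    have [||f fn fE] := jrep (B s x) (hnorm (j x)); last by exists f.
      exact: hnorm_ge0.
    move=> v; rewrite lin_extB// knormE -le_sqr ?normc_ge0 ?mulr_ge0 ?hnorm_ge0//.
    by rewrite exprMn !sqr_hnorm !jk (fpsd_CS hD Bs Bp).
  have [t {}ht] := choice ht.
  have tl : linear t.
    by move=> a x y; apply: jtot => z; rewrite hdotDl hdotZl !(ht _).2 (Bs _ Ds).1.
  have tsum (v : seq (C * V)) : t (\sum_(p <- v) p.1 *: p.2) = \sum_(p <- v) p.1 *: t p.2.
    have t0 : t 0 = 0 by have := tl (-1) 0 0; rewrite scaler0 addr0 scaleN1r addNr.
    elim: v => [|p v ih]; first by rewrite !big_nil.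
    by rewrite !big_cons tl ih.
  (* The map [t] is defined on V and not on L. Its adjoint is defined on all of L by prescribed
     values, and the adjoint of that is the operator sought. *)
  have hS f : exists g : L, hnorm g <= hnorm f /\ forall x, hdot g (j x) = hdot f (t x).
    have [||g gn gE] := jrep (fun x => hdot f (t x)) (hnorm f); last by exists g.
      exact: hnorm_ge0.
    move=> v; rewrite lin_ext_hdot -tsum knormE (le_trans (Cauchy_Schwarz _ _))//.
    by rewrite ler_wpM2l ?hnorm_ge0// (ht _).1.
  have [S {}hS] := choice hS.
  have Sl : linear S.
    by move=> a x y; apply: jtot => z; rewrite hdotDl hdotZl !(hS _).2 hdotDl hdotZl.
  have [S' hS'] := bounded_bop (M := 1) Sl (fun x => ltac:(rewrite mul1r; exact: (hS x).1)).
  exists (adj S'); split=> [h|_ x y]; first by rewrite h eqxx in s1.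
  by rewrite hdotC -adjP hS' (hS _).2 -hdotC (ht _).2.
have [u {}hu] := choice hu.
exists L, j, u; split=> // [S aS||s Ds]; last 2 first.
- exact: (hu _).1.
- exact: (hu _).2.
apply: (mxop_pos_dense dense) => xi hxi.
have hx (s : S) : exists x, j x = xi s by have [x _ <-] := hxi s; exists x.
have [x {}hx] := choice hx.
have := Bp [seq (val s, x s) | s <- index_enum (fset_sub_type S)]; rewrite big_map.
move=> h; rewrite (le_trans (h _))//.
  by move=> p1 q1 /mapP[s _ ->] /mapP[t _ ->]; apply: aS; exact: fsvalP.
rewrite le_eqVlt; apply/orP; left; apply/eqP; apply: eq_bigr => s _.
rewrite big_map; apply: eq_bigr => t _; rewrite -!hx (hu _).2//.
by apply: aS; exact: fsvalP.
Qed.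

End Kolmogorov.

(** * Matrices over C^*(G) *)

Section euclidean_sums.
Context {R : realType} {H : hilbert R} {n : nat}.
Local Notation C := R[i].
Implicit Types (x y : 'I_n -> H) (S T : 'M[bop H]_n) (M N : R).

Definition l2dot x y : C := \sum_i hdot (x i) (y i).

Definition mxform T x y : C := \sum_i \sum_j hdot (T i j (x j)) (y i).

Definition mxbound T M := forall x, l2norm (mxop_act T x) <= M * l2norm x.

Lemma l2norm_ge0 x : 0 <= l2norm x. Proof. exact: sqrtr_ge0. Qed.

Lemma sqr_l2norm x : l2norm x ^+ 2 = \sum_i hnorm (x i) ^+ 2.
Proof. by rewrite sqr_sqrtr// sumr_ge0// => i _; rewrite sqr_ge0. Qed.

Lemma l2dotxx x : l2dot x x = (l2norm x ^+ 2)%:C.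
Proof. by rewrite sqr_l2norm rmorph_sum; apply: eq_bigr => i _; rewrite hdotxx. Qed.

Lemma l2dotC x y : l2dot y x = (l2dot x y)^*.
Proof. by rewrite rmorph_sum; apply: eq_bigr => i _; rewrite hdotC. Qed.

Lemma l2dot_CS x y : normc (l2dot x y) <= l2norm x * l2norm y.
Proof.
rewrite -le_sqr ?normc_ge0 ?mulr_ge0 ?l2norm_ge0// exprMn.
apply: discriminant_le; rewrite ?sqr_ge0// => w.
have : 0 <= l2norm (fun i => x i + w^* *: y i) ^+ 2 by rewrite sqr_ge0.
rewrite !sqr_l2norm => h; rewrite (le_trans h)// le_eqVlt; apply/orP; left; apply/eqP.
rewrite /l2dot mulr_sumr Re_sum !mulr_sumr -!big_split /=; apply: eq_bigr => i _.
by rewrite sqr_hnormD hdotZr conjcK hnormZ normc_conj exprMn.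
Qed.

Lemma l2norm_coord x i : hnorm (x i) <= l2norm x.
Proof.
rewrite -le_sqr ?hnorm_ge0 ?l2norm_ge0// sqr_l2norm (bigD1 i)//= lerDl.
by rewrite sumr_ge0// => j _; rewrite sqr_ge0.
Qed.

Lemma l2norm_eq0 x : l2norm x = 0 -> forall i, x i = 0.
Proof.
move=> h i; apply: hnorm0_eq0; apply/le_anti; rewrite hnorm_ge0 andbT -h.
exact: l2norm_coord.
Qed.

Lemma l2normZ (a : C) x : l2norm (fun i => a *: x i) = normc a * l2norm x.
Proof.
apply/eqP; rewrite -(@eqrXn2 _ 2) ?l2norm_ge0 ?mulr_ge0 ?normc_ge0 ?l2norm_ge0//.
rewrite exprMn !sqr_l2norm mulr_sumr; apply/eqP; apply: eq_bigr => i _.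
by rewrite hnormZ exprMn.
Qed.

Lemma mxformE T x y : mxform T x y = l2dot (mxop_act T x) y.
Proof. by apply: eq_bigr => i _; rewrite hdot_suml. Qed.

Lemma mxop_actZ T (a : C) x : mxop_act T (fun i => a *: x i) = fun i => a *: mxop_act T x i.
Proof.
apply/funext => i; rewrite /mxop_act scaler_sumr; apply: eq_bigr => j _.
by rewrite bopZr.
Qed.

Lemma mxboundP T M : 0 <= M -> (mxopnorm T <= M%:E)%E <-> mxbound T M.
Proof.
move=> M0; split=> [h x|h].
- have [x0|x0] := eqVneq (l2norm x) 0.
    have -> : mxop_act T x = fun i => 0.
      apply/funext => i; rewrite /mxop_act big1// => j _.
      by rewrite (l2norm_eq0 x0) bop0r.
    rewrite x0 mulr0 /l2norm big1 ?sqrtr0// => i _.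
    by rewrite hnorm0 expr0n.
  have xp : 0 < l2norm x by rewrite lt_def x0 l2norm_ge0.
  pose a := ((l2norm x)^-1)%:C : C.
  have na : normc a = (l2norm x)^-1 by rewrite normcr ger0_norm// invr_ge0 l2norm_ge0.
  have : ((l2norm (mxop_act T (fun i => a *: x i)))%:E <= M%:E)%E.
    apply: le_trans h; apply: ereal_sup_ubound; exists (fun i => a *: x i) => //=.
    by rewrite l2normZ na mulVf.
  by rewrite mxop_actZ l2normZ na lee_fin ler_pdivrMl// mulrC.
- apply: ge_ereal_sup => _ [x /= x1 <-]; rewrite lee_fin (le_trans (h x))//.
  by rewrite ler_piMr.
Qed.

Lemma mxbound_form T M x y : mxbound T M ->
  normc (mxform T x y) <= M * l2norm x * l2norm y.
Proof.
by move=> h; rewrite mxformE (le_trans (l2dot_CS _ _))// ler_wpM2r ?l2norm_ge0.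
Qed.

Lemma form_mxbound T M : 0 <= M ->
  (forall x y, normc (mxform T x y) <= M * l2norm x * l2norm y) -> mxbound T M.
Proof.
move=> M0 h x; set y := mxop_act T x.
have [->|y0] := eqVneq (l2norm y) 0; first by rewrite mulr_ge0 ?l2norm_ge0.
have yp : 0 < l2norm y by rewrite lt_def y0 l2norm_ge0.
rewrite -(ler_pM2r yp); have := h x y; rewrite mxformE l2dotxx normcr.
by rewrite ger0_norm ?sqr_ge0// expr2.
Qed.

(** A crude estimate, which may lose a factor n^2; it serves where such a factor vanishes in a limit
    or does not matter. *)
Lemma mxbound_entries T (c : 'I_n -> 'I_n -> R) :
  (forall i j, 0 <= c i j) ->
  (forall i j a b, normc (hdot (T i j a) b) <= c i j * hnorm a * hnorm b) ->
  mxbound T (\sum_i \sum_j c i j).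
Proof.
move=> c0 h; have s0 : 0 <= \sum_i \sum_j c i j.
  by apply: sumr_ge0 => i _; apply: sumr_ge0 => j _.
apply: form_mxbound => // x y.
have normc_sum (F : 'I_n -> C) : normc (\sum_i F i) <= \sum_i normc (F i).
  elim/big_ind2 : _ => [|x' a1 y' b1 xa yb|//]; first by rewrite Normc.normc0.
  by rewrite (le_trans (le_normcD _ _))// lerD.
rewrite (le_trans (normc_sum _))// -mulrA mulr_suml ler_sum// => i _.
rewrite (le_trans (normc_sum _))// mulr_suml ler_sum// => j _.
rewrite (le_trans (h _ _ _ _))// -mulrA ler_wpM2l//.
by rewrite ler_pM ?hnorm_ge0// l2norm_coord.
Qed.

Lemma mxbound_entry T M i j a b : 0 <= M -> mxbound T M ->
  normc (hdot (T i j a) b) <= M * hnorm a * hnorm b.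
Proof.
move=> M0 h; pose x (k : 'I_n) := if k == j then a else 0.
pose y (k : 'I_n) := if k == i then b else 0.
have nx : l2norm x = hnorm a.
  apply/eqP; rewrite -(@eqrXn2 _ 2) ?l2norm_ge0 ?hnorm_ge0// sqr_l2norm (bigD1 j)//=.
  rewrite /x eqxx big1 ?addr0// => k /negPf->; by rewrite hnorm0 expr0n.
have ny : l2norm y = hnorm b.
  apply/eqP; rewrite -(@eqrXn2 _ 2) ?l2norm_ge0 ?hnorm_ge0// sqr_l2norm (bigD1 i)//=.
  rewrite /y eqxx big1 ?addr0// => k /negPf->; by rewrite hnorm0 expr0n.
have := mxbound_form x y h; rewrite nx ny /mxform (bigD1 i)//= (bigD1 j)//=.
rewrite /x /y !eqxx big1 ?addr0 => [|k /negPf->]; last by rewrite bop0r hdot0l.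
rewrite big1 ?addr0// => k /negPf->; rewrite big1// => l _; by rewrite hdot0r.
Qed.

Lemma mxbound_exists T : exists2 M : R, 0 <= M & mxbound T M.
Proof.
have hT (S : bop H) : exists M : R, 0 <= M /\ forall z : H, hnorm (S z) <= M * hnorm z.
  by have [M M0 hM] := bop_bounded S; exists M.
have [M hM] := choice hT; exists (\sum_i \sum_j M (T i j)).
  by apply: sumr_ge0 => i _; apply: sumr_ge0 => j _; exact: (hM _).1.
apply: (@mxbound_entries T (fun i j => M (T i j))) => [i j|i j a b]; first exact: (hM _).1.
by rewrite (le_trans (Cauchy_Schwarz _ _))// ler_wpM2r ?hnorm_ge0 ?(hM _).2.
Qed.

Lemma mxop_actM S T x : mxop_act (S *m T) x = mxop_act S (mxop_act T x).
Proof.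
apply/funext => i; rewrite /mxop_act.
under eq_bigr do rewrite mxE bop_sumE.
by rewrite exchange_big/=; apply: eq_bigr => k _; rewrite bop_sumr.
Qed.

Lemma mxbound_mul S T M N : 0 <= M -> mxbound S M -> mxbound T N ->
  mxbound (S *m T) (M * N).
Proof.
move=> M0 hS hT x; rewrite mxop_actM (le_trans (hS _))// -mulrA.
by rewrite ler_wpM2l.
Qed.

Lemma mxadj_form T x y : mxform (mxadj T) x y = (mxform T y x)^*.
Proof.
rewrite /mxform exchange_big rmorph_sum; apply: eq_bigr => i _.
rewrite rmorph_sum; apply: eq_bigr => j _; rewrite !mxE /=.
by rewrite [LHS]hdotC -adjP.
Qed.

Lemma mxbound_adj T M : 0 <= M -> mxbound T M -> mxbound (mxadj T) M.
Proof.
move=> M0 h; apply: form_mxbound => // x y.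
by rewrite mxadj_form normc_conj mulrAC mxbound_form.
Qed.

Lemma mxform_inj S T : (forall x y, mxform S x y = mxform T x y) -> S = T.
Proof.
move=> h; apply/matrixP => i j; apply: bop_ext => a; apply: hdot_injl => b.
have := h (fun k => if k == j then a else 0) (fun k => if k == i then b else 0).
have E (U : 'M[bop H]_n) : mxform U (fun k => if k == j then a else 0)
    (fun k => if k == i then b else 0) = hdot (U i j a) b.
  rewrite /mxform (bigD1 i)//= (bigD1 j)//= !eqxx.
  rewrite big1 ?addr0 => [|k /negPf->]; last by rewrite bop0r hdot0l.
  rewrite big1 ?addr0// => k /negPf->; rewrite big1// => l _; by rewrite hdot0r.
by rewrite !E.
Qed.

Lemma mxadjM S T : mxadj (S *m T) = mxadj T *m mxadj S.
Proof.
apply: mxform_inj => x y; rewrite mxadj_form mxformE mxop_actM -mxformE.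
rewrite [RHS]mxformE mxop_actM -mxformE mxadj_form; congr (_^*).
by rewrite [RHS]mxformE l2dotC -mxformE mxadj_form conjcK.
Qed.

Lemma mxadjK T : mxadj (mxadj T) = T.
Proof. by apply: mxform_inj => x y; rewrite !mxadj_form conjcK. Qed.

End euclidean_sums.

Section group_algebra_elements.
Context {R : realType} {G : groupType}.
Local Notation C := R[i].
Implicit Types (l : seq (C * G)) (H : hilbert R).

(* Elements of C[G] are represented by lists of coefficients and group elements. *)
Definition lc H (u : G -> bop H) l : bop H := \sum_(p <- l) p.1 *: u p.2.

Definition coefl l (s : G) : C := \sum_(p <- l | p.2 == s) p.1.

Lemma lc_cat H (u : G -> bop H) l l' : lc u (l ++ l') = lc u l + lc u l'.
Proof. exact: big_cat. Qed.

Lemma lc_scale H (u : G -> bop H) a l : lc u [seq (a * p.1, p.2) | p <- l] = a *: lc u l.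
Proof. by rewrite /lc big_map scaler_sumr; apply: eq_bigr => p _; rewrite scalerA. Qed.

Lemma lc1 H (u : G -> bop H) (s : G) : lc u [:: (1, s)] = u s.
Proof. by rewrite /lc big_seq1 scale1r. Qed.

Lemma sum_partition (T : Type) (I : eqType) (M : nmodType) (f : T -> I) (F : T -> M)
    (l : seq T) (r : seq I) : uniq r -> all (fun p => f p \in r) l ->
  \sum_(p <- l) F p = \sum_(t <- r) \sum_(p <- l | f p == t) F p.
Proof.
move=> ur lr; under [RHS]eq_bigr do rewrite big_mkcond.
rewrite exchange_big/=; elim: l lr => [|p l ih]; first by rewrite !big_nil.
move=> /= /andP[pr lr]; rewrite !big_cons ih//; congr (_ + _).
rewrite (bigD1_seq (f p))//= eqxx big1 ?addr0// => t tp.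
by rewrite eq_sym (negPf tp).
Qed.

Lemma lcE H (u : G -> bop H) l :
  lc u l = lincomb u [fset s in [seq p.2 | p <- l]]%fset (coefl l).
Proof.
rewrite /lc /lincomb (@sum_partition _ _ _ snd _ l [fset s in [seq p.2 | p <- l]]%fset) //.
- apply: eq_bigr => s _; rewrite scaler_suml.
  by apply: eq_bigr => p /eqP->.
- exact: fset_uniq.
- by apply/allP => p pl; rewrite !inE; apply/mapP; exists p.
Qed.

Lemma lincombE H (u : G -> bop H) S (c : G -> C) :
  lincomb u S c = lc u [seq (c s, s) | s <- S].
Proof. by rewrite /lc big_map. Qed.

Definition mul_lc l l' := [seq (p.1 * q.1, (p.2 * q.2)%g) | p <- l, q <- l'].
Definition adj_lc l := [seq (p.1^*, (p.2^-1)%g) | p <- l].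

Lemma lc_mul H (pi : G -> bop H) l l' : unitary_rep pi ->
  lc pi (mul_lc l l') = lc pi l * lc pi l'.
Proof.
move=> [_ piM _]; rewrite /lc big_allpairs_dep mulr_suml; apply: eq_bigr => p _.
rewrite mulr_sumr; apply: eq_bigr => q _; rewrite piM.
by apply: bop_ext => x; rewrite !(bopZE, bopME) bopZr scalerA.
Qed.

Lemma adj_unique H (S T : bop H) : (forall x y, hdot (T x) y = hdot x (S y)) -> adj T = S.
Proof.
by move=> h; apply: bop_ext => y; apply: hdot_injr => x; rewrite -adjP h.
Qed.

Lemma lc_adj H (pi : G -> bop H) l : unitary_rep pi -> lc pi (adj_lc l) = adj (lc pi l).
Proof.
move=> piU; apply/esym/adj_unique => x y; rewrite /lc big_map !bop_sumE hdot_suml hdot_sumr.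
apply: eq_bigr => p _; rewrite !bopZE hdotZl hdotZr conjcK; congr (_ * _).
exact: rep_dotV.
Qed.

Section matrices.
Context {n : nat}.
Implicit Types Z W : 'I_n -> 'I_n -> seq (C * G).

Definition lcmx H (u : G -> bop H) Z : 'M[bop H]_n := \matrix_(i, j) lc u (Z i j).

Definition mul_lcmx Z W i j := flatten [seq mul_lc (Z i k) (W k j) | k <- index_enum 'I_n].
Definition adj_lcmx Z i j := adj_lc (Z j i).

Lemma lc_flatten H (u : G -> bop H) (ls : seq (seq (C * G))) :
  lc u (flatten ls) = \sum_(l <- ls) lc u l.
Proof. exact: big_flatten. Qed.

Lemma lcmx_mul H (pi : G -> bop H) Z W : unitary_rep pi ->
  lcmx pi (mul_lcmx Z W) = lcmx pi Z *m lcmx pi W.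
Proof.
move=> piU; apply/matrixP => i j; rewrite !mxE lc_flatten big_map.
by apply: eq_bigr => k _; rewrite !mxE lc_mul.
Qed.

Lemma lcmx_adj H (pi : G -> bop H) Z : unitary_rep pi ->
  lcmx pi (adj_lcmx Z) = mxadj (lcmx pi Z).
Proof. by move=> piU; apply/matrixP => i j; rewrite !mxE lc_adj. Qed.

End matrices.
End group_algebra_elements.

(** * Comparison of matrix norms between [delta] and an arbitrary representation *)

Section norm_comparison.
Context {R : realType} {G : groupType} (A : group_cstar R G).
Local Notation C := R[i].
Local Notation K := (gc_space A).
Local Notation delta := (delta A).
Context {L : hilbert R} (pi0 : G -> bop L) (piU : unitary_rep pi0).

Lemma opnormP (H : hilbert R) (T : bop H) (M : R) : 0 <= M ->
  (opnorm T <= M%:E)%E <-> forall x, hnorm (T x) <= M * hnorm x.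
Proof.
move=> M0; split=> [h x|h].
- have [x0|x0] := eqVneq (hnorm x) 0.
    by rewrite (hnorm0_eq0 x0) bop0r hnorm0 mulr0.
  have xp : 0 < hnorm x by rewrite lt_def x0 hnorm_ge0.
  pose a := ((hnorm x)^-1)%:C : C.
  have na : normc a = (hnorm x)^-1 by rewrite normcr ger0_norm// invr_ge0 hnorm_ge0.
  have : ((hnorm (T (a *: x)))%:E <= M%:E)%E.
    apply: le_trans h; apply: ereal_sup_ubound; exists (a *: x) => //=.
    by rewrite hnormZ na mulVf.
  by rewrite bopZr hnormZ na lee_fin ler_pdivrMl// mulrC.
- apply: ge_ereal_sup => _ [x /= x1 <-]; rewrite lee_fin (le_trans (h x))//.
  by rewrite ler_piMr.
Qed.

Lemma lc_norm_le (l : seq (C * G)) (M : R) : 0 <= M ->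
  (forall x, hnorm (lc delta l x) <= M * hnorm x) ->
  forall x, hnorm (lc pi0 l x) <= M * hnorm x.
Proof.
move=> M0 /(opnormP _ M0) h; apply/(opnormP _ M0); apply: le_trans h.
by rewrite !lcE; exact: delta_universal.
Qed.

(** If x > y > 0, Bernoulli's inequality makes (x / y)^(2^m) grow at least linearly in 2^m, so that
    it exceeds B. *)
Let pow_le (x y B : R) : 0 <= x -> 0 <= y ->
  (forall m, x ^+ (2 ^ m) <= B * y ^+ (2 ^ m)) -> x <= y.
Proof.
move=> x0 y0 h; rewrite leNgt; apply/negP => yx.
have [y_eq0|y_neq0] := eqVneq y 0.
  by have := h 0%N; rewrite expr1 y_eq0 mulr0 leNgt -[X in X < _]y_eq0 yx.
have yp : 0 < y by rewrite lt_def y_neq0.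
pose d := x / y - 1; have d0 : 0 < d by rewrite subr_gt0 ltr_pdivlMr// mul1r.
have bern N : 1 + N%:R * d <= (x / y) ^+ N.
  elim: N => [|N ih]; first by rewrite mul0r addr0 expr0.
  rewrite exprS (_ : x / y = 1 + d) in ih *; last by rewrite /d addrC subrK.
  have N0 : 0 <= N%:R :> R by [].
  rewrite (le_trans _ (ler_wpM2l _ ih))//; last by rewrite addr_ge0// ltW.
  rewrite -natr1; nra.
have hB m : 1 + (2 ^ m)%:R * d <= B.
  rewrite (le_trans (bern _))// expr_div_n ler_pdivrMr ?exprn_gt0//.
have [m hm] : exists m : nat, m.+1%:R^-1 < d / (`|B| + 1).
  by apply: exists_invS_lt; rewrite divr_gt0// ltr_wpDl.
move: hm; rewrite ltr_pdivlMr; last by rewrite ltr_wpDl.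
rewrite mulrC ltr_pdivrMr// => hm.
have := hB m.+1; have : m.+1%:R <= (2 ^ m.+1)%:R :> R by rewrite ler_nat ltnW// ltn_expl.
have := ler_norm B; move: hm; set a := m.+1%:R; set b := (2 ^ _)%:R => hm B1 ab.
have : a * d <= b * d by rewrite ler_wpM2r// ltW.
rewrite [d * a]mulrC in hm.
lra.
Qed.

Context {n : nat}.
Implicit Types Z : 'I_n -> 'I_n -> seq (C * G).

(* The norms of self-adjoint matrices satisfy [||T ^ 2|| = ||T|| ^ 2], and up to
   the constant [n ^ 2], which disappears in the limit of high powers, a matrix is
   controlled by the norms of its entries. *)
Let herm_bound Z (M : R) : 0 <= M -> mxadj (lcmx pi0 Z) = lcmx pi0 Z ->
  mxbound (lcmx delta Z) M -> mxbound (lcmx pi0 Z) M.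
Proof.
move=> M0 SH hM x0.
pose W m := iter m (fun W => mul_lcmx W W) Z.
have WH m : mxadj (lcmx pi0 (W m)) = lcmx pi0 (W m).
  by elim: m => [//|m ih] /=; rewrite lcmx_mul// mxadjM ih.
have WM m : mxbound (lcmx delta (W m)) (M ^+ (2 ^ m)).
  elim: m => [|m ih] /=; first by rewrite expr1.
  rewrite lcmx_mul; last exact: delta_unitary.
  by rewrite expnS mul2n -addnn exprD; apply: mxbound_mul; rewrite ?exprn_ge0.
have Wpi m : mxbound (lcmx pi0 (W m)) (\sum_(i < n) \sum_(j < n) M ^+ (2 ^ m)).
  apply: (@mxbound_entries _ _ _ _ (fun _ _ => M ^+ (2 ^ m))) => [i j|i j a b].
    by rewrite exprn_ge0.
  rewrite (le_trans (Cauchy_Schwarz _ _))// ler_wpM2r ?hnorm_ge0// mxE.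
  apply: lc_norm_le; first by rewrite exprn_ge0.
  move=> c; set d := lc _ _ _; have [->|d0] := eqVneq (hnorm d) 0.
    by rewrite mulr_ge0 ?exprn_ge0 ?hnorm_ge0.
  have dp : 0 < hnorm d by rewrite lt_def d0 hnorm_ge0.
  rewrite -(ler_pM2r dp) -expr2 sqr_hnorm (le_trans (Re_le_normc _))//.
  have := mxbound_entry i j c d (exprn_ge0 _ M0) (WM m); rewrite mxE; exact.
suff h x : l2norm x = 1 -> l2norm (mxop_act (lcmx pi0 Z) x) <= M.
  have [xz|xnz] := eqVneq (l2norm x0) 0.
    have := Wpi 0%N x0; rewrite xz !mulr0; exact.
  pose a := ((l2norm x0)^-1)%:C : C.
  have na : normc a = (l2norm x0)^-1 by rewrite normcr ger0_norm// invr_ge0 l2norm_ge0.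
  have := h (fun i => a *: x0 i); rewrite mxop_actZ !l2normZ na mulVf// => /(_ erefl).
  by rewrite ler_pdivrMl// ?[_ * M]mulrC// lt_def xnz l2norm_ge0.
(* [W m] is the power Z^(2^m). As it is self-adjoint, c m ^ 2 is the form of Z^(2^(m + 1)) at x,
   hence at most c (m + 1). *)
move=> x1; pose c m := l2norm (mxop_act (lcmx pi0 (W m)) x).
have cc m : c m ^+ 2 <= c m.+1.
  have E : mxform (lcmx pi0 (W m.+1)) x x = (c m ^+ 2)%:C.
    rewrite lcmx_mul// mxformE mxop_actM -mxformE -{1}(WH m) mxadj_form mxformE.
    by rewrite -l2dotC l2dotxx.
  have := l2dot_CS (mxop_act (lcmx pi0 (W m.+1)) x) x.
  by rewrite -mxformE E x1 mulr1 normcr ger0_norm ?sqr_ge0.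
have cpow m : c 0%N ^+ (2 ^ m) <= c m.
  elim: m => [|m ih]; first by rewrite expr1.
  rewrite expnS mulnC exprM (le_trans _ (cc m))//.
  by rewrite le_sqr ?exprn_ge0 ?l2norm_ge0.
apply: (@pow_le _ _ (\sum_(i < n) \sum_(j < n) 1)) => //; first exact: l2norm_ge0.
move=> m; rewrite (le_trans (cpow m))// (le_trans (Wpi m x))// x1 mulr1 mulr_suml.
by rewrite ler_sum// => i _; rewrite mulr_suml ler_sum// => j _; rewrite mul1r.
Qed.

(** The C^*-identity reduces Z to the self-adjoint Z^* Z, to which [herm_bound] applies. The result
    extends [delta_universal] from elements to matrices. *)
Theorem mxbound_universal Z (M : R) : 0 <= M ->
  mxbound (lcmx delta Z) M -> mxbound (lcmx pi0 Z) M.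
Proof.
move=> M0 hM x.
have dU := delta_unitary A.
pose Y := mul_lcmx (adj_lcmx Z) Z.
have hY : mxbound (lcmx pi0 Y) (M ^+ 2).
  apply: herm_bound; first by rewrite exprn_ge0.
    by rewrite lcmx_mul// lcmx_adj// mxadjM mxadjK.
  by rewrite lcmx_mul// lcmx_adj// expr2; apply: mxbound_mul => //; exact: mxbound_adj.
have := mxbound_form x x hY; rewrite lcmx_mul// lcmx_adj// mxformE mxop_actM.
rewrite -mxformE mxadj_form normc_conj mxformE l2dotxx normcr ger0_norm ?sqr_ge0//.
by rewrite -mulrA -expr2 -exprMn le_sqr ?mulr_ge0 ?l2norm_ge0.
Qed.

End norm_comparison.

Section diagonal_forms.
Context {R : realType} {G : groupType} {V : lmodType R[i]}.
Local Notation C := R[i].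

(** The coefficients of the regular representation with multiplicity space (V, b). It serves for the
    independence of the [delta s], and as the trace from which the separation argument starts. *)
Definition diag_form (b : V -> V -> C) (s : G) (x y : V) : C :=
  if s == 1%g then b x y else 0.

Lemma diag_sesqui b s : sesquiform b -> sesquiform (diag_form b s).
Proof.
rewrite /diag_form; case: eqP => // _ _; split=> *; by rewrite mulr0 addr0.
Qed.

Lemma diag_fpsd b (D : set G) : sesquiform b -> (forall x, 0 <= b x x) ->
  fpsd D (diag_form b).
Proof.
move=> bs b0 l _; pose r := undup [seq p.1 | p <- l].
have lr : all (fun p => p.1 \in r) l.
  by apply/allP => p pl; rewrite mem_undup; apply/mapP; exists p.
rewrite (sum_partition _ (undup_uniq _) lr) sumr_ge0// => t _.
set v := \sum_(p <- l | p.1 == t) p.2.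
rewrite (_ : \sum_(_ <- _ | _) _ = b v v) ?b0//.
rewrite {2}/v (sesqui_sumr bs); apply: eq_bigr => p /eqP pt.
rewrite /v (sesqui_suml bs) [RHS]big_mkcond; apply: eq_bigr => q _.
rewrite /diag_form pt -(inj_eq (mulIg q.1)) mulgVK mul1g eq_sym.
by [].
Qed.

End diagonal_forms.

(** * Linear independence of the canonical unitaries *)

Section linear_independence.
Context {R : realType} {G : groupType} (A : group_cstar R G).
Local Notation C := R[i].
Local Notation K := (gc_space A).
Local Notation delta := (delta A).
Implicit Types (l : seq (C * G)).

(** In the regular representation, obtained from [diag_form] on C, the coefficient at t is the inner
    product of l applied to [J 1] with the translate of [J 1] by t. The bound 0 in [lc_norm_le]
    transports the vanishing to that representation. *)
Lemma delta_free l : lc delta l = 0 -> forall s, coefl l s = 0.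
Proof.
move=> l0 t.
pose b (x y : C^o) : C := x * y^*.
have bs : sesquiform b.
  by split=> a x y z; rewrite /b; [rewrite mulrDl -mulrA|rewrite rmorphD rmorphM mulrDr; ring].
have [||L [pi0 [J [piU Jl Jpi]]]] := @GNS R G C^o (diag_form b).
- by move=> s; exact: diag_sesqui.
- by apply: diag_fpsd => // x; rewrite /b mul_conjc ler0c sqr_ge0.
have : lc pi0 l (J 1) = 0.
  apply: hnorm0_eq0; apply/le_anti; rewrite hnorm_ge0 andbT -(mul0r (hnorm (J 1))).
  by apply: (lc_norm_le (A := A) piU (lexx 0)) => x; rewrite l0 bop0E hnorm0 mul0r.
move=> /(congr1 (fun z => hdot z (pi0 t (J 1)))); rewrite hdot0l /lc bop_sumE hdot_suml => <-.
rewrite /coefl big_mkcond; apply: eq_bigr => p _; rewrite bopZE hdotZl.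
have -> : hdot (pi0 p.2 (J 1)) (pi0 t (J 1)) = hdot (pi0 (t^-1 * p.2)%g (J 1)) (J 1).
  by rewrite (repM piU) (rep_dotV piU (t^-1)%g) invgK.
rewrite Jpi /diag_form /b conj1 mulr1 mulg_eq1 (inj_eq invg_inj) eq_sym.
by case: eqP => _; rewrite ?mulr1 ?mulr0.
Qed.

Lemma lc_delta_inj (H : hilbert R) (u : G -> bop H) l l' :
  lc delta l = lc delta l' -> lc u l = lc u l'.
Proof.
move=> ll'; apply/eqP; rewrite -subr_eq0; apply/eqP.
pose m := l ++ [seq (-1 * p.1, p.2) | p <- l'].
have mE (H' : hilbert R) (w : G -> bop H') : lc w m = lc w l - lc w l'.
  by rewrite lc_cat lc_scale scaleN1r.
rewrite -mE lcE; have m0 : lc delta m = 0 by rewrite mE ll' subrr.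
by rewrite /lincomb big1// => s _; rewrite (delta_free m0) scale0r.
Qed.

Lemma linear_extension (H : hilbert R) (u : G -> bop H) :
  exists phi : bop K -> bop H, forall l, phi (lc delta l) = lc u l.
Proof.
have h (X : bop K) : exists T : bop H, forall l, X = lc delta l -> T = lc u l.
  have [[l ->]|h] := pselect (exists l, X = lc delta l).
    by exists (lc u l) => l'; exact: lc_delta_inj.
  by exists 0 => l Xl; case: h; exists l.
by have [phi hphi] := choice h; exists phi => l; exact: hphi.
Qed.

Lemma delta1 : delta 1%g = 1. Proof. by have [] := delta_unitary A. Qed.

(** On the zero space [delta 1] would vanish, against linear independence. A nonzero vector is what
    recovers scalar matrices from operators in [smx_root]. *)
Lemma gc_space_nontrivial : exists x : K, x != 0.
Proof.
apply/not_existsP => h.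
have := @delta_free [:: (1, 1%g)]; rewrite lc1 => /(_ _ 1%g).
rewrite /coefl big_mkcond big_seq1 eqxx => h1.
suff /eqP : (1 : C) = 0 by rewrite oner_eq0.
apply: h1; apply: bop_ext => x; rewrite bop0E; apply/eqP/negPn/negP => hx.
exact: (h _ hx).
Qed.

Lemma span_deltaP (D : set G) (X : bop K) : span_delta D X <->
  exists2 l, (forall p, p \in l -> D p.2) & X = lc delta l.
Proof.
split=> [[S [c [SD ->]]]|[l lD ->]].
  exists [seq (c s, s) | s <- S]; last exact: lincombE.
  by move=> _ /mapP[s sS ->]; exact: SD.
exists [fset s in [seq p.2 | p <- l]]%fset, (coefl l); split; last exact: lcE.
by move=> s; rewrite !inE/= => /mapP[p pl ->]; exact: lD.
Qed.

Lemma linear_on_lc (H : hilbert R) (D : set G) (E : set (bop K)) (phi : bop K -> bop H) l :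
  span_delta D `<=` E -> linear_on E phi -> (forall p, p \in l -> D p.2) ->
  phi (lc delta l) = lc (phi \o delta) l.
Proof.
move=> DE phil; have E0 : E 0.
  by apply/DE/span_deltaP; exists [::] => //; rewrite /lc big_nil.
have phi0 : phi 0 = 0.
  by have := phil (-1) 0 0 E0 E0; rewrite scaler0 addr0 scaleN1r addNr.
elim: l => [_|p l ih lD]; first by rewrite /lc !big_nil.
rewrite /lc !big_cons phil/=.
- by rewrite -/(lc _ _) ih// => q ql; apply: lD; rewrite inE ql orbT.
- apply/DE/span_deltaP; exists [:: (1, p.2)]; last by rewrite lc1.
  by move=> q; rewrite inE => /eqP->; exact: (lD p (mem_head _ _)).
- apply/DE/span_deltaP; exists l => // q ql; by apply: lD; rewrite inE ql orbT.
Qed.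

(** Linear independence makes the set in [xget] inhabited, so that [phi_UOS] is a map with these
    properties and not the default. *)
Lemma phi_UOSP (H : hilbert R) (D : set G) (u : G -> bop H) :
  linear_on (span_delta D) (phi_UOS D u : bop K -> bop H) /\
  forall s, D s -> phi_UOS D u (delta s) = u s.
Proof.
suff : [set phi : bop K -> bop H | linear_on (span_delta D) phi /\
    forall s, D s -> phi (delta s) = u s] (phi_UOS D u) by [].
apply: xgetPex; have [phi hphi] := linear_extension u; exists phi; split.
  move=> a X Y /span_deltaP[l _ ->] /span_deltaP[l' _ ->].
  by rewrite -lc_scale -lc_cat !hphi lc_cat lc_scale.
by move=> s _; rewrite -(lc1 delta) hphi lc1.
Qed.

Lemma phi_UOS_lc (H : hilbert R) (D : set G) (u : G -> bop H) l :
  (forall p, p \in l -> D p.2) -> phi_UOS D u (lc delta l) = lc u l.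
Proof.
move=> lD; have [phil phis] := phi_UOSP D u.
rewrite (@linear_on_lc _ D (span_delta D))// /lc !big_seq.
by apply: eq_bigr => p /lD pD /=; rewrite phis.
Qed.

End linear_independence.

Section matrix_forms.
Context {R : realType} {H : hilbert R} {n : nat}.
Local Notation C := R[i].
Implicit Types (S T : 'M[bop H]_n) (x y : 'I_n -> H).

Lemma mxform_addl T x x' y : mxform T (fun i => x i + x' i) y = mxform T x y + mxform T x' y.
Proof.
rewrite -big_split; apply: eq_bigr => i _; rewrite -big_split; apply: eq_bigr => j _ /=.
by rewrite bopDr hdotDl.
Qed.

Lemma mxform_addr T x y y' : mxform T x (fun i => y i + y' i) = mxform T x y + mxform T x y'.
Proof.
rewrite -big_split; apply: eq_bigr => i _; rewrite -big_split; apply: eq_bigr => j _ /=.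
by rewrite hdotDr.
Qed.

Lemma mxform_scalel T (a : C) x y : mxform T (fun i => a *: x i) y = a * mxform T x y.
Proof.
rewrite mulr_sumr; apply: eq_bigr => i _; rewrite mulr_sumr; apply: eq_bigr => j _.
by rewrite bopZr hdotZl.
Qed.

Lemma mxform_scaler T (a : C) x y : mxform T x (fun i => a *: y i) = a^* * mxform T x y.
Proof.
rewrite mulr_sumr; apply: eq_bigr => i _; rewrite mulr_sumr; apply: eq_bigr => j _.
by rewrite hdotZr.
Qed.

Lemma mxformD S T x y : mxform (S + T) x y = mxform S x y + mxform T x y.
Proof.
rewrite -big_split; apply: eq_bigr => i _; rewrite -big_split; apply: eq_bigr => j _ /=.
by rewrite mxE hdotDl.
Qed.

Lemma mxformN T x y : mxform (- T) x y = - mxform T x y.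
Proof.
rewrite -sumrN; apply: eq_bigr => i _; rewrite -sumrN; apply: eq_bigr => j _ /=.
by rewrite mxE bopNE hdotNl.
Qed.

Lemma mxformB S T x y : mxform (S - T) x y = mxform S x y - mxform T x y.
Proof. by rewrite mxformD mxformN. Qed.

Lemma mxform_sum (I : Type) (r : seq I) (P : pred I) (F : I -> 'M[bop H]_n) x y :
  mxform (\sum_(k <- r | P k) F k) x y = \sum_(k <- r | P k) mxform (F k) x y.
Proof.
apply: (big_morph (fun T => mxform T x y)) => [S T|]; first exact: mxformD.
by rewrite -(subrr (0 : 'M[bop H]_n)) mxformB subrr.
Qed.

Lemma mxform_polar S T : (forall x, mxform S x x = mxform T x x) -> S = T.
Proof.
move=> h; apply: mxform_inj => x y.
have hD a : a^* * mxform S x y + a * mxform S y x = a^* * mxform T x y + a * mxform T y x.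
  have := h (fun i => x i + a *: y i).
  rewrite !mxform_addl !mxform_addr !mxform_scalel !mxform_scaler !h => e.
  move/eqP: e; rewrite -!addrA (inj_eq (addrI _)) !addrA (inj_eq (addIr _)) => /eqP.
  exact.
have h1 := hD 1; have h2 := hD 'i; rewrite conj1 !mul1r in h1.
have ci : ('i : C)^* = - 'i by exact: conj_imag.
rewrite ci !mulNr in h2.
have h3 : - mxform S x y + mxform S y x = - mxform T x y + mxform T y x.
  apply: (@mulfI _ ('i : C)); first by rewrite eq_complex /= oner_eq0 andbF.
  by rewrite !mulrDr !mulrN.
apply: (@mulfI _ (2 : C)); first by rewrite pnatr_eq0.
have -> : 2 * mxform S x y = (mxform S x y + mxform S y x) - (- mxform S x y + mxform S y x) by ring.
by rewrite h1 h3; ring.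
Qed.

Lemma mxop_pos_herm T : mxop_pos T -> mxadj T = T.
Proof.
move=> Tp; apply: mxform_polar => x; rewrite mxadj_form.
have : 0 <= mxform T x x := Tp x.
by move=> /ge0_ReE ->; rewrite conjc_real.
Qed.

Definition scal_mx (a : C) : 'M[bop H]_n :=
  \matrix_(i, j) (if i == j then a *: (1 : bop H) else 0).

Lemma mxform_scalar_mx (a : C) x y : mxform (scal_mx a) x y = a * l2dot x y.
Proof.
rewrite mulr_sumr; apply: eq_bigr => i _.
rewrite (bigD1 i)//= mxE eqxx bopZE bop1E hdotZl big1 ?addr0// => j ji.
by rewrite mxE eq_sym (negPf ji) bop0E hdot0l.
Qed.

(* The positive form [r |x|^2 - <T x, x>] satisfies the Cauchy-Schwarz inequality. *)
Lemma mxop_pos_dist T (r : R) : mxop_pos T -> mxbound T r -> 0 <= r ->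
  mxbound (scal_mx r%:C - T) r.
Proof.
move=> Tp Tr r0; apply: form_mxbound => // x y.
set S := _ - T.
have SE u v : mxform S u v = r%:C * l2dot u v - mxform T u v.
  by rewrite mxformB mxform_scalar_mx.
have ST u : complex.Re (mxform S u u) <= r * l2norm u ^+ 2.
  rewrite SE l2dotxx ReB Re_scale/= gerBl.
  by have := Tp u; rewrite -/(mxform T u u) ge0_complexE => /andP[].
have S0 u : 0 <= mxform S u u.
  have := Tp u; rewrite -/(mxform T u u) SE l2dotxx => /ge0_ReE E; rewrite E.
  rewrite -rmorphM -rmorphB ler0c subr_ge0.
  have := mxbound_form u u Tr; rewrite E normcr expr2 mulrA; apply: le_trans.
  exact: ler_norm.
have SH u v : mxform S v u = (mxform S u v)^*.
  by rewrite -mxadj_form (mxop_pos_herm S0).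
rewrite -le_sqr ?normc_ge0 ?mulr_ge0 ?l2norm_ge0//.
have h : normc (mxform S x y) ^+ 2 <= complex.Re (mxform S x x) * complex.Re (mxform S y y).
  apply: discriminant_le.
    by have := S0 y; rewrite ge0_complexE => /andP[].
  move=> w; have := S0 (fun i => x i + w^* *: y i).
  rewrite ge0_complexE => /andP[_].
  rewrite !mxform_addl !mxform_addr !mxform_scalel !mxform_scaler conjcK (SH x y).
  rewrite mulrA conjc_mul -rmorphM !ReD Re_conjc Re_scale => h.
  rewrite (le_trans h)// le_eqVlt; apply/orP; left; apply/eqP; ring.
rewrite (le_trans h)//.
have -> : (r * l2norm x * l2norm y) ^+ 2 = (r * l2norm x ^+ 2) * (r * l2norm y ^+ 2) by ring.
have ReS0 u : 0 <= complex.Re (mxform S u u) by have := S0 u; rewrite ge0_complexE => /andP[].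
exact: ler_pM.
Qed.

(** Together with [mxop_pos_dist] this expresses positivity by a norm: a self-adjoint T with |T| <=
    r is positive if and only if |r - T| <= r. *)
Lemma mxop_pos_of_dist T (r : R) : mxadj T = T ->
  mxbound (scal_mx r%:C - T) r -> mxop_pos T.
Proof.
move=> TH h x; rewrite -/(mxform T x x).
have := mxbound_form x x h; rewrite mxformB mxform_scalar_mx l2dotxx => hx.
have Tr : complex.Im (mxform T x x) = 0.
  have := congr1 (@complex.Im R) (mxadj_form T x x); rewrite TH Im_conjc; lra.
rewrite ge0_complexE Tr eqxx/=.
have := le_trans (Re_le_normc _) hx; rewrite ReB Re_scale/= expr2; lra.
Qed.

End matrix_forms.

Section positivity_transport.
Context {R : realType} {G : groupType} (A : group_cstar R G).
Local Notation C := R[i].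
Local Notation delta := (delta A).
Context {L : hilbert R} (pi0 : G -> bop L) (piU : unitary_rep pi0) {n : nat}.
Implicit Types Z : 'I_n -> 'I_n -> seq (C * G).

(** Self-adjointness passes to [pi0] because the [delta s] are independent, and the norm of r - Z,
    represented by [W], passes by [mxbound_universal]. *)
Lemma mxop_pos_universal Z : mxop_pos (lcmx delta Z) -> mxop_pos (lcmx pi0 Z).
Proof.
move=> Zp; have dU := delta_unitary A.
have lcmx_pi W W' : lcmx delta W = lcmx delta W' -> lcmx pi0 W = lcmx pi0 W'.
  move=> WW'; apply/matrixP => i j; have := congr1 (fun M => fun_of_matrix M i j) WW'.
  by rewrite !mxE; exact: lc_delta_inj.
have [r r0 hr] := mxbound_exists (lcmx delta Z).
apply: (@mxop_pos_of_dist _ _ _ _ r).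
  by rewrite -lcmx_adj//; apply: lcmx_pi; rewrite lcmx_adj// mxop_pos_herm.
pose W (i j : 'I_n) := (if i == j then [:: (r%:C, 1%g)] else [::]) ++
   [seq (-1 * p.1, p.2) | p <- Z i j].
have WE (H : hilbert R) (w : G -> bop H) : unitary_rep w ->
    lcmx w W = scal_mx r%:C - lcmx w Z.
  move=> [w1 _ _]; apply/matrixP => i j; rewrite !mxE /W lc_cat lc_scale scaleN1r.
  by congr (_ - _); case: eqP => _; rewrite /lc ?big_seq1 ?big_nil ?w1.
rewrite -WE//; apply: (mxbound_universal (A := A)) => //.
by rewrite WE//; apply: mxop_pos_dist.
Qed.

End positivity_transport.

Section hilbert_limits.
Context {R : realType} {H : hilbert R}.
Implicit Types (x : nat -> H).

Lemma hnorm_le_form (z : H) (c : R) : 0 <= c ->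
  (forall y, normc (hdot z y) <= c * hnorm y) -> hnorm z <= c.
Proof.
move=> c0 h; have [->//|z0] := eqVneq (hnorm z) 0.
have zp : 0 < hnorm z by rewrite lt_def z0 hnorm_ge0.
by rewrite -(ler_pM2r zp) -expr2 sqr_hnorm (le_trans (Re_le_normc _)).
Qed.

Lemma hlim_unique x y z (K L : R) : 0 <= K -> 0 <= L ->
  (forall n, hnorm (x n - y) <= K * n.+1%:R^-1) ->
  (forall n, hnorm (x n - z) <= L * n.+1%:R^-1) -> y = z.
Proof.
move=> K0 L0 xy xz; apply/eqP; rewrite -subr_eq0; apply/eqP/hnorm0_eq0.
apply: le_anti; rewrite hnorm_ge0 andbT; apply: le_of_forall_eps => e e0.
have [n hn] : exists n : nat, n.+1%:R^-1 < e / (K + L + 1).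
  by apply: exists_invS_lt; rewrite divr_gt0// ltr_wpDl// addr_ge0.
have -> : y - z = (x n - z) - (x n - y) by rewrite opprB [RHS]addrC addrA subrK.
rewrite (le_trans (ler_hnormD _ _))// hnorm_opp add0r.
rewrite (le_trans (lerD (xz n) (xy n)))//.
move: hn; rewrite ltr_pdivlMr; last by rewrite ltr_wpDl// addr_ge0.
set a := n.+1%:R^-1; have a0 : 0 < a by rewrite invr_gt0.
move=> hn; nra.
Qed.

Lemma hilbert_nested_scaled x (c : R) : 0 <= c ->
  (forall m n, hnorm (x m - x n) <= c * (m.+1%:R^-1 + n.+1%:R^-1)) ->
  exists l, forall n, hnorm (x n - l) <= c * n.+1%:R^-1.
Proof.
rewrite le_eqVlt => /orP[/eqP <- h|c0 h].
  exists (x 0%N) => n; rewrite mul0r; have := h n 0%N; by rewrite mul0r.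
have nc : normc (c^-1)%:C = c^-1 by rewrite normcr ger0_norm// invr_ge0 ltW.
have [m n|l hl] := @hilbert_nested _ H (fun n => (c^-1)%:C *: x n).
  by rewrite -scalerBr hnormZ nc ler_pdivrMl.
exists (c%:C *: l) => n; have := hl n.
have -> : (c^-1)%:C *: x n - l = (c^-1)%:C *: (x n - c%:C *: l).
  by rewrite scalerBr scalerA -rmorphM mulVf ?gt_eqF// scale1r.
by rewrite hnormZ nc ler_pdivrMl.
Qed.

End hilbert_limits.

(** * Completely bounded maps on C^*(G) *)

Section completely_bounded.
Context {R : realType} {G : groupType} (A : group_cstar R G).
Local Notation C := R[i].
Local Notation K := (gc_space A).
Local Notation delta := (delta A).
Context {H : hilbert R}.
Implicit Types (v : G -> bop H) (M N : R) (l : seq (C * G)).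

(* [phi_v] is completely bounded, with cb-norm at most [M], on the span of [delta]. *)
Definition cbbound v M := forall n (Z : 'I_n -> 'I_n -> seq (C * G)) N, 0 <= N ->
  mxbound (lcmx delta Z) N -> mxbound (lcmx v Z) (M * N).

(** Applied to n-tuples coordinatewise, [J1] and [J2] keep their bounds, and [pi0] does not increase
    matrix norms. The second half of the theorem on norms rests on this estimate. *)
Lemma rep_cbbound (L : hilbert R) (pi0 : G -> bop L) (J1 J2 : H -> L) v (c1 c2 : R) :
  unitary_rep pi0 -> 0 <= c1 -> 0 <= c2 ->
  (forall x, hnorm (J1 x) <= c1 * hnorm x) -> (forall x, hnorm (J2 x) <= c2 * hnorm x) ->
  (forall s x y, hdot (v s x) y = hdot (pi0 s (J1 x)) (J2 y)) -> cbbound v (c1 * c2).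
Proof.
move=> piU c10 c20 hJ1 hJ2 hv n Z N N0 hZ.
have hpi := mxbound_universal (A := A) piU N0 hZ.
have l2J (J : H -> L) (c : R) (x : 'I_n -> H) : 0 <= c ->
    (forall x, hnorm (J x) <= c * hnorm x) -> l2norm (J \o x) <= c * l2norm x.
  move=> c0 hJ; rewrite -le_sqr ?mulr_ge0 ?l2norm_ge0// exprMn !sqr_l2norm mulr_sumr.
  by rewrite ler_sum// => i _; rewrite -exprMn le_sqr ?mulr_ge0 ?hnorm_ge0//; exact: hJ.
apply: form_mxbound => [|x y]; first by rewrite !mulr_ge0.
have -> : mxform (lcmx v Z) x y = mxform (lcmx pi0 Z) (J1 \o x) (J2 \o y).
  apply: eq_bigr => i _; apply: eq_bigr => j _; rewrite !mxE /lc !bop_sumE !hdot_suml.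
  by apply: eq_bigr => p _; rewrite !bopZE !hdotZl hv.
rewrite (le_trans (mxbound_form _ _ hpi))//.
have -> : c1 * c2 * N * l2norm x * l2norm y = N * (c1 * l2norm x) * (c2 * l2norm y) by ring.
by rewrite ler_pM ?mulr_ge0 ?l2norm_ge0// ?ler_wpM2l// l2J.
Qed.

Lemma psd_cbbound v : psd setT v -> exists2 M, 0 <= M & cbbound v M.
Proof.
move=> vp; have [|| L [pi0 [J [piU Jl Jv]]]] := @GNS R G H (bform v).
- by move=> s; exact: bform_sesqui.
- exact/psdP.
have [N N0 hN] := bop_bounded (v 1%g).
(* Because the squared norm of J x is the form of [v 1] at x. *)
have hJ x : hnorm (J x) <= Num.sqrt N * hnorm x.
  rewrite -le_sqr ?mulr_ge0 ?sqrtr_ge0 ?hnorm_ge0// exprMn sqr_sqrtr// sqr_hnorm.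
  rewrite -{1}(rep1 piU (J x)) Jv (le_trans (Re_le_normc _))//.
  rewrite (le_trans (Cauchy_Schwarz _ _))// expr2 mulrA.
  by rewrite ler_wpM2r ?hnorm_ge0.
exists (Num.sqrt N * Num.sqrt N); first by rewrite mulr_ge0 ?sqrtr_ge0.
by apply: (rep_cbbound piU _ _ hJ hJ); rewrite ?sqrtr_ge0// => s x y; rewrite Jv.
Qed.

Lemma mxbound_comb n r (S : 'M[bop H]_n) (c : 'I_r -> C) (T : 'I_r -> 'M[bop H]_n)
    (M : 'I_r -> R) : (forall k, 0 <= M k) -> (forall k, mxbound (T k) (M k)) ->
  (forall x y, mxform S x y = \sum_k c k * mxform (T k) x y) ->
  mxbound S (\sum_k normc (c k) * M k).
Proof.
move=> M0 hT SE; apply: form_mxbound => [|x y].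
  by rewrite sumr_ge0// => k _; rewrite mulr_ge0 ?normc_ge0.
rewrite SE !mulr_suml.
elim/big_ind2 : _ => [|a1 b1 a2 b2 h1 h2|k _]; first by rewrite Normc.normc0.
  by rewrite (le_trans (le_normcD _ _))// lerD.
rewrite Normc.normcM -!mulrA ler_wpM2l ?normc_ge0// !mulrA.
exact: mxbound_form.
Qed.

Lemma mxform_lcmx_comb n (Z : 'I_n -> 'I_n -> seq (C * G)) r (c : 'I_r -> C)
    (w : 'I_r -> G -> bop H) v x y :
  (forall i j p, p \in Z i j -> v p.2 = \sum_k c k *: w k p.2) ->
  mxform (lcmx v Z) x y = \sum_k c k * mxform (lcmx (w k) Z) x y.
Proof.
move=> vE; under [RHS]eq_bigr do rewrite mulr_sumr.
rewrite exchange_big; apply: eq_bigr => i _.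
under [RHS]eq_bigr do rewrite mulr_sumr.
rewrite exchange_big; apply: eq_bigr => j _.
rewrite mxE /lc bop_sumE hdot_suml.
under [RHS]eq_bigr do rewrite mxE bop_sumE hdot_suml mulr_sumr.
rewrite exchange_big big_seq [RHS]big_seq; apply: eq_bigr => p hp.
rewrite bopZE hdotZl (vE i j)// bop_sumE hdot_suml mulr_sumr; apply: eq_bigr => k _.
by rewrite !bopZE !hdotZl mulrCA.
Qed.

Lemma BDH_cbbound v : BDH setT v -> exists2 M, 0 <= M & cbbound v M.
Proof.
move=> [r [c [w [wp vE]]]].
have hw k : exists M, 0 <= M /\ cbbound (w k) M.
  by have [M M0 hM] := psd_cbbound (wp k); exists M.
have [M hM] := choice hw; exists (\sum_k normc (c k) * M k).
  by rewrite sumr_ge0// => k _; rewrite mulr_ge0 ?normc_ge0 ?(hM _).1.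
move=> n Z N N0 hZ; rewrite mulr_suml.
under eq_bigr do rewrite -mulrA.
apply: (mxbound_comb (T := fun k => lcmx (w k) Z)) => [k|k|x y].
- by rewrite mulr_ge0 ?(hM k).1.
- exact: (hM k).2.
- by apply: mxform_lcmx_comb => i j p _; exact: vE.
Qed.

(* The value of the extension at [X] is the limit of [lc v l] as [lc delta l]
   tends to [X]. *)
Definition ext_value v M (X : bop K) (T : bop H) := forall l N, 0 <= N ->
  (forall x, hnorm ((X - lc delta l) x) <= N * hnorm x) ->
  forall x, hnorm (T x - lc v l x) <= M * N * hnorm x.

Lemma cstarP (X : bop K) : cstar X <-> forall e : R, 0 < e ->
  exists l, forall x, hnorm ((X - lc delta l) x) <= e * hnorm x.
Proof.
split=> h e e0.
- have [_ /span_deltaP[l _ ->] hl] := h e e0; exists l.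
  by apply/(opnormP _ (ltW e0))/ltW.
- have [|l hl] := h (e / 2); first by rewrite divr_gt0.
  exists (lc delta l); first by apply/span_deltaP; exists l.
  have e20 : 0 <= e / 2 by rewrite divr_ge0// ltW.
  apply: le_lt_trans (_ : (e / 2)%:E < _)%E; first exact/(opnormP _ e20).
  by rewrite lte_fin; lra.
Qed.

Lemma cstar_linear (a : C) (X Y : bop K) : cstar X -> cstar Y -> cstar (a *: X + Y).
Proof.
move=> /cstarP hX /cstarP hY; apply/cstarP => e e0.
have n0 := normc_ge0 a.
have [|l hl] := hX (e / 2 / (normc a + 1)); first by rewrite !divr_gt0// ltr_wpDl.
have [|l' hl'] := hY (e / 2); first by rewrite divr_gt0.
exists ([seq (a * p.1, p.2) | p <- l] ++ l') => x; rewrite lc_cat lc_scale.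
have -> : (a *: X + Y - (a *: lc delta l + lc delta l')) x =
   a *: (X - lc delta l) x + (Y - lc delta l') x.
  by rewrite !(bopBE, bopDE, bopZE) scalerBr opprD addrACA.
rewrite (le_trans (ler_hnormD _ _))// hnormZ.
have h1 : normc a * hnorm ((X - lc delta l) x) <= e / 2 * hnorm x.
  rewrite (le_trans (ler_wpM2l n0 (hl x)))// mulrA ler_wpM2r ?hnorm_ge0//.
  rewrite mulrCA -[X in _ <= X]mulr1 ler_wpM2l ?divr_ge0// ?(ltW e0)//.
  by rewrite ler_pdivrMr ?mul1r ?lerDl// ltr_wpDl.
have := hl' x; have := hnorm_ge0 x; nra.
Qed.

Lemma cstar_lc l : cstar (lc delta l).
Proof. by apply/cstarP => e e0; exists l => x; rewrite subrr bop0E hnorm0 mulr_ge0 ?hnorm_ge0 ?ltW. Qed.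

Lemma cbbound_lc v M l N : cbbound v M -> 0 <= M -> 0 <= N ->
  (forall x, hnorm (lc delta l x) <= N * hnorm x) ->
  forall x, hnorm (lc v l x) <= M * N * hnorm x.
Proof.
move=> hv M0 N0 hl x; pose Z (i j : 'I_1) := l.
have hZ : mxbound (lcmx delta Z) N.
  have := @mxbound_entries _ _ 1 (lcmx delta Z) (fun _ _ => N) (fun _ _ => N0).
  rewrite !big_ord1; apply=> i j a b.
  by rewrite mxE (le_trans (Cauchy_Schwarz _ _))// ler_wpM2r ?hnorm_ge0.
apply: hnorm_le_form => [|y]; first by rewrite !mulr_ge0 ?hnorm_ge0.
have := mxbound_entry ord0 ord0 x y (mulr_ge0 M0 N0) (hv _ _ _ N0 hZ).
by rewrite mxE.
Qed.

Lemma cbbound_dist v M X m1 m2 N1 N2 : cbbound v M -> 0 <= M -> 0 <= N1 -> 0 <= N2 ->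
  (forall x, hnorm ((X - lc delta m1) x) <= N1 * hnorm x) ->
  (forall x, hnorm ((X - lc delta m2) x) <= N2 * hnorm x) ->
  forall x, hnorm (lc v m1 x - lc v m2 x) <= M * (N1 + N2) * hnorm x.
Proof.
move=> hv M0 N10 N20 h1 h2 x.
pose m := m1 ++ [seq (-1 * p.1, p.2) | p <- m2].
have mE (H' : hilbert R) (w : G -> bop H') : lc w m = lc w m1 - lc w m2.
  by rewrite lc_cat lc_scale scaleN1r.
rewrite -bopBE -mE; apply: cbbound_lc => //; first by rewrite addr_ge0.
move=> z; rewrite mE.
have -> : (lc delta m1 - lc delta m2) z = (X - lc delta m2) z - (X - lc delta m1) z.
  by rewrite !bopBE opprB [RHS]addrC addrA subrK.
by rewrite (le_trans (ler_hnormD _ _))// hnorm_opp mulrDl addrC lerD.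
Qed.

Lemma ext_value_exists v M X : 0 <= M -> cbbound v M -> cstar X ->
  exists T, ext_value v M X T.
Proof.
move=> M0 hv /cstarP hX.
have hl (n : nat) : exists l, forall x, hnorm ((X - lc delta l) x) <= n.+1%:R^-1 * hnorm x.
  exact: hX.
have [l {}hl] := choice hl.
have hT x : exists y, forall n, hnorm (lc v (l n) x - y) <= M * hnorm x * n.+1%:R^-1.
  apply: hilbert_nested_scaled => [|m n]; first by rewrite mulr_ge0 ?hnorm_ge0.
  have r0 k : 0 <= k.+1%:R^-1 :> R by [].
  have := cbbound_dist hv M0 (r0 m) (r0 n) (hl m) (hl n) x.
  by rewrite mulrAC.
have [T {}hT] := choice hT.
have Tl : linear T.
  move=> a x y; apply/esym/(hlim_unique _ _ _ (hT (a *: x + y))); last first.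
  - move=> n; rewrite bop_linear.
    have -> : a *: lc v (l n) x + lc v (l n) y - (a *: T x + T y) =
       a *: (lc v (l n) x - T x) + (lc v (l n) y - T y) by rewrite scalerBr opprD addrACA.
    rewrite (le_trans (ler_hnormD _ _))// hnormZ.
    rewrite (le_trans (lerD (ler_wpM2l (normc_ge0 a) (hT x n)) (hT y n)))//.
    by rewrite [_ * (_ * n.+1%:R^-1)]mulrA -mulrDl.
  - by rewrite mulr_ge0 ?hnorm_ge0.
  - by rewrite addr_ge0 ?mulr_ge0 ?normc_ge0 ?hnorm_ge0.
have hTl m N x : 0 <= N -> (forall x, hnorm ((X - lc delta m) x) <= N * hnorm x) ->
    hnorm (T x - lc v m x) <= M * N * hnorm x.
  move=> N0 hm; apply: le_of_forall_eps => e e0.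
  pose B := M * hnorm x; have B0 : 0 <= B by rewrite mulr_ge0 ?hnorm_ge0.
  have [n hn] : exists n : nat, n.+1%:R^-1 < e / (2 * B + 1).
    by apply: exists_invS_lt; rewrite divr_gt0// ltr_wpDl// mulr_ge0.
  have r0 : 0 <= n.+1%:R^-1 :> R by [].
  have h1 := hT x n; have h2 := cbbound_dist hv M0 r0 N0 (hl n) hm x.
  have -> : T x - lc v m x = (lc v (l n) x - lc v m x) - (lc v (l n) x - T x).
    by rewrite opprB [RHS]addrC addrA subrK.
  rewrite (le_trans (ler_hnormD _ _))// hnorm_opp (le_trans (lerD h2 h1))//.
  move: hn; rewrite ltr_pdivlMr; last by rewrite ltr_wpDl// mulr_ge0.
  set r := n.+1%:R^-1 in r0 *.
  have -> : M * (r + N) * hnorm x = r * B + M * N * hnorm x by rewrite /B; ring.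
  rewrite -/B => hn; nra.
have [m hm] := hX 1 ltr01; have [N N0 hN] := bop_bounded (lc v m).
have [|T' hT'] := bounded_bop (M := M * 1 + N) Tl.
  move=> x; rewrite -[T x](subrK (lc v m x)) (le_trans (ler_hnormD _ _))// mulrDl.
  by rewrite lerD// hTl.
by exists T' => m' N' N'0 hm' x; rewrite hT' hTl.
Qed.

(** Two constants are allowed because the map chosen by [phi_cstar] is known only to have some
    finite cb-norm, unrelated to the sharp one. *)
Lemma ext_value_unique v M M' X T T' : 0 <= M -> 0 <= M' -> cstar X ->
  ext_value v M X T -> ext_value v M' X T' -> T = T'.
Proof.
move=> M0 M'0 /cstarP hX hT hT'; apply: bop_ext => x; apply/eqP.
rewrite -subr_eq0; apply/eqP/hnorm0_eq0/le_anti; rewrite hnorm_ge0 andbT.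
apply: le_of_forall_eps => e e0.
pose B := (M + M') * hnorm x; have B0 : 0 <= B by rewrite mulr_ge0 ?hnorm_ge0 ?addr_ge0.
have d0 : 0 < e / (B + 1) by rewrite divr_gt0// ltr_wpDl.
have [l hl] := hX _ d0.
have -> : T x - T' x = (T x - lc v l x) - (T' x - lc v l x) by rewrite opprB addrA subrK.
rewrite (le_trans (ler_hnormD _ _))// hnorm_opp.
rewrite (le_trans (lerD (hT _ _ (ltW d0) hl x) (hT' _ _ (ltW d0) hl x)))//.
have -> : M * (e / (B + 1)) * hnorm x + M' * (e / (B + 1)) * hnorm x = (e / (B + 1)) * B.
  by rewrite /B; ring.
by rewrite add0r -mulrA ler_piMr ?(ltW e0)// mulrC ler_pdivrMr ?mul1r ?lerDl// ltr_wpDl.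
Qed.

Lemma ext_value_approx v M (X : bop K) (T : bop H) : 0 <= M -> cbbound v M ->
  (forall e, 0 < e -> exists l, (forall x, hnorm ((X - lc delta l) x) <= e * hnorm x) /\
     forall x, hnorm (T x - lc v l x) <= M * e * hnorm x) -> ext_value v M X T.
Proof.
move=> M0 hv h l N N0 hl x; apply: le_of_forall_eps => e e0.
pose B := M * hnorm x; have B0 : 0 <= B by rewrite mulr_ge0 ?hnorm_ge0.
have d0 : 0 < e / (2 * B + 1) by rewrite divr_gt0// ltr_wpDl// mulr_ge0.
have [l' [hX hT]] := h _ d0.
have h2 := cbbound_dist hv M0 (ltW d0) N0 hX hl x.
have -> : T x - lc v l x = (T x - lc v l' x) + (lc v l' x - lc v l x).
  by rewrite addrA subrK.
rewrite (le_trans (ler_hnormD _ _))// (le_trans (lerD (hT x) h2))//.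
set d := e / _; have -> : M * d * hnorm x + M * (d + N) * hnorm x =
   d * (2 * B) + M * N * hnorm x by rewrite /B; ring.
rewrite addrC lerD2l /d mulrAC ler_pdivrMr; last by rewrite ltr_wpDl// mulr_ge0.
by rewrite ler_wpM2l ?(ltW e0)// lerDl.
Qed.

Local Notation cstarA := (@cstar R G A).

Lemma cbbound_extension v M : 0 <= M -> cbbound v M ->
  exists phi : bop K -> bop H, [/\ linear_on cstarA phi, (cbnorm_cstar phi <= M%:E)%E,
    forall s, phi (delta s) = v s & forall X, cstar X -> ext_value v M X (phi X)].
Proof.
move=> M0 hv.
have hphi (X : bop K) : exists T, cstar X -> ext_value v M X T.
  have [cX|ncX] := pselect (cstar X); last by exists 0.
  by have [T hT] := ext_value_exists M0 hv cX; exists T.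
have [phi {}hphi] := choice hphi.
have phil : linear_on cstarA phi.
  move=> a X Y cX cY; have cXY := cstar_linear a cX cY.
  apply: (ext_value_unique M0 M0 cXY (hphi _ cXY)).
  apply: ext_value_approx => // e e0.
  have n0 := normc_ge0 a; have n1 : 0 < normc a + 1 by rewrite ltr_wpDl.
  have d0 : 0 < e / (normc a + 1) by rewrite divr_gt0.
  have de : normc a * (e / (normc a + 1)) + e / (normc a + 1) = e.
    by field; rewrite gt_eqF.
  have /cstarP/(_ _ d0)[l hl] := cX; have /cstarP/(_ _ d0)[l' hl'] := cY.
  exists ([seq (a * p.1, p.2) | p <- l] ++ l'); split=> x; rewrite lc_cat lc_scale.
    have -> : (a *: X + Y - (a *: lc delta l + lc delta l')) x =
       a *: (X - lc delta l) x + (Y - lc delta l') x.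
      by rewrite !(bopBE, bopDE, bopZE) scalerBr opprD addrACA.
    rewrite (le_trans (ler_hnormD _ _))// hnormZ -[in X in _ <= X]de mulrDl.
    by rewrite lerD// -mulrA ler_wpM2l.
  have -> : (a *: phi X + phi Y) x - (a *: lc v l + lc v l') x =
     a *: (phi X x - lc v l x) + (phi Y x - lc v l' x).
    by rewrite !(bopBE, bopDE, bopZE) scalerBr opprD addrACA.
  rewrite (le_trans (ler_hnormD _ _))// hnormZ -[in X in _ <= X]de mulrDr mulrDl.
  rewrite lerD//; last exact: hphi (ltW d0) hl' x.
  rewrite mulrCA -mulrA ler_wpM2l//; exact: hphi (ltW d0) hl x.
exists phi; split => //.
- apply: ge_ereal_sup => _ [n [X [cX X1 ->]]]; apply/(mxboundP _ M0).
  apply: form_mxbound => // x y; apply: le_of_forall_eps => e e0.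
  pose Q : R := \sum_(i < n) \sum_(j < n) 1.
  have Q0 : 0 <= Q by rewrite sumr_ge0// => i _; rewrite sumr_ge0.
  pose B := M * l2norm x * l2norm y.
  have B0 : 0 <= B by rewrite !mulr_ge0 ?l2norm_ge0.
  have QB0 : 0 <= 2 * Q * B by apply: mulr_ge0 => //; exact: mulr_ge0.
  (* Changing the entries by d moves the norms of X and of its image by at most d Q and M d Q, with
     Q = n^2; this d keeps the total error 2 d Q B below e. *)
  have d0 : 0 < e / (2 * Q * B + 1) by rewrite divr_gt0// ltr_wpDl.
  set d := e / _ in d0.
  have hZ (ij : 'I_n * 'I_n) : exists l, forall z,
      hnorm ((X ij.1 ij.2 - lc delta l) z) <= d * hnorm z.
    by have /cstarP := cX ij.1 ij.2; exact.
  have [Z' hZ'] := choice hZ; pose Z i j := Z' (i, j).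
  have sumd (c : R) : \sum_(i < n) \sum_(j < n) c = c * Q.
    rewrite mulr_sumr; apply: eq_bigr => i _; rewrite mulr_sumr.
    by apply: eq_bigr => j _; rewrite mulr1.
  have hE : mxbound (X - lcmx delta Z) (d * Q).
    rewrite -sumd; apply: (@mxbound_entries _ _ _ _ (fun _ _ => d)) => [i j|i j a b].
      exact: ltW.
    rewrite !mxE (le_trans (Cauchy_Schwarz _ _))// ler_wpM2r ?hnorm_ge0//.
    exact: (hZ' (i, j)).
  have hE' : mxbound (map_mx phi X - lcmx v Z) (M * d * Q).
    rewrite -sumd; apply: (@mxbound_entries _ _ _ _ (fun _ _ => M * d)) => [i j|i j a b].
      by rewrite mulr_ge0// ltW.
    rewrite !mxE (le_trans (Cauchy_Schwarz _ _))// ler_wpM2r ?hnorm_ge0//.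
    by apply: hphi; [exact: cX|exact: ltW|exact: (hZ' (i, j))].
  have hZd : mxbound (lcmx delta Z) (1 + d * Q).
    have dQ0 : 0 <= d * Q by rewrite mulr_ge0// ltW.
    apply: form_mxbound => [|a b]; first by rewrite addr_ge0.
    have -> : mxform (lcmx delta Z) a b = mxform X a b - mxform (X - lcmx delta Z) a b.
      by rewrite mxformB; ring.
    rewrite (le_trans (le_normcD _ _))// normcN !mulrDl lerD ?mxbound_form//.
    exact/(mxboundP _ ler01).
  have := hv _ _ _ _ hZd; move=> /(_ (ltac:(by rewrite addr_ge0// mulr_ge0// ltW))) hvZ.
  have -> : mxform (map_mx phi X) x y =
      mxform (lcmx v Z) x y + mxform (map_mx phi X - lcmx v Z) x y.
    by rewrite mxformB; ring.
  rewrite (le_trans (le_normcD _ _))//.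
  rewrite (le_trans (lerD (mxbound_form _ _ hvZ) (mxbound_form _ _ hE')))//.
  have -> : M * (1 + d * Q) * l2norm x * l2norm y + M * d * Q * l2norm x * l2norm y =
     B + d * (2 * Q * B) by rewrite /B; ring.
  rewrite lerD2l /d mulrAC ler_pdivrMr; last by rewrite ltr_wpDl.
  by rewrite ler_wpM2l ?(ltW e0)// lerDl.
- move=> s; have ds : cstar (delta s) by rewrite -lc1; exact: cstar_lc.
  apply: bop_ext => x; apply/eqP; rewrite -subr_eq0; apply/eqP/hnorm0_eq0/le_anti.
  rewrite hnorm_ge0 andbT -(lc1 v) -(mul0r (hnorm x)) -(mulr0 M).
  apply: hphi => // y; by rewrite lc1 subrr bop0E hnorm0 mul0r.
Qed.

Lemma phi_cstarP v M : 0 <= M -> cbbound v M ->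
  [/\ linear_on cstarA (phi_cstar v), (cbnorm_cstar (phi_cstar v : bop K -> bop H) < +oo)%E
    & forall s, phi_cstar v (delta s) = v s].
Proof.
move=> M0 hv; suff : [set phi : bop K -> bop H | [/\ linear_on cstarA phi,
    (cbnorm_cstar phi < +oo)%E & forall s, phi (delta s) = v s]] (phi_cstar v) by [].
apply: xgetPex; have [phi [h1 h2 h3 _]] := cbbound_extension M0 hv.
by exists phi; split=> //; rewrite (le_lt_trans h2)// ltry.
Qed.

Lemma phi_cstar_lc v M l : 0 <= M -> cbbound v M -> phi_cstar v (lc delta l) = lc v l.
Proof.
move=> M0 hv; have [phil _ phis] := phi_cstarP M0 hv.
rewrite (@linear_on_lc _ _ _ _ setT cstarA)//.
  by apply: eq_bigr => p _ /=; rewrite phis.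
by move=> X /span_deltaP[m _ ->]; exact: cstar_lc.
Qed.

(** The norm is that of an arbitrarily chosen cb-map with the right values. Being bounded, this map
    coincides on C^*(G) with the extension by continuity, whose cb-norm is controlled. *)
Lemma BGH_norm_le v M : 0 <= M -> cbbound v M -> (BGH_norm A v <= M%:E)%E.
Proof.
move=> M0 hv; have [phil phicb phis] := phi_cstarP M0 hv.
have [psi [psil psiM psis psiv]] := cbbound_extension M0 hv.
suff E (X : bop K) : cstar X -> phi_cstar v X = psi X.
  apply: le_trans psiM; apply: ge_ereal_sup => _ [n [X [cX X1 ->]]].
  apply: ereal_sup_ubound; exists n, X; split=> //; congr mxopnorm.
  by apply/matrixP => i j; rewrite !mxE E.
move=> cX.
have [B B0 hB] : exists2 B : R, 0 <= B & (cbnorm_cstar (phi_cstar v : bop K -> bop H) <= B%:E)%E.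
  move: phicb; case: (cbnorm_cstar _) => [r _| |_].
  - by exists `|r| => //; rewrite lee_fin ler_norm.
  - by rewrite ltxx.
  - by exists 0 => //; exact: leNye.
apply: (ext_value_unique B0 M0 cX _ (psiv _ cX)) => l N N0 hl x.
rewrite -bopBE -(phi_cstar_lc l M0 hv).
have cY : cstar (X - lc delta l).
  by have := cstar_linear (-1) (cstar_lc l) cX; rewrite scaleN1r addrC.
have -> : phi_cstar v X - phi_cstar v (lc delta l) = phi_cstar v (X - lc delta l).
  have := phil (-1) _ _ (cstar_lc l) cX; rewrite !scaleN1r addrC => ->.
  by rewrite addrC.
set Y := X - _ in cY hl *.
apply: le_of_forall_eps => e e0.
pose B' := B * hnorm x; have B'0 : 0 <= B' by rewrite mulr_ge0 ?hnorm_ge0.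
(* A small positive quantity is added because N may be 0 and Y is rescaled by 1 / d; the norm bound
   is then read off from the cb-norm on 1 x 1 matrices. *)
pose d := N + e / (B' + 1).
have d1 : 0 < e / (B' + 1) by rewrite divr_gt0// ltr_wpDl.
have d0 : 0 < d by rewrite /d ltr_wpDl.
have cdY : cstar ((d^-1)%:C *: Y).
  have := cstar_linear (d^-1)%:C cY (cstar_lc [::]).
  by rewrite /lc big_nil addr0.
have nd : normc (d^-1)%:C = d^-1 by rewrite normcr ger0_norm// invr_ge0 ltW.
pose Z : 'M[bop K]_1 := \matrix_(i, j) ((d^-1)%:C *: Y).
have Z1 : (mxopnorm Z <= 1)%E.
  apply/(mxboundP _ ler01).
  have := @mxbound_entries _ _ 1 Z (fun _ _ => 1) (fun _ _ => ler01).
  rewrite !big_ord1; apply=> i j a b.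
  rewrite mxE (le_trans (Cauchy_Schwarz _ _))// ler_wpM2r ?hnorm_ge0//.
  rewrite bopZE hnormZ nd mul1r ler_pdivrMl// (le_trans (hl a))// ler_wpM2r ?hnorm_ge0//.
  by rewrite lerDl ltW.
have hZB : mxbound (map_mx (phi_cstar v) Z) B.
  apply/(mxboundP _ B0); apply: le_trans hB; apply: ereal_sup_ubound.
  by exists 1%N, Z; split; [move=> i j; rewrite mxE|exact: Z1|].
have phiZ : phi_cstar v ((d^-1)%:C *: Y) = (d^-1)%:C *: phi_cstar v Y.
  have := phil (d^-1)%:C Y (lc delta [::]) cY (cstar_lc _).
  by rewrite (phi_cstar_lc _ M0 hv) /lc !big_nil !addr0.
have : hnorm (((d^-1)%:C *: phi_cstar v Y) x) <= B * hnorm x.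
  apply: hnorm_le_form => [|y]; first by rewrite mulr_ge0 ?hnorm_ge0.
  by have := mxbound_entry ord0 ord0 x y B0 hZB; rewrite !mxE phiZ.
rewrite bopZE hnormZ nd ler_pdivrMl// => /le_trans; apply.
have -> : d * (B * hnorm x) = B * N * hnorm x + e / (B' + 1) * B' by rewrite /d /B'; ring.
rewrite lerD2l mulrAC ler_pdivrMr; last by rewrite ltr_wpDl.
by rewrite ler_wpM2l ?(ltW e0)// lerDl.
Qed.

End completely_bounded.

(** * Extension of positive functionals *)

Section Riesz_extension.
Context {R : realType} {E : lmodType R}.
Variable K : set E.
Hypotheses (KD : forall x y, K x -> K y -> K (x + y)).
Hypothesis KZ : forall (a : R) x, 0 <= a -> K x -> K (a *: x).
Implicit Types X : set (E * R).

(* Linear functionals on subspaces of [E] are handled through their graphs; a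
   positive linear graph is functional as soon as [K 0]. *)
Definition linear_graph X := X (0, 0) /\
  forall (a : R) x r y t, X (x, r) -> X (y, t) -> X (a *: x + y, a * r + t).

Definition positive_graph X := forall x r, X (x, r) -> K x -> 0 <= r.

Lemma linear_graphZ X (a : R) x r : linear_graph X -> X (x, r) -> X (a *: x, a * r).
Proof. by move=> [X0 Xl] Xx; have := Xl a x r 0 0 Xx X0; rewrite !addr0. Qed.

Lemma linear_graphD X x r y t : linear_graph X -> X (x, r) -> X (y, t) -> X (x + y, r + t).
Proof. by move=> [X0 Xl] Xx Xy; have := Xl 1 x r y t Xx Xy; rewrite scale1r mul1r. Qed.

(** The step by one dimension. The value at x must lie above all - t with y + x in K and below all t
    with y - x in K; the infimum of the latter works. Positivity at y + a x is checked after
    division by |a|. *)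
Let extend X x : linear_graph X -> positive_graph X ->
  (exists y t, X (y, t) /\ K (y - x)) -> (exists y t, X (y, t) /\ K (y + x)) ->
  exists X', [/\ X `<=` X', linear_graph X', positive_graph X' & exists r, X' (x, r)].
Proof.
move=> Xl Xp [y1 [t1 [Xy1 Ky1]]] [y2 [t2 [Xy2 Ky2]]].
pose U := [set t | exists y, X (y, t) /\ K (y - x)].
have Ulb y t : X (y, t) -> K (y + x) -> lbound U (- t).
  move=> Xy Ky q [z [Xz Kz]]; rewrite -subr_ge0 opprK.
  apply: (Xp (z + y)); first exact: linear_graphD.
  have -> : z + y = (z - x) + (y + x) by rewrite addrACA [- x + x]addrC subrr addr0.
  exact: KD.
have U0 : U !=set0 by exists t1, y1.
have hU : has_inf U by split=> //; exists (- t2); exact: Ulb Xy2 Ky2.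
pose r := inf U.
have r_le y t : X (y, t) -> K (y - x) -> r <= t.
  by move=> Xy Ky; apply: ge_inf; [exact: hU.2|exists y].
have r_ge y t : X (y, t) -> K (y + x) -> - t <= r.
  by move=> Xy Ky; apply: lb_le_inf => //; exact: Ulb Xy Ky.
pose X' := [set p : E * R | exists y t a, X (y, t) /\ p = (y + a *: x, t + a * r)].
exists X'; split.
- by move=> [y t] Xy; exists y, t, 0; rewrite scale0r mul0r !addr0.
- split; first by exists 0, 0, 0; rewrite scale0r mul0r !addr0; split=> //; exact: Xl.1.
  move=> a _ _ _ _ [y [t [b [Xy [-> ->]]]]] [z [q [c [Xz [-> ->]]]]].
  exists (a *: y + z), (a * t + q), (a * b + c); split; first exact: Xl.2.
  by congr pair; [rewrite scalerDr scalerA addrACA -scalerDl|ring].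
- move=> _ _ [y [t [a [Xy [-> ->]]]]] Ka.
  have [a0|a0|a0] := ltgtP a 0; last by move: Ka; rewrite a0 scale0r mul0r !addr0; exact: Xp.
  + have n0 : 0 < - a by rewrite oppr_gt0.
    have := r_le _ _ (linear_graphZ (- a)^-1 Xl Xy).
    have -> : (- a)^-1 *: y - x = (- a)^-1 *: (y + a *: x).
      by rewrite scalerDr scalerA invrN mulNr mulVf ?lt_eqF// scaleN1r.
    move=> /(_ (KZ _ Ka)); rewrite invr_ge0 ltW// => /(_ erefl).
    rewrite ler_pdivlMl// mulNr; lra.
  + have := r_ge _ _ (linear_graphZ a^-1 Xl Xy).
    have -> : a^-1 *: y + x = a^-1 *: (y + a *: x).
      by rewrite scalerDr scalerA mulVf ?gt_eqF// scale1r.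
    move=> /(_ (KZ _ Ka)); rewrite invr_ge0 ltW// => /(_ erefl).
    by rewrite -mulrN ler_pdivrMl//; lra.
- by exists r, 0, 0, 1; rewrite scale1r mul1r !add0r; split=> //; exact: Xl.1.
Qed.

(** The conclusion is restricted to majorised points: in the application E consists of all real
    functions on the hermitian families, most of which are not dominated by tests. *)
Theorem Riesz_extension X0 : linear_graph X0 -> positive_graph X0 ->
  exists X, [/\ X0 `<=` X, linear_graph X, positive_graph X
    & forall x, (exists y t, X0 (y, t) /\ K (y - x)) ->
                (exists y t, X0 (y, t) /\ K (y + x)) -> exists r, X (x, r)].
Proof.
move=> X0l X0p.
pose P X := X = set0 \/ [/\ X0 `<=` X, linear_graph X & positive_graph X].
have [F FP Ftot|A [PA Amax]] := @Zorn_bigcup _ P.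
  have [[X [FX [X0X Xl Xp]]]|h] :=
      pselect (exists X, F X /\ [/\ X0 `<=` X, linear_graph X & positive_graph X]); last first.
    left; apply/seteqP; split=> // p [X FX Xp]; have [X0'|Xg] := FP _ FX.
      by rewrite X0' in Xp.
    by case: h; exists X.
  right; split.
  - by move=> p /X0X Xp'; exists X.
  - split; first by exists X => //; exact: Xl.1.
    move=> a x r y t [Y FY Yx] [Z FZ Zy].
    have [W [FW Wx Wy]] : exists W, [/\ F W, W (x, r) & W (y, t)].
      by have [YZ|ZY] := Ftot _ _ FY FZ; [exists Z; split=> //; exact: YZ|
        exists Y; split=> //; exact: ZY].
    have [W0|[_ Wl _]] := FP _ FW; first by rewrite W0 in Wx.
    by exists W => //; exact: Wl.2.
  - move=> x r [Y FY Yx]; have [Y0|[_ _ Yp]] := FP _ FY; first by rewrite Y0 in Yx.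
    exact: Yp.
have [A0|[X0A Al Ap]] := PA.
  have PX0 : P X0 by right; split.
  exfalso; apply: (Amax X0 _ PX0).
  by rewrite A0; split=> // h; exact: (h _ X0l.1).
exists A; split=> // x [y1 [t1 [Xy1 Ky1]]] [y2 [t2 [Xy2 Ky2]]].
have [||A' [AA' A'l A'p [r A'r]]] := @extend A x Al Ap.
- by exists y1, t1; split=> //; exact: X0A.
- by exists y2, t2; split=> //; exact: X0A.
have PA' : P A' by right; split=> // p /X0A/AA'.
apply: contrapT => h; apply: (Amax A' _ PA').
by split=> // A'A; apply: h; exists r; exact: A'A.
Qed.

End Riesz_extension.

Section form_extension.
Context {R : realType} {G : groupType} {V : lmodType R[i]}.
Local Notation C := R[i].
Variable D : set G.
Hypothesis hD : positivity_domain D.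
Implicit Types (B : G -> V -> V -> C) (t : seq (G * V * V)) (k : seq (seq (G * V))).

Definition hermitian_family B := [/\ forall s, sesquiform (B s),
  forall s x y, B (s^-1)%g y x = (B s x y)^* & forall s, ~ D s -> forall x y, B s x y = 0].

(* The list [t] represents the element of C[G] (x) V (x) V^* which is the sum of the
   [s (x) x (x) y^*] over [((s, x), y)] in [t]; families of forms act on such elements
   by evaluation, and elements are identified when all hermitian families over [D]
   have the same real part on them. *)
Definition evalt t B : R := \sum_(p <- t) complex.Re (B p.1.1 p.1.2 p.2).

Definition hfamily := {B | hermitian_family B}.

Definition test t : hfamily -> R^o := fun f => evalt t (sval f).

Definition block_test (b : seq (G * V)) : seq (G * V * V) :=
  [seq ((p.1 * q.1^-1)%g, q.2, p.2) | p <- b, q <- b].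

Definition blocks_test k := flatten [seq block_test b | b <- k].

Definition admissible_blocks (D' : set G) k :=
  forall b p q, b \in k -> p \in b -> q \in b -> D' (p.1 * q.1^-1)%g.

Definition supported t := forall p, p \in t -> D p.1.1.

Definition scale_test (a : R) t : seq (G * V * V) := [seq (p.1.1, a%:C *: p.1.2, p.2) | p <- t].

Lemma eval_cat t t' B : evalt (t ++ t') B = evalt t B + evalt t' B.
Proof. exact: big_cat. Qed.

Lemma eval_scale a t B : (forall s, sesquiform (B s)) -> evalt (scale_test a t) B = a * evalt t B.
Proof.
move=> Bs; rewrite /evalt big_map mulr_sumr; apply: eq_bigr => p _ /=.
by rewrite (sesquiZl (Bs _)) Re_scale.
Qed.

Lemma eval1 s x y B : evalt [:: (s, x, y)] B = complex.Re (B s x y).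
Proof. by rewrite /evalt big_seq1. Qed.

Lemma eval_block b B :
  evalt (block_test b) B = complex.Re (\sum_(p <- b) \sum_(q <- b) B (p.1 * q.1^-1)%g q.2 p.2).
Proof.
rewrite /evalt big_allpairs_dep Re_sum; apply: eq_bigr => p _; by rewrite Re_sum.
Qed.

Lemma eval_blocks k B : evalt (blocks_test k) B = \sum_(b <- k) evalt (block_test b) B.
Proof. by rewrite /evalt big_flatten big_map. Qed.

Lemma test_cat t t' : test (t ++ t') = test t + test t'.
Proof. by apply/funext => B; exact: eval_cat. Qed.

Lemma test_scale a t : test (scale_test a t) = a *: test t.
Proof. by apply/funext => -[B hB]; apply: eval_scale; case: hB. Qed.

(** Three pairs of a cone K and a space F of tests occur: the squares over G with the tests
    supported on a subdomain; the squares and one negated test with the multiples of the unit; the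
    squares over D with the tests in the corners. *)
Variable K : set (hfamily -> R^o).
Hypotheses (KD : forall f g, K f -> K g -> K (f + g))
  (KZ : forall (a : R) f, 0 <= a -> K f -> K (a *: f))
  (Kblocks : forall k, admissible_blocks D k -> K (test (blocks_test k))).
Variable F : set (seq (G * V * V)).
Hypotheses (F0 : F [::]) (FD : forall t t', F t -> F t' -> F (t ++ t'))
  (FZ : forall a t, F t -> F (scale_test a t)).
Hypothesis Fmaj : forall x, exists t, F t /\ K (test t - test [:: (1%g, x, x)]).
Variable B0 : G -> V -> V -> C.
Hypotheses (B0h : hermitian_family B0)
  (B0pos : forall t, F t -> K (test t) -> 0 <= evalt t B0).

Theorem form_extension : exists B, [/\ hermitian_family B, fpsd D B,
  forall t, F t -> supported t -> evalt t B = evalt t B0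
  & forall t, supported t -> K (test t) -> 0 <= evalt t B].
Proof.
have D1 := hD.1.
have B0s : forall s, sesquiform (B0 s) by case: B0h.
have K0 : K 0.
  have := Kblocks (k := [::]); rewrite /blocks_test/= => h.
  have -> : 0 = test [::] by apply/funext => B; rewrite /test /evalt big_nil.
  by apply: h.
pose X0 := [set p : (hfamily -> R^o) * R | exists t, F t /\ p = (test t, evalt t B0)].
have test0 : test [::] = 0 by apply/funext => B; rewrite /test /evalt big_nil.
have X0l : linear_graph X0.
  split; first by exists [::]; split=> //; rewrite test0 /evalt big_nil.
  move=> a f r g q [t [Ft [-> ->]]] [t' [Ft' [-> ->]]].
  exists (scale_test a t ++ t'); split; first by apply: FD => //; exact: FZ.
  by rewrite test_cat test_scale eval_cat eval_scale.
have X0p : positive_graph K X0.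
  by move=> f r [t [Ft [-> ->]]]; exact: B0pos.
have [X [X0X Xl Xp Xdom]] := Riesz_extension KD KZ X0l X0p.
have Xuniq f r r' : X (f, r) -> X (f, r') -> r = r'.
  have h a b : X (f, a) -> X (f, b) -> a <= b.
    move=> Xa Xb; rewrite -subr_ge0; apply: (Xp 0) => //.
    have := Xl.2 (-1) f a f b Xa Xb; by rewrite scaleN1r addNr mulN1r addrC.
  by move=> Xa Xb; apply/le_anti; rewrite !h.
have maj s x y : D s -> exists f r, X0 (f, r) /\ K (f - test [:: (s, x, y)]).
  move=> Ds; have [tx [Ftx Kx]] := Fmaj x; have [ty [Fty Ky]] := Fmaj y.
  exists (2^-1 *: (test tx + test ty)), (evalt (scale_test 2^-1 (tx ++ ty)) B0).
  split.
    exists (scale_test 2^-1 (tx ++ ty)); split; first by apply: FZ; exact: FD.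
    by rewrite test_scale test_cat.
  (* This square evaluates to B_1(x, x) + B_1(y, y) - 2 Re B_s(x, y), so the tests at 1 dominate
     those at every s in D. *)
  pose b : seq (G * V) := [:: (1%g, - x); (s, y)].
  have Kb : K (test (blocks_test [:: b])).
    apply: Kblocks => b' p q; rewrite inE => /eqP->; rewrite !inE.
    by move=> /orP[] /eqP-> /orP[] /eqP->;
      rewrite /= ?mulgV ?mulg1 ?mul1g ?invg1// ?mulg1//; exact: domain_inv.
  have Eb : test (blocks_test [:: b]) =
      test [:: (1%g, x, x)] + test [:: (1%g, y, y)] - 2 *: test [:: (s, x, y)].
    apply/funext => -[B hB]; rewrite /test /= eval_blocks big_seq1 eval_block.
    have [Bs Bh _] := hB.
    rewrite /b !big_cons !big_nil /= !addr0 !mulgV invg1 mul1g mulg1 !ReD.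
    rewrite (Bh s (- x) y) Re_conjc.
    have N (s' : G) (x' y' : V) : B s' (- x') y' = - B s' x' y'.
      by rewrite -scaleN1r (sesquiZl (Bs _)) mulN1r.
    have N' (s' : G) (x' y' : V) : B s' x' (- y') = - B s' x' y'.
      by rewrite -scaleN1r (sesquiZr (Bs _)) conjN1 mulN1r.
    rewrite !N N' opprK !ReN.
    rewrite -[RHS]/(evalt [:: (1%g, x, x)] B + evalt [:: (1%g, y, y)] B -
      2 * evalt [:: (s, x, y)] B) !eval1; lra.
  have := KZ (_ : 0 <= 2^-1) (KD (KD Kx Ky) Kb) => /(_ (ltac:(by []))).
  congr K; rewrite Eb.
  apply/funext => B; rewrite !fctE.
  set a1 := test tx B; set a2 := test ty B; set a3 := test [:: (1%g, x, x)] B.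
  set a4 := test [:: (1%g, y, y)] B; set a5 := test _ B.
  rewrite -[LHS]/(2^-1 * (a1 - a3 + (a2 - a4) + (a3 + a4 - 2 * a5))).
  by rewrite -[RHS]/(2^-1 * (a1 + a2) - a5); field.
have testN s x y : test [:: (s, - x, y)] = - test [:: (s, x, y)].
  apply/funext => -[B hB]; rewrite /test /= -[RHS]/(- evalt _ B) !eval1.
  by case: hB => Bs _ _; rewrite -scaleN1r (sesquiZl (Bs _)) mulN1r ReN.
have hg (sxy : G * V * V) : exists r, D sxy.1.1 -> X (test [:: sxy], r).
  have [Ds|nDs] := pselect (D sxy.1.1); last by exists 0.
  case: sxy Ds => -[s x] y /= Ds.
  have [||r hr] := Xdom (test [:: (s, x, y)]); last by exists r.
    exact: maj.
  by have [f [r [h1 h2]]] := maj s (- x) y Ds; exists f, r; split=> //; move: h2; rewrite testN opprK.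
have [g {}hg] := choice hg.
(* A form that is linear in x is recovered from its real part by Im z = - Re ('i z). *)
pose B s x y : C := if pselect (D s) then Complex (g (s, x, y)) (- g (s, 'i *: x, y)) else 0.
have ReB_ s x y : D s -> complex.Re (B s x y) = g (s, x, y).
  by move=> Ds; rewrite /B; case: (pselect (D s)).
have ImB_ s x y : D s -> complex.Im (B s x y) = - g (s, 'i *: x, y).
  by move=> Ds; rewrite /B; case: (pselect (D s)).
have BN s x y : ~ D s -> B s x y = 0 by rewrite /B; case: (pselect (D s)).
(* An identity between real parts that holds for all hermitian families is an equality of tests, and
   therefore holds for [g]. Sesquilinearity and symmetry of B are all obtained in this way. *)
have geq s x y t : D s -> supported t -> (forall B', hermitian_family B' ->
    complex.Re (B' s x y) = evalt t B') -> g (s, x, y) = \sum_(p <- t) g p.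
  move=> Ds ts h; apply: Xuniq (hg (s, x, y) Ds) _.
  have -> : test [:: (s, x, y)] = test t.
    by apply/funext => -[B' hB']; rewrite /test/= eval1 h.
  elim: t ts {h} => [_|p t ih ts]; first by rewrite big_nil test0; exact: Xl.1.
  rewrite big_cons -cat1s test_cat; apply: linear_graphD => //.
    by apply: hg; apply: ts; rewrite inE eqxx.
  by apply: ih => q qt; apply: ts; rewrite inE qt orbT.
have gscale s (a : R) x y : D s -> g (s, a%:C *: x, y) = a * g (s, x, y).
  move=> Ds; apply: Xuniq (hg (s, a%:C *: x, y) Ds) _.
  have -> : test [:: (s, a%:C *: x, y)] = a *: test [:: (s, x, y)].
    by rewrite -test_scale.
  by apply: linear_graphZ => //; exact: hg.
have Bh' B' : hermitian_family B' -> [/\ forall s, sesquiform (B' s),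
    forall s x y, complex.Re (B' s ('i *: x) y) = - complex.Im (B' s x y)
    & forall s x y, complex.Re (B' s x ('i *: y)) = complex.Im (B' s x y)].
  case=> Bs _ _; split=> // s x y; first by rewrite (sesquiZl (Bs _)) Re_imag.
  by rewrite (sesquiZr (Bs _)) conj_imag mulNr ReN Re_imag opprK.
have gi2 s x y : D s -> g (s, 'i *: ('i *: x), y) = - g (s, x, y).
  move=> Ds; rewrite scalerA mul_imag.
  have := gscale s (-1) x y Ds; rewrite mulN1r => <-.
  by congr (g (_, _ *: _, _)); rewrite rmorphN rmorph1.
have Re_mulE (a z : C) : complex.Re (a * z) =
    complex.Re a * complex.Re z - complex.Im a * complex.Im z.
  by case: a z => ? ? [].
have Im_mulE (a z : C) : complex.Im (a * z) =
    complex.Re a * complex.Im z + complex.Im a * complex.Re z.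
  by case: a z => ? ? [].
have gl s a x x' y : D s -> g (s, a *: x + x', y) =
    complex.Re a * g (s, x, y) + complex.Im a * g (s, 'i *: x, y) + g (s, x', y).
  move=> Ds; rewrite -!gscale//.
  rewrite (geq _ _ _ [:: (s, (complex.Re a)%:C *: x, y);
    (s, (complex.Im a)%:C *: ('i *: x), y); (s, x', y)])//.
  - by rewrite !big_cons big_nil addr0 addrA.
  - by move=> p; rewrite !inE => /or3P[] /eqP->.
  - move=> B' hB'; have [Bs Bi _] := Bh' _ hB'.
    rewrite /evalt !big_cons big_nil /= addr0 (Bs _).1 ReD Re_mulE addrA.
    by rewrite !(sesquiZl (Bs _)) !Re_scale -(sesquiZl (Bs _)) Bi; ring.
have gr s a x y y' : D s -> g (s, x, a *: y + y') =
    complex.Re a * g (s, x, y) - complex.Im a * g (s, 'i *: x, y) + g (s, x, y').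
  move=> Ds; rewrite -mulNr -!gscale//.
  rewrite (geq _ _ _ [:: (s, (complex.Re a)%:C *: x, y);
    (s, (- complex.Im a)%:C *: ('i *: x), y); (s, x, y')])//.
  - by rewrite !big_cons big_nil addr0 addrA.
  - by move=> p; rewrite !inE => /or3P[] /eqP->.
  - move=> B' hB'; have [Bs Bi _] := Bh' _ hB'.
    rewrite /evalt !big_cons big_nil /= addr0 (Bs _).2 ReD Re_mulE Re_conjc Im_conjc addrA.
    by rewrite !(sesquiZl (Bs _)) !Re_scale -(sesquiZl (Bs _)) Bi; ring.
have Bs s : sesquiform (B s).
  have [Ds|nDs] := pselect (D s); last first.
    by split=> a x y z; rewrite !BN// mulr0 addr0.
  split=> a x y z; apply: complex_eq.
  - by rewrite ReD Re_mulE !ReB_// !ImB_// gl//; ring.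
  - rewrite ImD Im_mulE !ReB_// !ImB_//.
    have -> : 'i *: (a *: x + y) = a *: ('i *: x) + 'i *: y.
      by rewrite scalerDr !scalerA mulrC.
    by rewrite gl// gi2//; ring.
  - by rewrite ReD Re_mulE Re_conjc Im_conjc !ReB_// !ImB_// gr//; ring.
  - rewrite ImD Im_mulE Re_conjc Im_conjc !ReB_// !ImB_// gr// gi2//; ring.
have Bherm : hermitian_family B.
  split=> // [s x y|s nDs x y]; last exact: BN.
  have [Ds|nDs] := pselect (D s); last first.
    have nDs' : ~ D (s^-1)%g.
      by move=> /(domain_inv hD); rewrite invgK.
    by rewrite !BN// rmorph0.
  have Ds' := domain_inv hD Ds.
  apply: complex_eq; rewrite ?Re_conjc ?Im_conjc ?ReB_// ?ImB_//.
    rewrite (geq _ _ _ [:: (s, x, y)]) ?big_seq1//.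
    - by move=> p; rewrite inE => /eqP->.
    - by move=> B' [_ Bh _]; rewrite eval1 Bh Re_conjc.
  rewrite (geq _ _ _ [:: (s, - ('i *: x), y)]) ?big_seq1//.
  - have := gscale s (-1) ('i *: x) y Ds; rewrite mulN1r => <-.
    by rewrite rmorphN rmorph1 scaleN1r.
  - by move=> p; rewrite inE => /eqP->.
  - move=> B' hB'; have [Bs' Bi Bi'] := Bh' _ hB'; have [_ Bh _] := hB'.
    rewrite eval1 Bh Re_conjc Bi' -scaleN1r (sesquiZl (Bs' _)) mulN1r ReN Bi.
    by rewrite opprK.
have XB t : supported t -> X (test t, evalt t B).
  elim: t => [_|p t ih ts]; first by rewrite test0 /evalt big_nil; exact: Xl.1.
  rewrite -cat1s test_cat eval_cat; apply: linear_graphD => //; last first.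
    by apply: ih => q qt; apply: ts; rewrite inE qt orbT.
  have Dp : D p.1.1 by apply: ts; rewrite inE eqxx.
  by rewrite /evalt big_seq1 ReB_//; case: p ts Dp => -[s x] y _ Ds; exact: hg.
exists B; split=> // [l hl|t Ft ts|t ts Kt]; last 2 first.
- by apply: Xuniq (XB t ts) _; apply: X0X; exists t.
- exact: Xp (XB t ts) Kt.
rewrite ge0_complexE; apply/andP; split.
- have E : (\sum_(p <- l) \sum_(q <- l) B (p.1 * q.1^-1)%g q.2 p.2)^* =
      \sum_(p <- l) \sum_(q <- l) B (p.1 * q.1^-1)%g q.2 p.2.
    rewrite rmorph_sum [RHS]exchange_big; apply: eq_bigr => p _.
    rewrite rmorph_sum; apply: eq_bigr => q _ /=.
    by case: Bherm => _ Bh _; rewrite -Bh invgM invgK.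
  have := congr1 (@complex.Im R) E; rewrite Im_conjc => hz.
  by apply/eqP; lra.
- rewrite -eval_block; have -> : block_test l = blocks_test [:: l] by rewrite /blocks_test /= cats0.
  apply: (Xp (test (blocks_test [:: l]))); last first.
    by apply: Kblocks => b p q; rewrite inE => /eqP->; exact: hl.
  apply: XB => p; rewrite /blocks_test /= cats0 => /allpairsP[[p1 q1] [/= h1 h2 ->]].
  exact: hl.
Qed.

End form_extension.

(** * The operator system UOS(D) *)

Section Ucone.
Context {R : realType} {G : groupType} (A : group_cstar R G).
Local Notation C := R[i].
Local Notation K := (gc_space A).
Local Notation delta := (delta A).
Context {n : nat}.
Implicit Types (D : set G) (S : {fset G}) (Z : 'I_n -> 'I_n -> seq (C * G)).

Definition supported_mx D Z := forall i j p, p \in Z i j -> D p.2.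

(* [Z] is a formal representative of an element of [U_n(D)], so that every positive
   semi-definite function on [D] is positive on it. *)
Definition form_pos D Z := forall (H : hilbert R) (u : G -> bop H), psd D u ->
  forall x, 0 <= mxform (lcmx u Z) x x.

Lemma lc_map_scale (H : hilbert R) (u : G -> bop H) (I : Type) (r : seq I) (c : I -> C) (g : I -> G) :
  lc u [seq (c i, g i) | i <- r] = \sum_(i <- r) c i *: u (g i).
Proof. by rewrite /lc big_map. Qed.

Lemma mxlincombE (H : hilbert R) (u : G -> bop H) S (B : G -> 'M[C]_n) :
  mxlincomb u S B = lcmx u (fun i j => [seq (B s i j, s) | s <- S]).
Proof.
apply/matrixP => i j; rewrite /mxlincomb summxE mxE lc_map_scale.
by apply: eq_bigr => s _; rewrite !mxE.
Qed.

Definition square_lcmx S (B : G -> 'M[C]_n) : 'I_n -> 'I_n -> seq (C * G) :=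
  let Y i j := [seq (B s i j, s) | s <- S] in mul_lcmx Y (adj_lcmx Y).

Lemma square_lcmxE S B : lcmx delta (square_lcmx S B) =
  mxlincomb delta S B *m mxadj (mxlincomb delta S B).
Proof.
have dU := delta_unitary A.
by rewrite lcmx_mul// lcmx_adj// mxlincombE.
Qed.

Lemma square_supported D S B : admissible D S -> supported_mx D (square_lcmx S B).
Proof.
move=> aS i j p /flattenP[_ /mapP[k _ ->]] /allpairsP[[p1 p2] [/= h1 h2 ->]] /=.
move: h1 => /mapP[s sS ->]; move: h2 => /mapP[q /mapP[t tS ->] ->] /=.
exact: aS.
Qed.

(** Each column l of the coefficient matrices combines x into vectors [eta l s], and the form is the
    sum over l of the defining expressions of positivity at these vectors. *)
Lemma square_form_pos D S B : admissible D S -> form_pos D (square_lcmx S B).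
Proof.
move=> aS H u /psdP up x.
pose eta l s := \sum_i (B s i l)^* *: x i.
have -> : mxform (lcmx u (square_lcmx S B)) x x =
    \sum_l \sum_(s <- S) \sum_(t <- S) hdot (u (s * t^-1)%g (eta l t)) (eta l s).
  rewrite /mxform.
  transitivity (\sum_i \sum_j \sum_l \sum_(s <- S) \sum_(t <- S)
     B s i l * (B t j l)^* * hdot (u (s * t^-1)%g (x j)) (x i)).
    apply: eq_bigr => i _; apply: eq_bigr => j _; rewrite mxE lc_flatten big_map.
    rewrite bop_sumE hdot_suml; apply: eq_bigr => l _.
    rewrite /lc /mul_lc big_allpairs_dep bop_sumE hdot_suml big_map; apply: eq_bigr => s _.
    rewrite bop_sumE hdot_suml /adj_lcmx /adj_lc !big_map; apply: eq_bigr => t _.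
    by rewrite bopZE hdotZl.
  under eq_bigr do rewrite exchange_big.
  rewrite exchange_big; apply: eq_bigr => l _.
  under eq_bigr do rewrite exchange_big.
  rewrite exchange_big; apply: eq_bigr => s _.
  under eq_bigr do rewrite exchange_big.
  rewrite exchange_big; apply: eq_bigr => t _.
  rewrite /eta hdot_sumr; apply: eq_bigr => i _; rewrite bop_sumr hdot_suml.
  by apply: eq_bigr => j _; rewrite bopZr hdotZl hdotZr conjcK; ring.
rewrite sumr_ge0// => l _.
have := up [seq (s, eta l s) | s <- S]; rewrite big_map.
under eq_bigr do rewrite big_map.
by apply => _ _ /mapP[s sS ->] /mapP[t tS ->]; exact: aS.
Qed.

Lemma lcmx_sum_exists D (r : nat) (a : 'I_r -> C) (q : 'I_r -> 'M[bop K]_n) :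
  (forall k, 0 <= a k) ->
  (forall k, exists Z, [/\ q k = lcmx delta Z, supported_mx D Z & form_pos D Z]) ->
  exists Z, [/\ \sum_k map_mx (fun T => a k *: T) (q k) = lcmx delta Z,
    supported_mx D Z & form_pos D Z].
Proof.
move=> a0 hq; have [Z hZ] := choice hq.
pose W i j := flatten [seq [seq (a k * p.1, p.2) | p <- Z k i j] | k <- index_enum 'I_r].
have WE (H : hilbert R) (u : G -> bop H) :
    lcmx u W = \sum_k map_mx (fun T => a k *: T) (lcmx u (Z k)).
  apply/matrixP => i j; rewrite summxE mxE lc_flatten big_map; apply: eq_bigr => k _.
  by rewrite !mxE lc_scale.
exists W; split.
- rewrite WE; apply: eq_bigr => k _; by have [-> _ _] := hZ k.
- move=> i j p /flattenP[_ /mapP[k _ ->]] /mapP[p' hp' ->] /=.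
  by have [_ h _] := hZ k; exact: h hp'.
- move=> H u up x; rewrite WE.
  have -> : mxform (\sum_k map_mx (fun T => a k *: T) (lcmx u (Z k))) x x =
      \sum_k a k * mxform (lcmx u (Z k)) x x.
    rewrite mxform_sum; apply: eq_bigr => k _.
    rewrite mulr_sumr; apply: eq_bigr => i _; rewrite mulr_sumr; apply: eq_bigr => j _.
    by rewrite mxE bopZE hdotZl.
  rewrite sumr_ge0// => k _; rewrite mulr_ge0//.
  by have [_ _ h] := hZ k; exact: h.
Qed.

Lemma sum_squares_lists D (r : nat) (S : 'I_r -> {fset G}) (B : 'I_r -> G -> 'M[C]_n) :
  (forall i, admissible D (S i)) ->
  exists Z, [/\ \sum_i mxlincomb delta (S i) (B i) *m mxadj (mxlincomb delta (S i) (B i)) =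
    lcmx delta Z, supported_mx D Z & form_pos D Z].
Proof.
move=> aS; have [|k|Z [ZE ZD Zp]] := @lcmx_sum_exists D r (fun=> 1)
  (fun i => mxlincomb delta (S i) (B i) *m mxadj (mxlincomb delta (S i) (B i))) => //.
  exists (square_lcmx (S k) (B k)); split; first by rewrite square_lcmxE.
    exact: square_supported.
  exact: square_form_pos.
exists Z; split=> //; rewrite -ZE; apply: eq_bigr => i _.
by apply/matrixP => a b; rewrite [RHS]mxE scale1r.
Qed.

Lemma Ucone_lists D X : Ucone D X ->
  exists Z, [/\ X = lcmx delta Z, supported_mx D Z & form_pos D Z].
Proof.
move=> [r [a [q [a0 hq ->]]]]; apply: lcmx_sum_exists => k; first by rewrite ler0c.
have [S aS [m [B ->]]] := hq k.
exact: sum_squares_lists.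
Qed.

End Ucone.

Section UOS_maps.
Context {R : realType} {G : groupType} (A : group_cstar R G).
Local Notation C := R[i].
Local Notation K := (gc_space A).
Local Notation delta := (delta A).
Context {D : set G} (hD : positivity_domain D).

Lemma span_lists n (X : 'M[bop K]_n) : mxin (span_delta D) X ->
  exists Z, X = lcmx delta Z /\ supported_mx D Z.
Proof.
move=> hX.
have h (ij : 'I_n * 'I_n) : exists l, (forall p, p \in l -> D p.2) /\ X ij.1 ij.2 = lc delta l.
  by have /span_deltaP[l lD lE] := hX ij.1 ij.2; exists l.
have [Z hZ] := choice h; exists (fun i j => Z (i, j)); split.
  by apply/matrixP => i j; rewrite mxE (hZ (i, j)).2.
by move=> i j; exact: (hZ (i, j)).1.
Qed.

Lemma phi_UOS_lcmx (H : hilbert R) (u : G -> bop H) n Z : supported_mx (n := n) D Z ->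
  map_mx (phi_UOS D u) (lcmx delta Z) = lcmx u Z.
Proof.
by move=> ZD; apply/matrixP => i j; rewrite !mxE phi_UOS_lc//; exact: ZD.
Qed.

(** Complete positivity of phi_u. On the cone of squares it is [form_pos]; the summand r in the
    definition of the positive cone of UOS(D) is removed by letting r = 1 / (m + 1) tend to 0. *)
Lemma UOS_pos_form (H : hilbert R) (u : G -> bop H) n (X : 'M[bop K]_n) x :
  psd D u -> UOS_pos D X -> 0 <= mxform (map_mx (phi_UOS D u) X) x x.
Proof.
move=> up [hX _ XU].
have [Z [XE ZD]] := span_lists hX; rewrite XE phi_UOS_lcmx//.
have [M M0 hM] := bop_bounded (u 1%g).
pose c : C := \sum_i hdot (u 1%g (x i)) (x i).
apply: (@ge0_of_approx _ _ (normc c)); first exact: normc_ge0.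
move=> m; have r0 : 0 < m.+1%:R^-1 :> R by [].
have [W [WE WD Wp]] := Ucone_lists (XU _ r0).
exists (mxform (lcmx u W) x x); first exact: Wp.
set r := m.+1%:R^-1 in r0 WE *.
have WE' : lcmx u W = lcmx u (fun i j => Z i j ++ (if i == j then [:: (r%:C, 1%g)] else [::])).
  apply/matrixP => i j; rewrite !mxE; apply: (lc_delta_inj (A := A)).
  have := congr1 (fun T => fun_of_matrix T i j) WE; rewrite XE !mxE => <-.
  rewrite lc_cat; congr (_ + _); case: eqP => _; rewrite /lc ?big_seq1 ?big_nil ?mulr1n//.
  by rewrite mulr0n scale0r.
have -> : mxform (lcmx u W) x x = mxform (lcmx u Z) x x + r%:C * c.
  rewrite WE' mulr_sumr -big_split; apply: eq_bigr => i _ /=.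
  rewrite [X in _ + X](_ : _ = \sum_j (if i == j then r%:C * hdot (u 1%g (x j)) (x i) else 0)).
    rewrite -big_split; apply: eq_bigr => j _; rewrite !mxE lc_cat bopDE hdotDl; congr (_ + _).
    by case: eqP => _; rewrite /lc ?big_seq1 ?big_nil ?bopZE ?hdotZl// bop0E hdot0l.
  by rewrite -big_mkcond (big_pred1 i)// => j; rewrite eq_sym.
rewrite opprD addrA subrr add0r normcN Normc.normcM normcr ger0_norm ?(ltW r0)//.
by rewrite mulrC.
Qed.

Lemma mxform_block (H : hilbert R) n (X1 X2 X3 X4 : 'M[bop H]_n) (x y : 'I_n -> H) :
  let z (i : 'I_(n + n)) := match fintype.split i with inl k => x k | inr k => y k end in
  mxform (block_mx X1 X2 X3 X4) z z =
  mxform X1 x x + mxform X2 y x + (mxform X3 x y + mxform X4 y y).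
Proof.
move=> z; have zl k : z (lshift n k) = x k by rewrite /z (unsplitK (inl k)).
have zr k : z (rshift n k) = y k by rewrite /z (unsplitK (inr k)).
rewrite /mxform big_split_ord/=; congr (_ + _).
- rewrite -big_split; apply: eq_bigr => i _; rewrite big_split_ord/= zl; congr (_ + _);
  by apply: eq_bigr => j _; rewrite ?zl ?zr ?block_mxEul ?block_mxEur.
- rewrite -big_split; apply: eq_bigr => i _; rewrite big_split_ord/= zr; congr (_ + _);
  by apply: eq_bigr => j _; rewrite ?zl ?zr ?block_mxEdl ?block_mxEdr.
Qed.

(** A completely positive map is bounded by its value at the unit: the image of [[r, X], [X^*, r]]
    is positive with diagonal at most r c, and [discriminant_le] bounds its corner. *)
Lemma psd_UOS_bound (H : hilbert R) (u : G -> bop H) (c : R) n (X : 'M[bop K]_n) :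
  psd D u -> 0 <= c -> (forall x, hnorm (u 1%g x) <= c * hnorm x) ->
  mxin (span_delta D) X -> (UOS_norm D X <= 1)%E -> mxbound (map_mx (phi_UOS D u) X) c.
Proof.
move=> up c0 hc hX X1.
suff h (r : R) : 0 < r -> UOS_pos D (block_mx (scalar_unit A n r) X (mxadj X) (scalar_unit A n r)) ->
    mxbound (map_mx (phi_UOS D u) X) (r * c).
  move=> x; apply: le_of_forall_eps => e e0.
  pose B := c * l2norm x; have B0 : 0 <= B by rewrite mulr_ge0 ?l2norm_ge0.
  have d0 : 0 < e / (B + 1) by rewrite divr_gt0// ltr_wpDl.
  (* The infimum defining the norm need not be attained, so r is only known to lie below 1 + d for a
     given d > 0. *)
  have : (UOS_norm D X < (1 + e / (B + 1))%:E)%E.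
    by apply: le_lt_trans X1 _; rewrite lte_fin ltrDl.
  move=> /ereal_inf_lt[_ [r [r0 Xr] <-]]; rewrite lte_fin => r1.
  rewrite (le_trans (h r r0 Xr x))// -mulrA -/B.
  rewrite (le_trans (ler_wpM2r B0 (ltW r1)))// mulrDl mul1r lerD2l.
  by rewrite mulrAC ler_pdivrMr ?ltr_wpDl// ler_wpM2l ?(ltW e0)// lerDl.
move=> r0 Xpos; apply: form_mxbound => [|y x]; first by rewrite mulr_ge0// ltW.
have [Z [XE ZD]] := span_lists hX.
have mapE z : 0 <= mxform (map_mx (phi_UOS D u) (block_mx (scalar_unit A n r) X (mxadj X)
   (scalar_unit A n r))) z z by exact: UOS_pos_form.
have phiU : map_mx (phi_UOS D u) (scalar_unit A n r) =
    \matrix_(i, j) (if i == j then r%:C *: u 1%g else 0).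
  apply/matrixP => i j; rewrite !mxE.
  have [phil phis] := phi_UOSP A D u.
  have -> : (r%:C *+ (i == j)) *: delta 1%g =
      lc delta (if i == j then [:: (r%:C, 1%g)] else [::]).
    by case: eqP => _; rewrite /lc ?big_seq1 ?big_nil ?mulr1n// mulr0n scale0r.
  rewrite phi_UOS_lc; first by case: eqP => _; rewrite /lc ?big_seq1 ?big_nil.
  by case: eqP => // _ p; rewrite inE => /eqP->; exact: hD.1.
have phiUE z : complex.Re (mxform (map_mx (phi_UOS D u) (scalar_unit A n r)) z z) <=
    r * c * l2norm z ^+ 2.
  have -> : mxform (map_mx (phi_UOS D u) (scalar_unit A n r)) z z =
      r%:C * \sum_i hdot (u 1%g (z i)) (z i).
    rewrite phiU mulr_sumr; apply: eq_bigr => i _.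
    rewrite (bigD1 i)//= mxE eqxx bopZE hdotZl big1 ?addr0// => j ji.
    by rewrite mxE eq_sym (negPf ji) bop0E hdot0l.
  rewrite Re_scale -mulrA ler_wpM2l ?(ltW r0)// Re_sum sqr_l2norm mulr_sumr.
  apply: ler_sum => i _; rewrite (le_trans (Re_le_normc _))//.
  by rewrite (le_trans (Cauchy_Schwarz _ _))// expr2 mulrA ler_wpM2r ?hnorm_ge0.
have phiX : map_mx (phi_UOS D u) (mxadj X) = mxadj (map_mx (phi_UOS D u) X).
  rewrite XE -(lcmx_adj _ (delta_unitary A)) !phi_UOS_lcmx//; last first.
    by move=> i j p /mapP[q hq ->]; apply: (domain_inv hD); exact: ZD hq.
  apply/matrixP => i j; rewrite !mxE; apply/esym/adj_unique => a b.
  rewrite /lc big_map !bop_sumE hdot_suml hdot_sumr big_seq [RHS]big_seq.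
  apply: eq_bigr => p hp; rewrite !bopZE hdotZl hdotZr conjcK; congr (_ * _).
  have := fpsd_herm hD (fun s _ => bform_sesqui u s) ((psdP D u).1 up) a b (ZD _ _ _ hp).
  by rewrite /bform => h; rewrite [RHS]hdotC h conjcK.
rewrite -le_sqr ?normc_ge0 ?mulr_ge0 ?l2norm_ge0 ?(ltW r0)//.
have -> : (r * c * l2norm y * l2norm x) ^+ 2 =
  (r * c * l2norm x ^+ 2) * (r * c * l2norm y ^+ 2) by ring.
apply: discriminant_le.
  by rewrite mulr_ge0 ?sqr_ge0// mulr_ge0// ltW.
move=> w.
have := mapE (fun i : 'I_(n + n) => match fintype.split i with inl k => x k | inr k => w *: y k end).
rewrite map_block_mx phiX mxform_block mxadj_form mxform_scalel ge0_complexE => /andP[_].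
rewrite !ReD Re_conjc => h; rewrite (le_trans h)//.
have h1 := phiUE x; have := phiUE (fun i => w *: y i); rewrite l2normZ => h2.
move: h1 h2; set a1 := complex.Re _; set a2 := complex.Re (mxform _ (fun i => w *: y i) _).
set a3 := complex.Re _; rewrite exprMn; lra.
Qed.

End UOS_maps.

(** * Bounded extensions give positive extensions *)

Section unital_contractions.
Context {R : realType} {G : groupType} (A : group_cstar R G).
Local Notation C := R[i].
Local Notation K := (gc_space A).
Local Notation delta := (delta A).
Context {H : hilbert R}.
Implicit Types (v : G -> bop H) (M N : R).

Lemma mxbound_scale (H' : hilbert R) n (T : 'M[bop H']_n) (a : C) N :
  mxbound T N -> mxbound (map_mx (fun S => a *: S) T) (normc a * N).
Proof.
move=> h x; have -> : mxop_act (map_mx (fun S => a *: S) T) x = fun i => a *: mxop_act T x i.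
  apply/funext => i; rewrite /mxop_act scaler_sumr; apply: eq_bigr => j _.
  by rewrite mxE bopZE.
by rewrite l2normZ -mulrA ler_wpM2l ?normc_ge0.
Qed.

Lemma BGH_norm_cbbound v M : 0 <= M -> BDH setT v -> (BGH_norm A v <= M%:E)%E ->
  cbbound A v M.
Proof.
move=> M0 vB vM n Z N N0 hZ.
have [M' M'0 hv] := BDH_cbbound A vB.
have phiE (W : 'I_n -> 'I_n -> seq (C * G)) : map_mx (phi_cstar v) (lcmx delta W) = lcmx v W.
  by apply/matrixP => i j; rewrite !mxE (phi_cstar_lc _ M'0 hv).
suff h (N' : R) : 0 < N' -> mxbound (lcmx delta Z) N' -> mxbound (lcmx v Z) (M * N').
  move=> x; apply: le_of_forall_eps => e e0.
  pose B := M * l2norm x; have B0 : 0 <= B by rewrite mulr_ge0 ?l2norm_ge0.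
  have d0 : 0 < e / (B + 1) by rewrite divr_gt0// ltr_wpDl.
  have N'0 : 0 < N + e / (B + 1) by rewrite ltr_wpDl.
  have := h _ N'0 => /(_ _ x); rewrite mulrDr mulrDl => h'; rewrite (le_trans (h' _))//.
    by move=> y; rewrite (le_trans (hZ y))// ler_wpM2r ?l2norm_ge0// lerDl ltW.
  rewrite lerD2l mulrAC -/B mulrC mulrAC ler_pdivrMr ?ltr_wpDl//.
  by rewrite ler_wpM2l ?(ltW e0)// lerDl.
move=> N'0 hN'; pose a := (N'^-1)%:C : C.
have na : normc a = N'^-1 by rewrite normcr ger0_norm// invr_ge0 ltW.
pose W i j := [seq (a * p.1, p.2) | p <- Z i j].
have WE (H' : hilbert R) (u : G -> bop H') :
    lcmx u W = map_mx (fun S => a *: S) (lcmx u Z).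
  by apply/matrixP => i j; rewrite !mxE lc_scale.
have hW : mxbound (lcmx v W) M.
  apply/(mxboundP _ M0); apply: le_trans vM; apply: ereal_sup_ubound.
  exists n, (lcmx delta W); split; last by rewrite phiE.
    by move=> i j; rewrite mxE; exact: cstar_lc.
  apply/(mxboundP _ ler01); rewrite WE.
  by rewrite -(mulVf (lt0r_neq0 N'0)) -na; exact: mxbound_scale.
have -> : lcmx v Z = map_mx (fun S => N'%:C *: S) (lcmx v W).
  apply/matrixP => i j; rewrite !mxE lc_scale scalerA -rmorphM mulfV ?lt0r_neq0//.
  by rewrite scale1r.
by rewrite mulrC -[in X in mxbound _ X](gtr0_norm N'0) -normcr; exact: mxbound_scale.
Qed.

(* The matrix [T = (delta (s t^-1))] satisfies [T ^ 2 = n T], so that [2 / n T - 1]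
   is a self-adjoint unitary; a unital contraction maps it to an operator with
   numerical range in [-1, 1]. *)
Lemma unital_contraction_psd v : cbbound A v 1 -> v 1%g = 1 -> psd setT v.
Proof.
move=> hv v1 S _ xi; have dU := delta_unitary A.
pose n := #|{: S}|; pose g (i : 'I_n) : G := val (enum_val i).
pose x (i : 'I_n) : H := xi (enum_val i).
suff : 0 <= mxform (lcmx v (fun i j => [:: (1, (g i * (g j)^-1)%g)])) x x.
  rewrite (reindex_onto enum_val enum_rank)/=; last by move=> i _; rewrite enum_rankK.
  rewrite /mxform; congr (_ <= _).
  rewrite [RHS](eq_bigl (fun=> true)); last by move=> i; rewrite enum_valK eqxx.
  apply: eq_bigr => i _; rewrite [RHS](reindex_onto enum_val enum_rank)/=; last first.
    by move=> j _; rewrite enum_rankK.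
  rewrite [RHS](eq_bigl (fun=> true)); last by move=> j; rewrite enum_valK eqxx.
  by apply: eq_bigr => j _; rewrite mxE lc1.
have [n0|n0] := posnP n.
  by rewrite /mxform big1// => i; have := ltn_ord i; rewrite [X in (_ < X)%N]n0.
pose Z i j := [:: (1, (g i * (g j)^-1)%g)] : seq (C * G).
have [c cE] : exists c : R, c = 2 / n%:R by exists (2 / n%:R).
have nR : (n%:R : R) != 0 by rewrite pnatr_eq0 -lt0n.
have c0 : 0 < c by rewrite cE divr_gt0// ltr0n.
(* With U = (2 / n) T - 1, the matrix [W tau] represents U - 'i tau, of norm at most sqrt (1 +
   tau^2). Letting tau vary forces the image of U to have a real numerical range. *)
pose a (tau : R) : C := - (1 + 'i * tau%:C).
pose W tau i j := [:: (c%:C, (g i * (g j)^-1)%g)] ++ (if i == j then [:: (a tau, 1%g)] else [::]).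
have WE (H' : hilbert R) (u : G -> bop H') tau y z : u 1%g = 1 ->
    mxform (lcmx u (W tau)) y z = c%:C * mxform (lcmx u Z) y z + a tau * l2dot y z.
  move=> u1; rewrite !mulr_sumr -big_split; apply: eq_bigr => i _ /=.
  rewrite mulr_sumr [X in _ + X](_ : _ = \sum_j (if i == j then a tau * hdot (y j) (z i) else 0)).
    rewrite -big_split; apply: eq_bigr => j _; rewrite !mxE lc1 lc_cat bopDE hdotDl.
    congr (_ + _); first by rewrite /lc big_seq1 bopZE hdotZl.
    by case: eqP => _; rewrite /lc ?big_seq1 ?big_nil ?u1 ?bopZE ?hdotZl// bop0E hdot0l.
  by rewrite -big_mkcond (big_pred1 i)// => j; rewrite eq_sym.
set T := lcmx delta Z.
have TH : mxadj T = T.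
  rewrite -lcmx_adj//; apply/matrixP => i j; rewrite !mxE /lc !big_seq1/= conj1.
  by rewrite invgM invgK.
have TT y : mxform T (mxop_act T y) y = n%:R * mxform T y y.
  rewrite mxformE -mxop_actM -mxformE.
  have -> : T *m T = map_mx (fun S => (n%:R : C) *: S) T.
    apply/matrixP => i j; rewrite !mxE lc1.
    rewrite (eq_bigr (fun=> delta (g i * (g j)^-1)%g)); last first.
      move=> k _; rewrite !mxE !lc1; have [_ dM _] := dU.
      by rewrite -dM -mulgA (mulgA (g k)^-1%g) mulVg mul1g.
    by rewrite sumr_const card_ord scaler_nat.
  rewrite mulr_sumr; apply: eq_bigr => i _; rewrite mulr_sumr; apply: eq_bigr => j _.
  by rewrite mxE bopZE hdotZl.
have Treal y : complex.Im (mxform T y y) = 0.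
  have := congr1 (@complex.Im R) (mxadj_form T y y); rewrite TH Im_conjc; lra.
have Tnorm y : l2norm (mxop_act T y) ^+ 2 = n%:R * complex.Re (mxform T y y).
  have := TT y; rewrite -{1}TH mxadj_form mxformE l2dotxx => /(congr1 (@complex.Re R)).
  rewrite Re_conjc /= => ->.
  by rewrite -(Re_scale n%:R) rmorph_nat.
have Wbound tau : mxbound (lcmx delta (W tau)) (Num.sqrt (1 + tau ^+ 2)).
  have t0 : 0 <= 1 + tau ^+ 2 by rewrite addr_ge0// sqr_ge0.
  move=> y; rewrite -le_sqr ?mulr_ge0 ?sqrtr_ge0 ?l2norm_ge0// exprMn (sqr_sqrtr t0).
  have actE : mxop_act (lcmx delta (W tau)) y =
      fun i => c%:C *: mxop_act T y i + a tau *: y i.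
    apply/funext => i; apply: hdot_injl => z.
    pose z' (k : 'I_n) := if k == i then z else 0.
    have E w : l2dot w z' = hdot (w i) z.
      rewrite /l2dot (bigD1 i)//= /z' eqxx big1 ?addr0// => k /negPf->.
      by rewrite hdot0r.
    have := WE _ _ tau y z' (delta1 A); rewrite mxformE E => ->.
    by rewrite mxformE !E hdotDl !hdotZl.
  have -> : l2norm (mxop_act (lcmx delta (W tau)) y) ^+ 2 =
      c ^+ 2 * l2norm (mxop_act T y) ^+ 2 + 2 * complex.Re (c%:C * (a tau)^* * mxform T y y) +
      normc (a tau) ^+ 2 * l2norm y ^+ 2.
    rewrite actE mxformE !sqr_l2norm /l2dot !mulr_sumr Re_sum mulr_sumr -!big_split /=.
    apply: eq_bigr => i _; rewrite sqr_hnormD !hnormZ hdotZl hdotZr !exprMn normcr.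
    by rewrite real_normK ?num_real// mulrA.
  have na : normc (a tau) ^+ 2 = 1 + tau ^+ 2.
    rewrite sqr_normcE /a /= !(mul0r, mul1r, mulr0, subr0, add0r, addr0); ring.
  have Rea : complex.Re (c%:C * (a tau)^* * mxform T y y) = - c * complex.Re (mxform T y y).
    have [r ->] : exists r : R, mxform T y y = r%:C.
      by exists (complex.Re (mxform T y y)); exact: complex_eq.
    have -> : c%:C * (a tau)^* * r%:C = (c * r)%:C * (a tau)^* by rewrite rmorphM; ring.
    by rewrite Re_scale Re_conjc /a /= !(mul0r, mul1r, mulr0, subr0, addr0); ring.
  rewrite na Rea Tnorm cE le_eqVlt; apply/orP; left; apply/eqP; field.
  by [].
have key tau : normc (c%:C * mxform (lcmx v Z) x x + a tau * l2dot x x) ^+ 2 <=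
    (1 + tau ^+ 2) * (l2norm x ^+ 2) ^+ 2.
  have t0 : 0 <= 1 + tau ^+ 2 by rewrite addr_ge0// sqr_ge0.
  have := mxbound_form x x (hv _ _ _ (sqrtr_ge0 _) (Wbound tau)).
  rewrite WE// mul1r -mulrA -expr2 => h.
  rewrite -(sqr_sqrtr t0) -exprMn le_sqr ?normc_ge0// mulr_ge0 ?sqrtr_ge0 ?sqr_ge0//.
move: key; rewrite -/Z l2dotxx; set w := mxform _ x x; set q := l2norm x ^+ 2 => key.
have q0 : 0 <= q by rewrite sqr_ge0.
have key' (tau : R) : (c * complex.Re w - q) ^+ 2 + (c * complex.Im w - tau * q) ^+ 2 <=
    (1 + tau ^+ 2) * q ^+ 2.
  rewrite (le_trans _ (key tau))// le_eqVlt; apply/orP; left; apply/eqP.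
  rewrite sqr_normcE ReD ImD Re_scale Im_scale /a /=.
  by rewrite !(mul0r, mul1r, mulr0, subr0, add0r, addr0); ring.
have Rw : 0 <= complex.Re w.
  (* At tau = 0 the number c w - q lies in the disc of radius q, hence Re w >= 0. *)
  have h := key' 0; rewrite mul0r subr0 expr0n/= addr0 mul1r in h.
  rewrite leNgt; apply/negP => w0; have cw : c * complex.Re w < 0 by rewrite pmulr_rlt0.
  have := sqr_ge0 (c * complex.Im w); nra.
have Iw : complex.Im w = 0.
  have [q_eq0|q_neq0] := eqVneq q 0.
    have := key' 0; rewrite q_eq0 !(mulr0, subr0, expr0n)/= => h.
    have h1 := sqr_ge0 (c * complex.Re w); have h2 := sqr_ge0 (c * complex.Im w).
    have /eqP : (c * complex.Im w) ^+ 2 = 0 by lra.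
    by rewrite sqrf_eq0 mulf_eq0 gt_eqF//= => /eqP.
  have qp : 0 < q by rewrite lt_def q_neq0.
  apply/eqP; apply: contraT => Iw0; have cI : c * complex.Im w != 0.
    by rewrite mulf_neq0// gt_eqF.
  (* For this tau the cross term equals q^2 + 1, more than the q^2 that the right-hand side
     leaves. *)
  have := key' (- (q ^+ 2 + 1) / (2 * q * (c * complex.Im w))).
  set tau := _ / _; have tE : tau * q * (c * complex.Im w) = - (q ^+ 2 + 1) / 2.
    by rewrite /tau; field; rewrite q_neq0 Iw0 (gt_eqF c0).
  have := sqr_ge0 (c * complex.Re w - q); have := sqr_ge0 (c * complex.Im w).
  have -> : (c * complex.Im w - tau * q) ^+ 2 =
    (c * complex.Im w) ^+ 2 - 2 * (tau * q * (c * complex.Im w)) + (tau * q) ^+ 2 by ring.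
  have -> : (1 + tau ^+ 2) * q ^+ 2 = q ^+ 2 + (tau * q) ^+ 2 by ring.
  rewrite tE; set s1 := (c * complex.Im w) ^+ 2; set s2 := (_ - q) ^+ 2.
  set s3 := (tau * q) ^+ 2; set s4 := q ^+ 2; lra.
by rewrite ge0_complexE Iw eqxx.
Qed.

End unital_contractions.

Section pullback.
Context {R : realType} {G : groupType}.
Local Notation C := R[i].

Lemma fpsd_operators (H : hilbert R) (B : G -> H -> H -> C) (c : R) :
  (forall s, sesquiform (B s)) -> fpsd setT B -> 0 <= c ->
  (forall x, complex.Re (B 1%g x x) <= c * hnorm x ^+ 2) ->
  exists v : G -> bop H, psd setT v /\ forall s x y, hdot (v s x) y = B s x y.
Proof.
move=> Bs Bp c0 hB.
have GT : positivity_domain [set: G].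
  by split=> //; apply/seteqP; split=> // s _; exists (s^-1)%g; rewrite ?invgK.
have hv s : exists T : bop H, forall x y, hdot (T x) y = B s x y.
  apply: (@form_bop _ _ _ c) => // [a x y z|a x y z|x y].
  - exact: (Bs s).1.
  - exact: (Bs s).2.
  rewrite -le_sqr ?normc_ge0 ?mulr_ge0 ?hnorm_ge0//.
  rewrite (le_trans (fpsd_CS GT (fun s _ => Bs s) Bp _ _ (I : setT s)))//.
  have -> : (c * hnorm x * hnorm y) ^+ 2 = (c * hnorm x ^+ 2) * (c * hnorm y ^+ 2) by ring.
  have B0 z : 0 <= complex.Re (B 1%g z z).
    by have := fpsd1_ge0 GT Bp z; rewrite ge0_complexE => /andP[].
  exact: ler_pM.
have [v {}hv] := choice hv; exists v; split=> //; apply/psdP => l hl.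
have := Bp l hl; congr (_ <= _); apply: eq_bigr => p _; apply: eq_bigr => q _.
by rewrite /bform hv.
Qed.

Lemma fpsd_comp (V W : lmodType C) (D : set G) (B : G -> W -> W -> C) (j : V -> W) :
  fpsd D B -> fpsd D (fun s x y => B s (j x) (j y)).
Proof.
move=> Bp l hl; have := Bp [seq (p.1, j p.2) | p <- l]; rewrite big_map.
under eq_bigr do rewrite big_map.
by apply => _ _ /mapP[p hp ->] /mapP[q hq ->]; exact: hl.
Qed.

Lemma sesqui_comp (V W : lmodType C) (b : W -> W -> C) (j : V -> W) :
  sesquiform b -> linear j -> sesquiform (fun x y => b (j x) (j y)).
Proof. by move=> [bl br] jl; split=> a x y z; rewrite jl ?bl ?br. Qed.

End pullback.

Section bounded_to_positive.
Context {R : realType} {G : groupType} (A : group_cstar R G).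
Context (D : set G) (hD : positivity_domain D).

Lemma bounded_to_positive : bounded_extension_property A D ->
  positive_extension_property R D.
Proof.
move=> ext H u up.
have [L [j [u' [jl u'p u'1 u'E]]]] :=
  Kolmogorov hD (fun s _ => bform_sesqui u s) ((psdP D u).1 up).
have [|v' [v'B v'E v'N]] := ext L u'.
  exists 1%N, (fun=> 1), (fun=> u'); split=> // s _.
  by rewrite big_ord1 scale1r.
have v'1 : v' 1%g = 1 by rewrite v'E//; exact: hD.1.
have v'p : psd setT v'.
  apply: (unital_contraction_psd (A := A)) => //.
  apply: BGH_norm_cbbound => //; rewrite v'N.
  apply: ge_ereal_sup => _ [n [X [hX X1 ->]]]; apply/(mxboundP _ ler01).
  by apply: psd_UOS_bound => // x; rewrite u'1 mul1r.
have [c c0 hc] := bop_bounded (u 1%g).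
(* The extension was made for the unital dilation [u'], as contractivity yields positivity only in
   the unital case; compressing along [j] returns to u. *)
have [||||v [vp vE]] := @fpsd_operators R G H (fun s x y => hdot (v' s (j x)) (j y)) c.
- by move=> s; exact: (sesqui_comp (bform_sesqui v' s) jl).
- exact: (fpsd_comp j ((psdP setT v').1 v'p)).
- exact: c0.
- move=> x; rewrite v'E ?u'E; [|exact: hD.1|exact: hD.1].
  rewrite (le_trans (Re_le_normc _))// (le_trans (Cauchy_Schwarz _ _))//.
  by rewrite expr2 mulrA ler_wpM2r ?hnorm_ge0.
exists v; split=> // s Ds; apply: bop_ext => x; apply: hdot_injl => y.
by rewrite vE v'E// u'E.
Qed.

End bounded_to_positive.

(** * Complete factorisation and positive extensions *)

Section sums_of_squares.
Context {R : realType} {G : groupType} (A : group_cstar R G).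
Local Notation C := R[i].
Local Notation K := (gc_space A).
Local Notation delta := (delta A).
Implicit Types (D : set G).

Definition sum_of_squares D n (X : 'M[bop K]_n) :=
  exists (r : nat) (S : 'I_r -> {fset G}) (B : 'I_r -> G -> 'M[C]_n),
    (forall i, admissible D (S i)) /\
    X = \sum_i mxlincomb delta (S i) (B i) *m mxadj (mxlincomb delta (S i) (B i)).

Lemma sum_of_squares0 D n : sum_of_squares D (0 : 'M[bop K]_n).
Proof.
by exists 0%N, (fun=> fset0), (fun _ _ => 0); split=> [[]//|]; rewrite big_ord0.
Qed.

Lemma sum_of_squares1 D n S (B : G -> 'M[C]_n) : admissible D S ->
  sum_of_squares D (mxlincomb delta S B *m mxadj (mxlincomb delta S B)).
Proof.
by move=> aS; exists 1%N, (fun=> S), (fun=> B); split=> //; rewrite big_ord1.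
Qed.

Lemma sum_of_squaresD D n (X Y : 'M[bop K]_n) :
  sum_of_squares D X -> sum_of_squares D Y -> sum_of_squares D (X + Y).
Proof.
move=> [r [S [B [aS ->]]]] [r' [S' [B' [aS' ->]]]].
pose c T (f : 'I_r -> T) (f' : 'I_r' -> T) (i : 'I_(r + r')) : T :=
  match fintype.split i with inl k => f k | inr k => f' k end.
have cl T f f' k : c T f f' (lshift r' k) = f k by rewrite /c (unsplitK (inl k)).
have cr T f f' k : c T f f' (rshift r k) = f' k by rewrite /c (unsplitK (inr k)).
exists (r + r')%N, (c _ S S'), (c _ B B'); split.
  by move=> i; rewrite /c; case: fintype.split.
rewrite big_split_ord/=; congr (_ + _); apply: eq_bigr => k _; by rewrite ?cl ?cr.
Qed.

Definition smx (H : hilbert R) m n (P : 'M[C]_(m, n)) : 'M[bop H]_(m, n) :=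
  map_mx (fun a => a *: (1 : bop H)) P.

Lemma bop_scale_mul (H : hilbert R) (a : C) (T : bop H) : (a *: (1 : bop H)) * T = a *: T.
Proof. exact: bop_ext. Qed.

Lemma smx_mxlincomb n (P : 'M[C]_n) S (B : G -> 'M[C]_n) :
  smx K P *m mxlincomb delta S B = mxlincomb delta S (fun s => P *m B s).
Proof.
rewrite mulmx_sumr; apply: eq_bigr => s _; apply/matrixP => i j; rewrite !mxE.
rewrite scaler_suml; apply: eq_bigr => k _; rewrite !mxE bop_scale_mul.
by rewrite scalerA.
Qed.

(** Scalar factors are absorbed by the coefficient matrices, so the supports do not change. *)
Lemma sum_of_squares_conj D n (P : 'M[C]_n) (X : 'M[bop K]_n) :
  sum_of_squares D X -> sum_of_squares D (smx K P *m X *m mxadj (smx K P)).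
Proof.
move=> [r [S [B [aS ->]]]]; exists r, S, (fun i s => P *m B i s); split=> //.
rewrite mulmx_sumr mulmx_suml; apply: eq_bigr => i _.
by rewrite -smx_mxlincomb mxadjM !mulmxA.
Qed.

Lemma sum_of_squares_unit D n (r : R) : positivity_domain D -> 0 <= r ->
  sum_of_squares D (scalar_unit A n r).
Proof.
move=> hD r0.
have -> : scalar_unit A n r =
    mxlincomb delta [fset 1%g]%fset (fun=> (Num.sqrt r)%:C%:M) *m
    mxadj (mxlincomb delta [fset 1%g]%fset (fun=> (Num.sqrt r)%:C%:M)).
  rewrite /mxlincomb big_seq_fset1; apply/matrixP => i j; rewrite !mxE.
  rewrite (bigD1 i)//= !mxE eqxx mulr1n big1 ?addr0 => [|k ki]; last first.
    by rewrite !mxE eq_sym (negPf ki) mulr0n scale0r mul0r.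
  rewrite delta1; have adjE (a : R) : adj (a%:C *: (1 : bop K)) = a%:C *: (1 : bop K).
    by apply: adj_unique => x y; rewrite !bopZE hdotZl hdotZr conjc_real.
  case: (eqVneq i j) => _.
    by rewrite !mulr1n adjE bop_scale_mul scalerA -rmorphM -expr2 sqr_sqrtr.
  rewrite !mulr0n !scale0r.
  by rewrite (_ : adj (0 : bop K) = 0) ?mulr0//; apply: adj_unique => x y; rewrite !bop0E hdot0l hdot0r.
apply: sum_of_squares1 => s t; rewrite !inE => /eqP-> /eqP->.
by rewrite mulgV; exact: hD.1.
Qed.

Lemma sum_of_squares_Ucone D n (X : 'M[bop K]_n) : sum_of_squares D X -> Ucone D X.
Proof.
move=> [r [S [B [aS ->]]]].
exists r, (fun=> 1), (fun i => mxlincomb delta (S i) (B i) *m mxadj (mxlincomb delta (S i) (B i))).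
split=> // [i|].
  exists (S i) => //; exists 1%N, (fun=> B i); by rewrite big_ord1.
by apply: eq_bigr => i _; apply/matrixP => a b; rewrite [RHS]mxE scale1r.
Qed.

Lemma square_pos n (Y : 'M[bop K]_n) x : 0 <= mxform (Y *m mxadj Y) x x.
Proof.
by rewrite mxformE mxop_actM -mxformE -[Y in mxform Y]mxadjK mxadj_form mxformE -l2dotC
  l2dotxx ler0c sqr_ge0.
Qed.

Lemma sum_of_squares_pos D n (X : 'M[bop K]_n) : sum_of_squares D X -> mxop_pos X.
Proof.
move=> [r [S [B [aS ->]]]] x; rewrite -/(mxform _ x x) mxform_sum sumr_ge0// => i _.
exact: square_pos.
Qed.

End sums_of_squares.

Section matrix_realisation.
Context {R : realType} {G : groupType} (A : group_cstar R G) {V : lmodType R[i]}.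
Local Notation C := R[i].
Local Notation K := (gc_space A).
Local Notation delta := (delta A).
Context {n : nat} (psi : 'I_n -> V -> C).
Hypothesis psil : forall a (c : C) x y, psi a (c *: x + y) = c * psi a x + psi a y.
Implicit Types (t : seq (G * V * V)) (D : set G).

(** The functionals [psi] and their conjugates carry V and its conjugate dual factor to C^n, which
    turns a test into a matrix over C[G]. The conjugated factor indexes the rows, so that a block
    becomes a square Y Y^*. *)
Definition tmx t (a a' : 'I_n) : seq (C * G) :=
  [seq (psi a' p.1.2 * (psi a p.2)^*, p.1.1) | p <- t].

Lemma mxform_tmx (H : hilbert R) (u : G -> bop H) t (h : 'I_n -> H) :
  mxform (lcmx u (tmx t)) h h =
  \sum_(p <- t) hdot (u p.1.1 (\sum_a psi a p.1.2 *: h a)) (\sum_a psi a p.2 *: h a).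
Proof.
transitivity (\sum_a \sum_a' \sum_(p <- t)
   psi a' p.1.2 * (psi a p.2)^* * hdot (u p.1.1 (h a')) (h a)).
  apply: eq_bigr => a _; apply: eq_bigr => a' _; rewrite mxE /lc big_map bop_sumE hdot_suml.
  by apply: eq_bigr => p _; rewrite bopZE hdotZl.
under eq_bigr do rewrite exchange_big.
rewrite exchange_big; apply: eq_bigr => p _.
rewrite hdot_sumr; apply: eq_bigr => a _; rewrite bop_sumr hdot_suml.
by apply: eq_bigr => a' _; rewrite bopZr hdotZl hdotZr; ring.
Qed.

(** Vector functionals of C^*(G) read as families on V and cut off outside D. They show that a test
    supported on D determines the real part of the quadratic form of its matrix. *)
Definition kappa_form D (k : 'I_n -> K) (g : G) (x y : V) : C :=
  if `[< D g >] then hdot (delta g (\sum_a psi a x *: k a)) (\sum_a psi a y *: k a) else 0.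

Lemma kappa_family D k : positivity_domain D -> hermitian_family D (kappa_form D k).
Proof.
move=> hD.
have lin c x y : \sum_a psi a (c *: x + y) *: k a =
    c *: (\sum_a psi a x *: k a) + \sum_a psi a y *: k a.
  rewrite scaler_sumr -big_split; apply: eq_bigr => a _.
  by rewrite psil scalerDl scalerA.
split=> [s|s x y|s nDs x y].
- rewrite /kappa_form; case: asboolP => _; last by split=> *; rewrite mulr0 addr0.
  by split=> c x y z; rewrite lin ?bop_linear ?hdotDl ?hdotDr ?hdotZl ?hdotZr.
- rewrite /kappa_form; case: asboolP => Ds; case: asboolP => Ds'; last by rewrite rmorph0.
  + by rewrite (rep_dotV (delta_unitary A)) invgK -hdotC.
  + by case: Ds'; rewrite -[s]invgK; exact: domain_inv.
  + by case: Ds; exact: domain_inv.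
- by rewrite /kappa_form asboolF.
Qed.

Lemma eval_kappa D k t : supported D t ->
  evalt t (kappa_form D k) = complex.Re (mxform (lcmx delta (tmx t)) k k).
Proof.
move=> tD; rewrite mxform_tmx Re_sum /evalt !big_seq; apply: eq_bigr => p /tD Dp.
by rewrite /kappa_form asboolT.
Qed.

Lemma test_eq_matrix D t t' : positivity_domain D -> supported D t -> supported D t' ->
  test (D := D) t = test t' -> forall k,
  complex.Re (mxform (lcmx delta (tmx t)) k k) = complex.Re (mxform (lcmx delta (tmx t')) k k).
Proof.
move=> hD tD t'D tt' k; rewrite -!(eval_kappa (D := D))//.
have := congr1 (fun f => f (exist _ _ (kappa_family k hD))) tt'; exact.
Qed.

Lemma block_square D (b : seq (G * V)) :
  (forall p q, p \in b -> q \in b -> D (p.1 * q.1^-1)%g) ->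
  sum_of_squares (A := A) D (lcmx delta (tmx (block_test b))).
Proof.
move=> bD; pose S := [fset s in [seq p.1 | p <- b]]%fset.
(* A block is a single vector of coefficients, whereas squares are formed from square matrices: the
   vector is put in the column 0 and the other columns are zero. *)
pose B s : 'M[C]_n := \matrix_(i, l) (if val l == 0%N then
  \sum_(p <- b | p.1 == s) (psi i p.2)^* else 0).
have -> : lcmx delta (tmx (block_test b)) =
    mxlincomb delta S B *m mxadj (mxlincomb delta S B).
  rewrite -square_lcmxE; apply/matrixP => i j; rewrite !mxE.
  have bS : all (fun p => p.1 \in S) b.
    by apply/allP => p pb; rewrite !inE/=; apply/mapP; exists p.
  rewrite /square_lcmx lc_flatten big_map.
  have n0 : (0 < n)%N by exact: leq_ltn_trans (ltn_ord i).
  rewrite (bigD1 (Ordinal n0))//= big1 ?addr0; last first.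
    move=> l l0; rewrite /lc big_allpairs_dep big_map big1// => s _ /=.
    rewrite big1// => t _ /=; rewrite !mxE ifF ?mul0r ?scale0r//.
    by apply: contra_neqF l0 => /eqP h; apply: val_inj.
  rewrite /lc /tmx big_map big_allpairs_dep /=.
  rewrite (sum_partition _ (fset_uniq S) bS) big_allpairs_dep big_map; apply: eq_bigr => s _ /=.
  under eq_bigr do rewrite (sum_partition _ (fset_uniq S) bS).
  rewrite exchange_big big_map big_map; apply: eq_bigr => t _ /=.
  rewrite !mxE /= rmorph_sum mulr_suml scaler_suml; apply: eq_bigr => p /eqP ps.
  rewrite mulr_sumr scaler_suml; apply: eq_bigr => q /eqP qt /=.
  by rewrite conjcK ps qt [in LHS]mulrC.
apply: sum_of_squares1 => s t; rewrite !inE/= => /mapP[p pb ->] /mapP[q qb ->].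
exact: bD.
Qed.

Lemma tmx_flatten (u : G -> bop K) (ts : seq (seq (G * V * V))) :
  lcmx u (tmx (flatten ts)) = \sum_(t <- ts) lcmx u (tmx t).
Proof.
apply/matrixP => i j; rewrite summxE mxE /tmx map_flatten lc_flatten big_map.
by apply: eq_bigr => t _; rewrite mxE.
Qed.

Lemma blocks_squares D (k : seq (seq (G * V))) : admissible_blocks D k ->
  sum_of_squares (A := A) D (lcmx delta (tmx (blocks_test k))).
Proof.
move=> kD; rewrite tmx_flatten big_map big_seq.
elim/big_ind : _ => [||b bk]; first exact: sum_of_squares0.
  by move=> *; exact: sum_of_squaresD.
by apply: block_square => p q; exact: kD.
Qed.

Lemma blocks_supported D (k : seq (seq (G * V))) : admissible_blocks D k -> supported D (blocks_test k).
Proof.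
move=> kD p /flattenP[_ /mapP[b bk ->]] /allpairsP[[p1 p2] [/= h1 h2 ->]] /=.
exact: kD h1 h2.
Qed.

End matrix_realisation.

Section dual_family.
Context {R : realType} {H : hilbert R}.
Local Notation C := R[i].

(** Reduces a test on H to a matrix: with these functionals in [tmx], the form at h returns the
    original vectors of the test. *)
Lemma dual_family (hs : seq H) : exists (n : nat) (h : 'I_n -> H) (phi : 'I_n -> H -> C),
  (forall a (c : C) x y, phi a (c *: x + y) = c * phi a x + phi a y) /\
  (forall x, x \in hs -> \sum_a phi a x *: h a = x).
Proof.
pose n := size hs; pose h (i : 'I_n) : H := nth 0 hs i.
pose g : 'M[C]_n := \matrix_(i, j) hdot (h i) (h j).
exists n, h, (fun a x => \sum_b hdot x (h b) * pinvmx g b a); split.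
  move=> a c x y; rewrite mulr_sumr -big_split; apply: eq_bigr => b _ /=.
  by rewrite hdotDl hdotZl; ring.
move=> x xs; have [i ->] : exists i, x = h i.
  have ix : (index x hs < n)%N by rewrite index_mem.
  by exists (Ordinal ix); rewrite /h nth_index.
(* The Gram matrix g may be singular, but P g = g. Hence the sum of the P i a h a minus h i is
   orthogonal to all h b, and it lies in their span. *)
set P := g *m pinvmx g.
have PE a : \sum_b hdot (h i) (h b) * pinvmx g b a = P i a.
  by rewrite [RHS]mxE; apply: eq_bigr => b _; rewrite [g i b]mxE.
under eq_bigr do rewrite PE.
have Pg : P *m g = g by exact: mulmxKpV.
set v := \sum_a _.
have hv b : hdot (v - h i) (h b) = 0.
  rewrite hdotBl hdot_suml; have := congr1 (fun M => fun_of_matrix M i b) Pg.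
  rewrite [LHS]mxE [RHS]mxE => <-; apply/eqP; rewrite subr_eq0; apply/eqP.
  apply: eq_bigr => a _.
  by rewrite hdotZl [g a b]mxE.
apply/eqP; rewrite -subr_eq0; apply/eqP/hdot_injl => z; rewrite hdot0l.
suff /hnorm0_eq0 -> : hnorm (v - h i) = 0 by rewrite hdot0l.
apply/eqP; rewrite -sqrf_eq0 sqr_hnorm; apply/eqP.
rewrite {2}/v hdotBr hdot_sumr big1 ?sub0r => [|a _]; last by rewrite hdotZr hv mulr0.
by rewrite hv oppr0.
Qed.

End dual_family.

Section hermitian_part.
Context {R : realType} {G : groupType} (A : group_cstar R G).
Local Notation C := R[i].
Local Notation K := (gc_space A).
Local Notation delta := (delta A).
Context {n : nat}.
Implicit Types (Z : 'I_n -> 'I_n -> seq (C * G)).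

(** The self-adjoint part of Z. Equality of tests fixes the real part of the form only, whereas
    positivity in M_n(C^*(G)) also needs the imaginary part to vanish. *)
Definition herm_lcmx Z (i j : 'I_n) : seq (C * G) :=
  [seq (2^-1 * p.1, p.2) | p <- Z i j ++ adj_lcmx Z i j].

Lemma herm_lcmxE (H : hilbert R) (u : G -> bop H) Z :
  lcmx u (herm_lcmx Z) = map_mx (fun T => (2^-1 : C) *: T) (lcmx u Z + lcmx u (adj_lcmx Z)).
Proof. by apply/matrixP => i j; rewrite !mxE lc_scale lc_cat. Qed.

Lemma mxform_map_scale (H : hilbert R) (a : C) (T : 'M[bop H]_n) x y :
  mxform (map_mx (fun S => a *: S) T) x y = a * mxform T x y.
Proof.
rewrite mulr_sumr; apply: eq_bigr => i _; rewrite mulr_sumr; apply: eq_bigr => j _.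
by rewrite mxE bopZE hdotZl.
Qed.

Lemma half_add_conj (z : C) : 2^-1 * (z + z^*) = (complex.Re z)%:C.
Proof.
rewrite addcJ mulrA mulVf ?mul1r// ?pnatr_eq0//.
Qed.

Lemma mxform_herm Z x : mxform (lcmx delta (herm_lcmx Z)) x x =
  (complex.Re (mxform (lcmx delta Z) x x))%:C.
Proof.
rewrite herm_lcmxE mxform_map_scale mxformD (lcmx_adj _ (delta_unitary A)) mxadj_form.
exact: half_add_conj.
Qed.

Lemma herm_supported (D : set G) Z : positivity_domain D -> supported_mx D Z ->
  supported_mx D (herm_lcmx Z).
Proof.
move=> hD ZD i j _ /mapP[p + ->] /=; rewrite mem_cat => /orP[/ZD//|].
by move=> /mapP[q hq ->] /=; apply: (domain_inv hD); exact: ZD hq.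
Qed.

Lemma mxform_herm_psd (D : set G) (H : hilbert R) (u : G -> bop H) Z x :
  positivity_domain D -> psd D u -> supported_mx D Z ->
  mxform (lcmx u (herm_lcmx Z)) x x = (complex.Re (mxform (lcmx u Z) x x))%:C.
Proof.
move=> hD up ZD; rewrite herm_lcmxE mxform_map_scale mxformD.
have -> : mxform (lcmx u (adj_lcmx Z)) x x = (mxform (lcmx u Z) x x)^*.
  rewrite -mxadj_form; apply: eq_bigr => i _; apply: eq_bigr => j _; rewrite !mxE.
  rewrite [RHS]hdotC -adjP /lc big_map !bop_sumE !hdot_suml rmorph_sum big_seq [RHS]big_seq.
  apply: eq_bigr => p hp; rewrite !bopZE !hdotZl rmorphM; congr (_ * _).
  exact: (fpsd_herm hD (fun s _ => bform_sesqui u s) ((psdP D u).1 up) _ _ (ZD _ _ _ hp)).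
exact: half_add_conj.
Qed.

End hermitian_part.

Section block_cone.
Context {R : realType} {G : groupType} {V : lmodType R[i]}.
Implicit Types (D : set G) (k : seq (seq (G * V))).

Lemma total_domain : positivity_domain [set: G].
Proof.
by split=> //; apply/seteqP; split=> // s _; exists (s^-1)%g; rewrite ?invgK.
Qed.

Lemma admissibleT k : admissible_blocks [set: G] k.
Proof. by []. Qed.

Lemma scale_blocks D' (a : R) k :
  positivity_domain D' -> 0 <= a -> admissible_blocks D' k ->
  exists2 k', admissible_blocks D' k' &
    test (D := D') (blocks_test k') = a *: test (blocks_test k).
Proof.
move=> hD' a0 kD; pose r := Num.sqrt a.
exists [seq [seq (p.1, r%:C *: p.2) | p <- b] | b <- k].
  by move=> _ p q /mapP[b bk ->] /mapP[p' hp ->] /mapP[q' hq ->]; exact: kD bk hp hq.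
apply/funext => -[B hB]; rewrite /test/= -[RHS]/(a * evalt _ B) !eval_blocks big_map mulr_sumr.
have [Bs _ _] := hB.
apply: eq_bigr => b _; rewrite !eval_block -Re_scale; congr complex.Re.
rewrite big_map mulr_sumr; apply: eq_bigr => p _; rewrite big_map mulr_sumr.
apply: eq_bigr => q _ /=; rewrite (sesquiZl (Bs _)) (sesquiZr (Bs _)) conjc_real mulrA.
by rewrite -rmorphM -expr2 sqr_sqrtr.
Qed.

Lemma blocks_cat D' k k' :
  test (D := D') (blocks_test (k ++ k')) = test (blocks_test k) + test (blocks_test k').
Proof. by rewrite -test_cat /blocks_test map_cat flatten_cat. Qed.

Lemma admissible_cat D' k k' :
  admissible_blocks D' k -> admissible_blocks D' k' -> admissible_blocks D' (k ++ k').
Proof.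
by move=> h h' b p q; rewrite mem_cat => /orP[]; [exact: h|exact: h'].
Qed.

Definition block_cone D : set (hfamily (V := V) D -> R^o) :=
  [set f | exists2 k, admissible_blocks D k & f = test (blocks_test k)].

Lemma block_coneD D (f g : hfamily D -> R^o) :
  block_cone f -> block_cone g -> block_cone (f + g).
Proof.
move=> [k kD ->] [k' k'D ->]; exists (k ++ k'); last by rewrite blocks_cat.
exact: admissible_cat.
Qed.

Lemma block_coneZ D (a : R) (f : hfamily D -> R^o) : positivity_domain D -> 0 <= a ->
  block_cone f -> block_cone (a *: f).
Proof.
by move=> hD a0 [k kD ->]; have [k' k'D E] := scale_blocks hD a0 kD; exists k'.
Qed.

Lemma block_cone0 D : block_cone (D := D) 0.
Proof.
exists [::]; first by move=> b p q; rewrite in_nil.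
by apply/funext => f; rewrite /test /evalt big_nil.
Qed.

Lemma block_cone1 D x : positivity_domain D -> block_cone (D := D) (test [:: (1%g, x, x)]).
Proof.
move=> hD; exists [:: [:: (1%g, x)]].
  move=> b p q; rewrite inE => /eqP->; rewrite !inE => /eqP-> /eqP->.
  by rewrite mulgV; exact: hD.1.
apply/funext => -[B hB]; rewrite /test/= eval_blocks big_seq1 eval_block eval1.
by rewrite !big_seq1 /= mulgV.
Qed.

End block_cone.

Section factorisation_to_positive.
Context {R : realType} {G : groupType} (A : group_cstar R G).
Context (D : set G) (hD : positivity_domain D).
Local Notation C := R[i].
Local Notation K := (gc_space A).
Local Notation delta := (delta A).

Lemma factorisation_to_positive : complete_factorisation_property A D ->
  positive_extension_property R D.
Proof.
move=> fact H u up; have hT : positivity_domain [set: G] := total_domain.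
pose B0 s (x y : H) : C := if `[< D s >] then hdot (u s x) y else 0.
have B0h : hermitian_family [set: G] B0.
  split=> [s|s x y|s []//].
  - rewrite /B0; case: asboolP => _; first exact: bform_sesqui.
    by split=> *; rewrite mulr0 addr0.
  - rewrite /B0; case: asboolP => Ds; case: asboolP => Ds'; last by rewrite rmorph0.
    + exact: (fpsd_herm hD (fun s _ => bform_sesqui u s) ((psdP D u).1 up)).
    + by case: Ds'; rewrite -[s]invgK; exact: domain_inv.
    + by case: Ds; exact: domain_inv.
pose Kc := @block_cone R G H [set: G].
have KZ (a : R) f : 0 <= a -> Kc f -> Kc (a *: f) by exact: block_coneZ.
(* A test over D that is a sum of squares over G gives a matrix over D whose self-adjoint part is
   positive over C^*(G). By factorisation this part lies in the cone of UOS(D), on which u is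
   nonnegative; its form at [h] is the value of t. *)
have B0pos t : supported D t -> Kc (test t) -> 0 <= evalt t B0.
  move=> tD [k _ tk].
  have [n [h [phi [phil phih]]]] := dual_family ([seq p.1.2 | p <- t] ++ [seq p.2 | p <- t]).
  have XD : supported_mx D (tmx phi t) by move=> i j _ /mapP[p pt ->]; exact: tD.
  pose X := lcmx delta (herm_lcmx (tmx phi t)).
  have Xpos x : 0 <= mxform X x x.
    rewrite mxform_herm (test_eq_matrix (A := A) phil hT _ _ tk)// ler0c.
    have /sum_of_squares_pos/(_ x) := blocks_squares A phi (@admissibleT R G H k).
    by rewrite -/(mxform _ x x) ge0_complexE => /andP[].
  have Xspan : mxin (span_delta D) X.
    move=> i j; apply/span_deltaP; exists (herm_lcmx (tmx phi t) i j); last by rewrite mxE.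
    exact: herm_supported.
  have XU : UOS_pos D X.
    split=> //; first by apply: mxop_pos_herm; exact: Xpos.
    move=> r r0; apply: sum_of_squares_Ucone.
    have [||//|m [S [B [aS E]]]] := fact n X r; last by exists m, S, B.
      split; last exact: Xpos.
      by move=> i j; rewrite mxE; exact: cstar_lc.
    exact: Xspan.
  have := UOS_pos_form h up XU.
  rewrite phi_UOS_lcmx; last exact: herm_supported.
  rewrite (mxform_herm_psd _ hD up XD) ler0c mxform_tmx Re_sum /evalt !big_seq => e.
  rewrite (le_trans e)// le_eqVlt; apply/orP; left; apply/eqP; apply: eq_bigr => p pt.
  rewrite /B0 asboolT; last exact: tD.
  by rewrite !phih// mem_cat; apply/orP; [right|left]; apply/mapP; exists p.
have Kb k : admissible_blocks [set: G] k -> Kc (test (blocks_test k)) by exists k.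
have F0 : supported D ([::] : seq (G * H * H)) by [].
have FD t t' : supported D t -> supported D t' -> supported (V := H) D (t ++ t').
  by move=> tD t'D p; rewrite mem_cat => /orP[]; [exact: tD|exact: t'D].
have FZ a t : supported D t -> supported (V := H) D (scale_test a t).
  by move=> tD _ /mapP[p pt ->]; exact: (tD p pt).
have Fm (x : H) : exists t, supported D t /\ Kc (test t - test [:: (1%g, x, x)]).
  exists [:: (1%g, x, x)]; split.
    by move=> p; rewrite inE => /eqP->; exact: hD.1.
  by rewrite subrr; exact: block_cone0.
have [B [Bh Bp BE _]] := form_extension hT (@block_coneD _ _ H _) KZ Kb F0 FD FZ Fm B0h B0pos.
have BE' s x y : D s -> B s x y = hdot (u s x) y.
  move=> Ds; have E z : complex.Re (B s z y) = complex.Re (hdot (u s z) y).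
    have := BE [:: (s, z, y)]; rewrite !eval1 /B0 asboolT//; apply => // p.
    by rewrite inE => /eqP->.
  have [Bs _ _] := Bh; apply: complex_eq; first exact: E.
  have := E ('i *: x); rewrite (sesquiZl (Bs _)) bopZr hdotZl !Re_imag.
  by move=> /oppr_inj.
have [c c0 hc] := bop_bounded (u 1%g).
have [||||v [vp vE]] := @fpsd_operators R G H B c.
- by case: Bh.
- exact: Bp.
- exact: c0.
- move=> x; rewrite BE'; last exact: hD.1.
  rewrite (le_trans (Re_le_normc _))// (le_trans (Cauchy_Schwarz _ _))//.
  by rewrite expr2 mulrA ler_wpM2r ?hnorm_ge0.
exists v; split=> // s Ds; apply: bop_ext => x; apply: hdot_injl => y.
by rewrite vE BE'.
Qed.

End factorisation_to_positive.

Section positive_to_factorisation.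
Context {R : realType} {G : groupType} (A : group_cstar R G).
Context (D : set G) (hD : positivity_domain D).
Local Notation C := R[i].
Local Notation K := (gc_space A).
Local Notation delta := (delta A).

(** A compression of a representation is positive wherever the representation is, by
    [mxop_pos_universal]. *)
Lemma psd_universal (H : hilbert R) (v : G -> bop H) n
    (Z : 'I_n -> 'I_n -> seq (C * G)) x :
  psd setT v -> mxop_pos (lcmx delta Z) -> 0 <= mxform (lcmx v Z) x x.
Proof.
move=> vp Zp; have [||L [pi0 [J [piU Jl Jv]]]] := @GNS R G H (bform v).
- by move=> s; exact: bform_sesqui.
- exact/psdP.
have -> : mxform (lcmx v Z) x x = mxform (lcmx pi0 Z) (J \o x) (J \o x).
  apply: eq_bigr => i _; apply: eq_bigr => j _; rewrite !mxE /lc !bop_sumE !hdot_suml.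
  by apply: eq_bigr => p _; rewrite !bopZE !hdotZl Jv.
exact: (mxop_pos_universal piU Zp).
Qed.

(** * Separation of z + e from the sums of squares *)

Section separation.
Variables (n : nat) (Z : 'I_n -> 'I_n -> seq (C * G)).
Hypotheses (ZD : supported_mx D Z) (Zp : mxop_pos (lcmx delta Z)) (n0 : (0 < n)%N).
Variables (e : R) (e0 : 0 < e).
Local Notation V := ('I_n -> C^o).

Let unit_vec (i : 'I_n) : V := fun k => (k == i)%:R.
Let psi (a : 'I_n) (x : V) : C := x a.

Let psil a (c : C) (x y : V) : psi a (c *: x + y) = c * psi a x + psi a y.
Proof. by []. Qed.

Let vecE (x : V) : x = \sum_i x i *: unit_vec i.
Proof.
apply/funext => k; rewrite fct_sumE (bigD1 k)//= big1 ?addr0 => [|i ik].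
  by rewrite /unit_vec -[RHS]/(x k * (k == k)%:R) eqxx mulr1.
by rewrite -[LHS]/(x i * (k == i)%:R) eq_sym (negPf ik) mulr0.
Qed.

Let tz : seq (G * V * V) :=
  flatten [seq [seq (p.2, p.1 *: unit_vec ij.2, unit_vec ij.1) | p <- Z ij.1 ij.2] |
    ij <- index_enum ('I_n * 'I_n)%type].

Let t1 : seq (G * V * V) :=
  [seq (1%g, unit_vec i, unit_vec i) | i <- index_enum 'I_n].

Let tzD : supported D tz.
Proof. by move=> p /flattenP[_ /mapP[ij _ ->]] /mapP[q hq ->] /=; exact: ZD hq. Qed.

Let t1D : supported D t1.
Proof. by move=> _ /mapP[i _ ->]; exact: hD.1. Qed.

Let eval_tz B : evalt tz B =
  complex.Re (\sum_i \sum_j \sum_(p <- Z i j) B p.2 (p.1 *: unit_vec j) (unit_vec i)).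
Proof.
rewrite /evalt big_flatten big_map pair_big Re_sum; apply: eq_bigr => ij _.
by rewrite big_map Re_sum.
Qed.

Let eval_t1 B : evalt t1 B = \sum_i complex.Re (B 1%g (unit_vec i) (unit_vec i)).
Proof. by rewrite /evalt big_map. Qed.

Let mx_tz : lcmx delta (tmx psi tz) = lcmx delta Z.
Proof.
apply/matrixP => i j; rewrite !mxE /lc /tmx big_map big_flatten big_map.
rewrite (bigD1 (i, j))//= big_map [X in _ + X]big1 ?addr0 => [|[a b] ab].
  apply: eq_bigr => p _ /=; rewrite /psi /unit_vec -[(_ *: _) j]/(p.1 * (j == j)%:R) !eqxx.
  by rewrite conjc_nat !mulr1.
rewrite big_map big1// => p _ /=.
rewrite /psi /unit_vec -[(_ *: _) j]/(p.1 * (j == b)%:R) conjc_nat.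
move: ab; rewrite xpair_eqE negb_and eq_sym [b == j]eq_sym => /orP[] /negPf ->.
  by rewrite mulr0 scale0r.
by rewrite mulr0 mul0r scale0r.
Qed.

Let mx_t1 : lcmx delta (tmx psi t1) = scal_mx 1.
Proof.
apply/matrixP => i j; rewrite !mxE /lc /tmx !big_map (bigD1 i)//= big1 ?addr0.
  rewrite /psi /unit_vec eqxx conjc_nat mulr1 delta1 eq_sym.
  by case: eqP => _; rewrite ?scale1r ?scale0r.
move=> k ki; rewrite /psi /unit_vec [i == k]eq_sym (negPf ki) conjc_nat mulr0.
by rewrite scale0r.
Qed.

Local Notation Kd := (@block_cone R G V D).

Let Kd_sum (I : Type) (r : seq I) (P : pred I) (F : I -> hfamily (V := V) D -> R^o) :
  (forall i, P i -> Kd (F i)) -> Kd (\sum_(i <- r | P i) F i).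
Proof.
by move=> h; elim/big_ind : _ => //; [exact: block_cone0|exact: block_coneD].
Qed.

Let test_t1 : test t1 = \sum_i test (D := D) [:: (1%g, unit_vec i, unit_vec i)].
Proof.
apply/funext => f; rewrite fct_sumE /test eval_t1; apply: eq_bigr => i _.
by rewrite eval1.
Qed.

(* [M t1 - (1, x, x)] is a combination of squares because
   [n sum |y_i|^2 - |sum y_i|^2 = 1/2 sum |y_i - y_j|^2]. *)
Let t1_dominates (x : V) : exists M : R, Kd (M *: test t1 - test [:: (1%g, x, x)]).
Proof.
pose y i : V := x i *: unit_vec i.
pose M := n%:R * \sum_i normc (x i) ^+ 2 : R.
have Mge i : 0 <= M - n%:R * normc (x i) ^+ 2.
  rewrite subr_ge0 ler_wpM2l// (bigD1 i)//= lerDl sumr_ge0// => j _.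
  exact: sqr_ge0.
exists M; have -> : M *: test t1 - test [:: (1%g, x, x)] =
    \sum_i ((M - n%:R * normc (x i) ^+ 2) *: test [:: (1%g, unit_vec i, unit_vec i)]) +
    2^-1 *: \sum_i \sum_j test (D := D) [:: (1%g, y i - y j, y i - y j)].
  apply/funext => f; have [Bs Bh _] := svalP f.
  pose b x' y' : R := complex.Re (sval f 1%g x' y').
  have bE x' : test (D := D) [:: (1%g, x', x')] f = b x' x' by rewrite /test/= eval1.
  have E1 : (test t1 : hfamily (V := V) D -> R^o) f = \sum_i b (unit_vec i) (unit_vec i).
    by rewrite test_t1 fct_sumE; apply: eq_bigr => i _.
  have E2 (c : 'I_n -> R) : (\sum_i (c i *: test (D := D) [:: (1%g, unit_vec i, unit_vec i)])) f =
      \sum_i c i * b (unit_vec i) (unit_vec i).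
    by rewrite fct_sumE; apply: eq_bigr => i _; rewrite -bE.
  have E3 : (\sum_i \sum_j test (D := D) [:: (1%g, y i - y j, y i - y j)]) f =
      \sum_i \sum_j b (y i - y j) (y i - y j).
    rewrite fct_sumE; apply: eq_bigr => i _.
    by rewrite fct_sumE; apply: eq_bigr => j _; rewrite -bE.
  have [M' ME] : exists M', M' = M by exists M.
  rewrite -ME -[LHS]/(M' * test t1 f - test [:: (1%g, x, x)] f) E1 bE.
  rewrite -[RHS]/((\sum_i ((M' - n%:R * normc (x i) ^+ 2) *:
    test [:: (1%g, unit_vec i, unit_vec i)])) f + 2^-1 * (\sum_i \sum_j test _) f) E2 E3.
  have bB x' y' : b (x' - y') (x' - y') = b x' x' - b x' y' - b y' x' + b y' y'.
    rewrite /b (sesquiDl (Bs _)) !(sesquiDr (Bs _)) -!(scaleN1r y') !(sesquiZl (Bs _)).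
    by rewrite !(sesquiZr (Bs _)) conjN1 !mulN1r !ReD !ReN opprK; ring.
  have by_ i : b (y i) (y i) = normc (x i) ^+ 2 * b (unit_vec i) (unit_vec i).
    rewrite /b /y (sesquiZl (Bs _)) (sesquiZr (Bs _)) mulrA mul_conjc Re_scale.
    by [].
  have bx : b x x = \sum_i \sum_j b (y i) (y j).
    rewrite {1 2}(vecE x) /b (sesqui_suml (Bs _)) Re_sum; apply: eq_bigr => i _.
    by rewrite (sesqui_sumr (Bs _)) Re_sum.
  have -> : \sum_i \sum_j b (y i - y j) (y i - y j) =
      2 * (n%:R * \sum_i b (y i) (y i)) - 2 * b x x.
    under eq_bigr do under eq_bigr do rewrite bB.
    under eq_bigr do rewrite !big_split/= !sumrN.
    rewrite !big_split/= !sumrN.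
    rewrite -[X in _ - X - _]bx [X in _ - _ - X]exchange_big -[X in _ - _ - X]bx.
    have -> : \sum_(i < n) \sum_(j < n) b (y i) (y i) = n%:R * \sum_i b (y i) (y i).
      rewrite mulr_sumr; apply: eq_bigr => i _.
      by rewrite sumr_const card_ord mulr_natl.
    have -> : \sum_(i < n) \sum_(j < n) b (y j) (y j) = n%:R * \sum_i b (y i) (y i).
      by rewrite sumr_const card_ord mulr_natl.
    by ring.
  under [X in _ = X + _]eq_bigr do rewrite mulrBl -mulrA -by_.
  rewrite sumrB -!mulr_sumr; field => //.
apply: block_coneD; first by apply: Kd_sum => i _; apply: block_coneZ => //; exact: block_cone1.
by apply: block_coneZ => //; apply: Kd_sum => i _; apply: Kd_sum => j _; exact: block_cone1.
Qed.

Let b (x y : V) : C := \sum_i x i * (y i)^*.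

Let b_sesqui : sesquiform b.
Proof.
by split=> a x y z; rewrite /b mulr_sumr -big_split; apply: eq_bigr => i _;
  rewrite -[(a *: x + y) i]/(a * x i + y i) ?rmorphD ?rmorphM/=; ring.
Qed.

Let b_ge0 x : 0 <= b x x.
Proof. by apply: sumr_ge0 => i _; rewrite mul_conjc ler0c sqr_ge0. Qed.

(** The canonical trace of C[G] tensored with the trace of the n x n matrices: it is nonnegative on
    squares and has the value n on the unit [t1]. *)
Let diag_hermitian : hermitian_family D (diag_form b).
Proof.
split=> [s|s x y|s nDs x y]; first exact: diag_sesqui.
- have -> : diag_form b (s^-1)%g y x = if s == 1%g then b y x else 0.
    rewrite /diag_form; congr (if _ then _ else _).
    by apply/eqP/eqP => [h|->]; rewrite ?invg1// -[s]invgK h invg1.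
  rewrite /diag_form; case: eqP => _; last by rewrite rmorph0.
  by rewrite /b rmorph_sum; apply: eq_bigr => i _; rewrite rmorphM /= conjcK mulrC.
- by rewrite /diag_form; case: eqP nDs => // -> []; exact: hD.1.
Qed.

Let mx_smul (a : R) t : lcmx delta (tmx psi (scale_test a t)) =
  map_mx (fun T => a%:C *: T) (lcmx delta (tmx psi t)).
Proof.
apply/matrixP => i j; rewrite !mxE -lc_scale /lc /tmx !big_map.
by apply: eq_bigr => p _; rewrite /= mulrA.
Qed.

Let mx_cat t t' : lcmx delta (tmx psi (t ++ t')) =
  lcmx delta (tmx psi t) + lcmx delta (tmx psi t').
Proof. by apply/matrixP => i j; rewrite !mxE /tmx map_cat lc_cat. Qed.

Let scalar_unitE r : scalar_unit A n r = map_mx (fun T => r%:C *: T) (scal_mx 1).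
Proof.
apply/matrixP => i j; rewrite !mxE delta1.
by case: eqP => _; rewrite ?mulr1n ?scale1r// mulr0n scale0r scaler0.
Qed.

Let w := tz ++ scale_test e t1.

Let wD : supported D w.
Proof.
by move=> p; rewrite mem_cat => /orP[/tzD//|/mapP[q /t1D qD ->]].
Qed.

Let mx_w : lcmx delta (tmx psi w) = lcmx delta Z + scalar_unit A n e.
Proof. by rewrite mx_cat mx_smul mx_tz mx_t1 scalar_unitE. Qed.

Let w_pos x : 0 <= mxform (lcmx delta (tmx psi w)) x x.
Proof.
rewrite mx_w mxformD addr_ge0//; first exact: Zp.
have /sum_of_squares_pos/(_ x) := sum_of_squares_unit A n hD (ltW e0); exact.
Qed.

Let Kd_t1 : Kd (test t1).
Proof. by rewrite test_t1; apply: Kd_sum => i _; exact: block_cone1. Qed.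

(** Tests compare only real parts of forms; here both matrices are positive, so their forms are real
    and the matrices agree by polarisation. *)
Let Kd_w : Kd (test w) -> sum_of_squares (A := A) D (lcmx delta Z + scalar_unit A n e).
Proof.
move=> [k kD wk]; have S := blocks_squares A psi kD.
suff <- : lcmx delta (tmx psi (blocks_test k)) = lcmx delta Z + scalar_unit A n e by [].
rewrite -mx_w; apply: mxform_polar => x.
have h1 := sum_of_squares_pos S x; rewrite -/(mxform _ x x) in h1.
have := test_eq_matrix (A := A) psil hD wD (blocks_supported kD) wk x.
have := w_pos x; move: h1; rewrite !ge0_complexE => /andP[/eqP i1 _] /andP[/eqP i2 _] h.
by apply: complex_eq; rewrite ?i1 ?i2.
Qed.

Lemma separation : positive_extension_property R D ->
  sum_of_squares (A := A) D (lcmx delta Z + scalar_unit A n e).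
Proof.
move=> ext; apply: contrapT => nw.
(* The negative of w is thrown into the cone, so that a functional positive on [Kw] is nonnegative
   on squares and at most 0 on w. *)
pose Kw := [set f : hfamily (V := V) D -> R^o | exists k (r : R),
  [/\ admissible_blocks D k, 0 <= r & f = test (blocks_test k) - r *: test w]].
have KwD f g : Kw f -> Kw g -> Kw (f + g).
  move=> [k [r [kD r0 ->]]] [k' [r' [kD' r0' ->]]]; exists (k ++ k'), (r + r').
  split; [exact: admissible_cat|exact: addr_ge0|].
  by rewrite blocks_cat scalerDl opprD addrACA.
have KwZ (a : R) f : 0 <= a -> Kw f -> Kw (a *: f).
  move=> a0 [k [r [kD r0 ->]]]; have [k' k'D E] := scale_blocks hD a0 kD.
  by exists k', (a * r); split; rewrite ?mulr_ge0// E scalerBr scalerA.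
have Kw_Kd f : Kd f -> Kw f.
  by move=> [k kD ->]; exists k, 0; split=> //; rewrite scale0r subr0.
have Kwb k : admissible_blocks D k -> Kw (test (blocks_test k)).
  by move=> kD; apply: Kw_Kd; exists k.
pose F := [set t | exists l : R, test (D := D) t = l *: test t1].
have F0 : F [::].
  by exists 0; rewrite scale0r; apply/funext => f; rewrite /test /evalt big_nil.
have FD t t' : F t -> F t' -> F (t ++ t').
  by move=> [l E] [l' E']; exists (l + l'); rewrite test_cat E E' scalerDl.
have FZ a t : F t -> F (scale_test a t).
  by move=> [l E]; exists (a * l); rewrite test_scale E scalerA.
have Fmaj x : exists t, F t /\ Kw (test t - test [:: (1%g, x, x)]).
  have [M hM] := t1_dominates x; exists (scale_test M t1).
  by split; [exists M; rewrite test_scale|rewrite test_scale; exact: Kw_Kd].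
have evt1 : evalt t1 (diag_form b) = n%:R.
  rewrite eval_t1; transitivity (\sum_(i < n) (1 : R)).
    2: by rewrite sumr_const card_ord.
  apply: eq_bigr => i _; rewrite /diag_form eqxx /b (bigD1 i)//= big1 ?addr0 => [|j ji].
    by rewrite /unit_vec eqxx conjc_nat mulr1.
  by rewrite /unit_vec (negPf ji) mul0r.
pose f0 : hfamily (V := V) D := exist _ _ diag_hermitian.
(* On l t1 the trace is l n. If l < 0 and l t1 is a sum of squares minus r w with r > 0, then w is
   itself a sum of squares, against [nw]; if r = 0, the trace of the squares is nonnegative. *)
have B0pos t : F t -> Kw (test t) -> 0 <= evalt t (diag_form b).
  move=> [l tl] [k [r [kD r0 tk]]].
  have bpos : 0 <= evalt (blocks_test k) (diag_form b).
    rewrite eval_blocks big_seq sumr_ge0// => c ck; rewrite eval_block.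
    have := diag_fpsd (D := D) b_sesqui b_ge0 (l := c).
    by rewrite ge0_complexE => /(_ (fun p q => kD c p q ck))/andP[].
  have [l0|l0] := leP 0 l.
    have -> : evalt t (diag_form b) = l * n%:R.
      by rewrite -evt1; exact: (congr1 (fun f => f f0) tl).
    by rewrite mulr_ge0.
  have [r00|rn0] := eqVneq r 0.
    have -> : evalt t (diag_form b) = evalt (blocks_test k) (diag_form b) => //.
    have := congr1 (fun f => f f0) tk; rewrite r00 scale0r subr0; exact.
  case: nw; apply: Kd_w.
  have -> : test w = r^-1 *: test (blocks_test k) + (- l / r) *: test (D := D) t1.
    have E : r *: test (D := D) w = test (blocks_test k) - l *: test t1.
      by rewrite -tl tk opprB addrCA subrr addr0.
    apply: (scalerI rn0); rewrite E scalerDr !scalerA mulfV// scale1r.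
    by rewrite mulrCA mulfV// mulr1 scaleNr.
  have rp : 0 < r by rewrite lt_def rn0.
  apply: (block_coneD (block_coneZ hD _ _) (block_coneZ hD _ Kd_t1));
    rewrite ?invr_ge0 ?divr_ge0 ?oppr_ge0 ?ltW//.
  by exists k.
have [B [Bh Bp BF BK]] := form_extension hD KwD KwZ Kwb F0 FD FZ Fmaj diag_hermitian B0pos.
have [Bs _ _] := Bh.
have Ft1 : F t1 by exists 1; rewrite scale1r.
have Bw : evalt w B <= 0.
  have [w' [w'D w'E w'e]] : exists w', [/\ supported D w', test (D := D) w' = - test w
      & evalt w' B = - evalt w B].
    exists (scale_test (-1) w); split.
    - by move=> _ /mapP[q /wD qD ->].
    - by rewrite test_scale scaleN1r.
    - by rewrite eval_scale// mulN1r.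
  rewrite -oppr_ge0 -w'e; apply: BK => //; exists [::], 1.
  split=> //; rewrite w'E scale1r -[LHS]add0r; congr (_ - _).
  by apply/funext => f; rewrite /test /evalt big_nil.
have [L [j [u [jl up u1 uE]]]] := Kolmogorov hD (fun s _ => Bs s) Bp.
have [v [vp vu]] := ext L u up.
(* B is at most 0 on w and equals n on [t1], hence is at most - e n on [tz]. As B is a compression
   of v over D and Z is positive, it is also nonnegative there. *)
have := psd_universal (j \o unit_vec) vp Zp.
have -> : mxform (lcmx v Z) (j \o unit_vec) (j \o unit_vec) =
    \sum_i \sum_k \sum_(p <- Z i k) B p.2 (p.1 *: unit_vec k) (unit_vec i).
  apply: eq_bigr => i _; apply: eq_bigr => k _; rewrite mxE /lc bop_sumE hdot_suml.
  rewrite big_seq [RHS]big_seq; apply: eq_bigr => p hp.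
  have pD : D p.2 by exact: ZD hp.
  by rewrite bopZE hdotZl vu// uE// (sesquiZl (Bs _)).
rewrite ge0_complexE => /andP[_]; rewrite -eval_tz.
have := Bw; rewrite eval_cat eval_scale// (BF t1 Ft1 t1D) evt1.
have : 0 < e * n%:R by rewrite mulr_gt0// ltr0n.
by move=> h1 h2 h3; lra.
Qed.

End separation.

Lemma positive_to_factorisation : positive_extension_property R D ->
  complete_factorisation_property A D.
Proof.
move=> ext n z e [zc zp] zD e0.
have [Z [zE ZD]] := span_lists zD.
(* For n = 0 the trace of the unit is 0 and gives no contradiction; the empty matrix is the empty
   sum of squares. *)
case: (posnP n) => n0; last by rewrite zE; apply: separation => //; rewrite -zE.
move: z zc zp zD Z zE ZD; rewrite n0 => z *.
exists 0%N, (fun=> fset0), (fun _ _ => 0); split=> [[]//|].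
by apply/matrixP => -[].
Qed.

End positive_to_factorisation.

(** * Positive extensions give bounded extensions *)

Section square_roots.
Local Open Scope sesquilinear_scope.

(** Spectral decomposition; the summand e makes the root invertible, and [block_inequality] has to
    divide by it. *)
Lemma posmx_root (C : numClosedFieldType) n (M : 'M[C]_n) (e : C) :
  M^t* = M -> (forall x : 'rV_n, 0 <= (x *m M *m x^t*) 0 0) -> 0 < e ->
  exists2 L, L \in unitmx & L *m L^t* = M + e%:M.
Proof.
move=> Mh Mp e0; pose P := spectralmx M; pose d := spectral_diag M.
have PU : P \is unitarymx := spectral_unitarymx M.
have Pu : P \in unitmx := unitarymx_unit PU.
have /hermitian_normalmx/orthomx_spectralP : M \is hermsymmx.
  by apply/is_hermitianmxP; rewrite expr0 scale1r Mh.
rewrite -/P -/d invmx_unitary// => ME.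
have PP : P *m P^t* = 1%:M  by exact/unitarymxP.
have PP' : P^t* *m P = 1%:M by rewrite -invmx_unitary// mulVmx.
have d0 i : 0 <= d 0 i.
  have := Mp (row i P); rewrite ME !mulmxA -row_mul PP -!mulmxA.
  have -> : P *m (row i P)^t* = (row i (P *m P^t*))^t*.
    by rewrite row_mul trmx_mul map_mxM trmxCK.
  rewrite PP; congr (_ <= _).
  rewrite !mxE (bigD1 i)//= big1 ?addr0 => [|k ki]; last by rewrite !mxE eq_sym (negPf ki) mul0r.
  rewrite !mxE (bigD1 i)//= big1 ?addr0 => [|k ki]; last first.
    by rewrite !mxE eq_sym (negPf ki) mulr0n mul0r.
  by rewrite !mxE eqxx conjC1 mulr1 mul1r mulr1n.
pose q := \row_i sqrtC (d 0 i + e).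
have q0 i : 0 < q 0 i by rewrite mxE sqrtC_gt0 ltr_wpDl.
exists (P^t* *m diag_mx q).
  rewrite unitmx_mul -{1}invmx_unitary// unitmx_inv Pu unitmxE det_diag unitfE.
  by apply/prodf_neq0 => i _; rewrite gt_eqF.
rewrite trmx_mul map_mxM trmxCK tr_diag_mx.
rewrite map_diag_mx -mulmxA [X in _ *m X]mulmxA mulmx_diag {1}ME.
have -> : e%:M = P^t* *m diag_mx (const_mx e) *m P.
  by rewrite diag_const_mx mul_mx_scalar -scalemxAl PP' scalemx1.
rewrite -mulmxDl -mulmxDr -linearD /= mulmxA; congr (_ *m diag_mx _ *m _).
have dq i : 0 <= d 0 i + e by rewrite addr_ge0// ltW.
by apply/rowP => i; rewrite !mxE geC0_conj ?sqrtC_ge0// -expr2 sqrtCK.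
Qed.

End square_roots.

Section scalar_matrices.
Local Open Scope sesquilinear_scope.
Context {R : realType} {H : hilbert R}.
Local Notation C := R[i].

Lemma smxD n (P Q : 'M[C]_n) : smx H (P + Q) = smx H P + smx H Q.
Proof. by apply/matrixP => i j; rewrite !mxE scalerDl. Qed.

Lemma smx0 m n : smx H (0 : 'M[C]_(m, n)) = 0.
Proof. by apply/matrixP => i j; rewrite !mxE scale0r. Qed.

Lemma smx_scalar n (a : C) : smx H (a%:M : 'M[C]_n) = scal_mx a.
Proof.
by apply/matrixP => i j; rewrite !mxE; case: eqP; rewrite ?mulr1n ?mulr0n ?scale0r.
Qed.

Lemma smx1 n : smx H (1%:M : 'M[C]_n) = 1%:M.
Proof.
by apply/matrixP => i j; rewrite !mxE; case: eqP; rewrite ?mulr1n ?mulr0n ?scale1r ?scale0r.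
Qed.

Lemma smxM n (P Q : 'M[C]_n) : smx H (P *m Q) = smx H P *m smx H Q.
Proof.
apply/matrixP => i j; rewrite !mxE scaler_suml; apply: eq_bigr => k _.
by rewrite !mxE bop_scale_mul scalerA.
Qed.

Lemma smx_adj n (P : 'M[C]_n) : mxadj (smx H P) = smx H (P^t*).
Proof.
apply/matrixP => i j; rewrite !mxE; apply: adj_unique => x y.
by rewrite !bopZE hdotZl hdotZr conjcK.
Qed.

Lemma smx_block n (P1 P2 P3 P4 : 'M[C]_n) :
  smx H (block_mx P1 P2 P3 P4) = block_mx (smx H P1) (smx H P2) (smx H P3) (smx H P4).
Proof. exact: map_block_mx. Qed.

Lemma mxadj_block n (X1 X2 X3 X4 : 'M[bop H]_n) : mxadj (block_mx X1 X2 X3 X4) =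
  block_mx (mxadj X1) (mxadj X3) (mxadj X2) (mxadj X4).
Proof. by rewrite /mxadj map_block_mx tr_block_mx. Qed.

Lemma mxform_conj n (S T S' : 'M[bop H]_n) x y :
  mxform (mxadj S *m T *m S') x y = mxform T (mxop_act S' x) (mxop_act S y).
Proof.
rewrite -mulmxA mxformE mxop_actM -(mxformE (mxadj S)) mxadj_form mxformE -l2dotC.
by rewrite mxop_actM mxformE.
Qed.

Lemma sqr_l2norm_act n (S : 'M[bop H]_n) x :
  (l2norm (mxop_act S x) ^+ 2)%:C = mxform (mxadj S *m S) x x.
Proof. by rewrite -l2dotxx mxformE mxop_actM -(mxformE (mxadj S)) mxadj_form mxformE -l2dotC. Qed.

Lemma mxform_smxE n (P : 'M[C]_n) x y :
  mxform (smx H P) x y = \sum_i \sum_j P i j * hdot (x j) (y i).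
Proof. by apply: eq_bigr => i _; apply: eq_bigr => j _; rewrite mxE bopZE hdotZl. Qed.

Variables (G : groupType) (u : G -> bop H) (n : nat) (P : 'M[C]_n).
Variable Z : 'I_n -> 'I_n -> seq (C * G).

Lemma smx_mul_lcmx : smx H P *m lcmx u Z =
  lcmx u (fun i j => flatten [seq [seq (P i k * p.1, p.2) | p <- Z k j] | k <- index_enum 'I_n]).
Proof.
apply/matrixP => i j; rewrite !mxE lc_flatten big_map; apply: eq_bigr => k _.
by rewrite !mxE bop_scale_mul lc_scale.
Qed.

Lemma lcmx_mul_smx : lcmx u Z *m smx H P =
  lcmx u (fun i j => flatten [seq [seq (P k j * p.1, p.2) | p <- Z i k] | k <- index_enum 'I_n]).
Proof.
apply/matrixP => i j; rewrite !mxE lc_flatten big_map. apply: eq_bigr => k _.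
rewrite !mxE lc_scale; apply: bop_ext => x.
by rewrite [RHS]bopZE; exact: bopZr.
Qed.

End scalar_matrices.

Section scalar_roots.
Local Open Scope sesquilinear_scope.
Context {R : realType} {G : groupType} (A : group_cstar R G).
Local Notation C := R[i].
Local Notation K := (gc_space A).
Local Notation delta := (delta A).
Context {n : nat}.

Lemma scalar_unit_smx (r : R) : scalar_unit A n r = smx K (r%:C%:M).
Proof. by rewrite /scalar_unit delta1. Qed.

(** Positivity of the scalar matrix over K is tested on the scalar multiples of one nonzero vector,
    which gives positivity over C. *)
Lemma smx_root (P : 'M[C]_n) (e : R) :
  (forall x : 'I_n -> K, 0 <= mxform (smx K P) x x) -> 0 < e ->
  exists2 L : 'M[C]_n, L \in unitmx & L *m L^t* = P + e%:C%:M.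
Proof.
move=> Pp e0; have [xi xi0] := gc_space_nontrivial A.
have q0 : 0 < (hnorm xi ^+ 2)%:C.
  rewrite ltcR exprn_gt0// lt_def hnorm_ge0 andbT.
  by apply: contra_neq xi0; exact: hnorm0_eq0.
apply: posmx_root; last by rewrite ltcR.
- have /matrixP E := mxop_pos_herm Pp; apply/matrixP => i j; have := E i j.
  rewrite smx_adj !mxE => /(congr1 (fun T : bop K => T xi)); rewrite !bopZE => /eqP.
  rewrite -subr_eq0 -scalerBl scaler_eq0 (negPf xi0) orbF subr_eq0 => /eqP.
  exact.
- move=> a; have := Pp (fun i => (a 0 i)^* *: xi).
  have -> : mxform (smx K P) (fun i => (a 0 i)^* *: xi) (fun i => (a 0 i)^* *: xi) =
      (hnorm xi ^+ 2)%:C * (a *m P *m a^t*) 0 0.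
    rewrite mxform_smxE exchange_big mxE mulr_sumr; apply: eq_bigr => j _.
    rewrite !mxE mulr_suml mulr_sumr; apply: eq_bigr => i _.
    by rewrite hdotZl hdotZr hdotxx conjcK; ring.
  by rewrite pmulr_rge0.
Qed.

End scalar_roots.

(** * The matrix inequality behind Paulsen's trick *)

Section block_inequality.
Local Open Scope sesquilinear_scope.
Context {R : realType} {G : groupType} (A : group_cstar R G).
Context (D : set G) (hD : positivity_domain D).
Local Notation C := R[i].
Local Notation K := (gc_space A).
Local Notation delta := (delta A).

Lemma sum_of_squares_UOS_pos n (X : 'M[bop K]_n) : sum_of_squares D X -> UOS_pos D X.
Proof.
move=> XS; split.
- have [Z [-> ZD _]] := Ucone_lists (sum_of_squares_Ucone XS).
  by move=> i j; apply/span_deltaP; exists (Z i j); rewrite ?mxE//; exact: ZD.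
- exact: mxop_pos_herm (sum_of_squares_pos XS).
- move=> r r0; apply: sum_of_squares_Ucone; apply: sum_of_squaresD => //.
  exact: sum_of_squares_unit (ltW r0).
Qed.

Lemma scalar_unit_block n (r : R) : scalar_unit A (n + n) r =
  block_mx (scalar_unit A n r) 0 0 (scalar_unit A n r).
Proof. by rewrite !scalar_unit_smx scalar_mx_block smx_block !smx0. Qed.

Lemma UOS_norm_le1 n (X : 'M[bop K]_n) :
  sum_of_squares D (block_mx (scalar_unit A n 1) X (mxadj X) (scalar_unit A n 1)) ->
  (UOS_norm D X <= 1)%E.
Proof.
move=> XS; apply: ereal_inf_lbound; exists 1 => //; split=> //.
exact: sum_of_squares_UOS_pos.
Qed.

Context (H : hilbert R) (u : G -> bop H) (c : R) (c0 : 0 <= c).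
Hypothesis uc : forall n (X : 'M[bop K]_n), mxin (span_delta D) X ->
  (UOS_norm D X <= 1)%E -> mxbound (map_mx (phi_UOS D u) X) c.

(* Writing [P + e = L L^*] and [Q + e = M M^*], the element [L^-1 Z M^-*] of UOS(D) has
   norm at most one, so that [phi_u] maps it to an operator of norm at most [c]. *)
Lemma block_inequality n (P Q : 'M[C]_n) Z (x y : 'I_n -> H) : supported_mx D Z ->
  sum_of_squares D
    (block_mx (smx K P) (lcmx delta Z) (mxadj (lcmx delta Z)) (smx K Q)) ->
  2 * normc (mxform (lcmx u Z) y x) <=
  c * (complex.Re (mxform (smx H P) x x) + complex.Re (mxform (smx H Q) y y)).
Proof.
move=> ZD TS; set T := block_mx _ _ _ _ in TS.
have Tp z : 0 <= mxform T z z := sum_of_squares_pos TS z.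
have f0l S (z w : 'I_n -> K) : mxform S (fun i => 0 *: z i) w = 0.
  by rewrite mxform_scalel mul0r.
have f0r S (z w : 'I_n -> K) : mxform S w (fun i => 0 *: z i) = 0.
  by rewrite mxform_scaler conjc0 mul0r.
have Pp (z : 'I_n -> K) : 0 <= mxform (smx K P) z z.
  have := mxform_block (smx K P) (lcmx delta Z) (mxadj (lcmx delta Z)) (smx K Q) z (fun i => 0 *: z i).
  by rewrite /= !f0l !f0r !addr0 => <-; exact: Tp.
have Qp (z : 'I_n -> K) : 0 <= mxform (smx K Q) z z.
  have := mxform_block (smx K P) (lcmx delta Z) (mxadj (lcmx delta Z)) (smx K Q) (fun i => 0 *: z i) z.
  by rewrite /= !f0l !f0r !add0r => <-; exact: Tp.
suff h (e : R) : 0 < e -> 2 * normc (mxform (lcmx u Z) y x) <=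
    c * (complex.Re (mxform (smx H P) x x) + complex.Re (mxform (smx H Q) y y)) +
    e * (c * (l2norm x ^+ 2 + l2norm y ^+ 2)).
  apply: le_of_forall_eps => e e0.
  have B0 : 0 <= c * (l2norm x ^+ 2 + l2norm y ^+ 2).
    by rewrite mulr_ge0// addr_ge0 ?sqr_ge0.
  have d0 : 0 < e / (c * (l2norm x ^+ 2 + l2norm y ^+ 2) + 1) by rewrite divr_gt0// ltr_wpDl.
  apply: le_trans (h _ d0) _; rewrite lerD2l mulrAC ler_pdivrMr ?ltr_wpDl//.
  by rewrite ler_wpM2l ?(ltW e0)// lerDl.
move=> e0; have [L Lu LE] := smx_root Pp e0; have [M Mu ME] := smx_root Qp e0.
have inv_adj (N : 'M[C]_n) : N \in unitmx -> N^t* *m (invmx N)^t* = 1%:M.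
  move=> Nu; rewrite -map_mxM -trmx_mul mulVmx//.
  by rewrite trmx1 map_mx1.
pose X := smx K (invmx L) *m lcmx delta Z *m mxadj (smx K (invmx M)).
(* Conjugation by the diagonal matrix of L^-1 and M^-1 normalises the diagonal blocks P + e and Q +
   e to 1 and remains a sum of squares. *)
have XS : sum_of_squares D (block_mx (scalar_unit A n 1) X (mxadj X) (scalar_unit A n 1)).
  have := sum_of_squares_conj (block_mx (invmx L) 0 0 (invmx M))
    (sum_of_squaresD TS (sum_of_squares_unit A (n + n) hD (ltW e0))).
  rewrite scalar_unit_block /T add_block_mx !addr0 smx_block !smx0 mxadj_block.
  rewrite smx_adj (_ : mxadj 0 = 0); last by rewrite -[0](smx0 n n) smx_adj trmx0 map_mx0.
  rewrite !mulmx_block !(mul0mx, mulmx0, addr0, add0r).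
  rewrite !scalar_unit_smx -!smxD -LE -ME !smx_adj -!smxM !mulmxA !mulVmx// !mul1mx !inv_adj//.
  rewrite rmorph1 -smx_adj -/X.
  have -> : mxadj X = smx K (invmx M) *m mxadj (lcmx delta Z) *m mxadj (smx K (invmx L)).
    by rewrite /X !mxadjM mxadjK mulmxA.
  by rewrite smx_adj.
have [W [XW WD Wu]] : exists W, [/\ X = lcmx delta W, supported_mx D W &
    lcmx u W = smx H (invmx L) *m lcmx u Z *m mxadj (smx H (invmx M))].
  rewrite /X !smx_adj !smx_mul_lcmx !lcmx_mul_smx; eexists; split; [reflexivity| |reflexivity].
  move=> i j _ /flattenP[_ /mapP[k _ ->]] /mapP[p + ->] /=.
  by move=> /flattenP[_ /mapP[l _ ->]] /mapP[q qZ ->] /=; exact: ZD qZ.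
have Xspan : mxin (span_delta D) X.
  by rewrite XW => i j; apply/span_deltaP; exists (W i j); rewrite ?mxE//; exact: WD.
have Wc := uc Xspan (UOS_norm_le1 XS).
rewrite XW phi_UOS_lcmx// in Wc.
have uZ : lcmx u Z = mxadj (smx H (L^t*)) *m lcmx u W *m smx H (M^t*).
  rewrite Wu !smx_adj trmxCK !mulmxA -smxM mulmxV// smx1 mul1mx -mulmxA -smxM.
  by rewrite -map_mxM -trmx_mul mulmxV// trmx1 map_mx1 smx1 mulmx1.
have nE (N : 'M[C]_n) (S : 'M[C]_n) (z : 'I_n -> H) : N *m N^t* = S + e%:C%:M ->
    l2norm (mxop_act (smx H (N^t*)) z) ^+ 2 =
    complex.Re (mxform (smx H S) z z) + e * l2norm z ^+ 2.
  move=> NE; have := sqr_l2norm_act (smx H (N^t*)) z.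
  rewrite smx_adj trmxCK -smxM NE smxD mxformD smx_scalar mxform_scalar_mx l2dotxx.
  by move=> /(congr1 (@complex.Re R)); rewrite ReD -rmorphM.
have := mxbound_form (mxop_act (smx H (M^t*)) y) (mxop_act (smx H (L^t*)) x) Wc.
rewrite -mxform_conj -uZ => h1.
have h2 := nE _ _ x LE; have h3 := nE _ _ y ME.
set a := l2norm _ in h1 h3; set b := l2norm _ in h1 h2.
(* 2 a b <= a^2 + b^2 replaces the product of norms by the sum of the diagonal forms, which is
   linear in the test. *)
have : 0 <= c * (a - b) ^+ 2 by rewrite mulr_ge0// sqr_ge0.
rewrite sqrrB h2 h3 => h4.
have h1' : 2 * normc (mxform (lcmx u Z) y x) <= 2 * (c * a * b) by rewrite ler_wpM2l.
by rewrite (le_trans h1')//; lra.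
Qed.

End block_inequality.

Section dominated_forms.
Local Open Scope sesquilinear_scope.
Context {R : realType} {G : groupType} (A : group_cstar R G).
Context (D : set G) (hD : positivity_domain D).
Local Notation C := R[i].
Local Notation K := (gc_space A).
Local Notation delta := (delta A).
Context (H : hilbert R) (u : G -> bop H) (c : R) (c0 : 0 <= c).
Hypothesis uc : forall n (X : 'M[bop K]_n), mxin (span_delta D) X ->
  (UOS_norm D X <= 1)%E -> mxbound (map_mx (phi_UOS D u) X) c.
Local Notation V := (H * H)%type.
Implicit Types (p : G * V * V) (t : seq (G * V * V)).

(** The family of the blocks [[c 1, u], [u^*, c 1]], where c 1 is c at the identity and 0 elsewhere.
    Only its values in the corners are prescribed to the extension, whose diagonal blocks away from
    the identity may differ. *)
Let B0 (s : G) (x y : V) : C := if `[< D s >] then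
  (if s == 1%g then c%:C * (hdot x.1 y.1 + hdot x.2 y.2) else 0) +
  hdot (u s x.2) y.1 + (hdot (u (s^-1)%g y.2) x.1)^* else 0.

Let B0_herm : hermitian_family D B0.
Proof.
split=> [s|s x y|s nDs x y]; last by rewrite /B0 asboolF.
- rewrite /B0; case: asboolP => _; last by split=> *; rewrite mulr0 addr0.
  split=> a x y z /=; rewrite ?bop_linear !(hdotDl, hdotDr, hdotZl, hdotZr).
  + by rewrite rmorphD rmorphM /= conjcK; case: ifP => _; ring.
  + by rewrite rmorphD rmorphM /=; case: ifP => _; ring.
- have [Ds|nDs] := pselect (D s); last first.
    rewrite /B0 !asboolF ?rmorph0// => /(domain_inv hD); rewrite invgK.
    exact: nDs.
  rewrite /B0 !asboolT//; last exact: domain_inv.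
  have -> : (s^-1 == 1)%g = (s == 1)%g.
    by apply/eqP/eqP => [h|->]; rewrite ?invg1// -[s]invgK h invg1.
  rewrite invgK !rmorphD /= conjcK [RHS]addrAC; congr (_ + _ + _).
  by case: ifP; rewrite ?rmorph0// rmorphM rmorphD /= -!hdotC conjc_real.
Qed.

(* The tests of the three kinds correspond to the corners of the operator system of
   the matrices [[a 1, x], [y, b 1]] with [x] in UOS(D). *)
Let corner p := [\/ [/\ p.1.1 = 1%g, p.1.2.2 = 0 & p.2.2 = 0],
  [/\ p.1.1 = 1%g, p.1.2.1 = 0 & p.2.1 = 0]
  | [/\ D p.1.1, p.1.2.1 = 0 & p.2.2 = 0]].

Let corners t := forall p, p \in t -> corner p.

Let corner_supported t : corners t -> supported D t.
Proof. by move=> tc p /tc[] [h0 _ _] //; rewrite h0; exact: hD.1. Qed.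

Let corner_B0 p : corner p -> B0 p.1.1 p.1.2 p.2 =
  c%:C * (hdot p.1.2.1 p.2.1 + hdot p.1.2.2 p.2.2) + hdot (u p.1.1 p.1.2.2) p.2.1.
Proof.
move=> h; have Dp : D p.1.1 by case: h => -[h0 _ _] //; rewrite h0; exact: hD.1.
rewrite /B0 asboolT//; case: h => -[h0 h1 h2].
- by rewrite h0 h1 h2 eqxx invg1 !bop0r !hdot0l rmorph0 addr0.
- by rewrite h0 h1 h2 eqxx !hdot0r rmorph0 addr0.
- by rewrite h1 h2 !bop0r !hdot0l !hdot0r rmorph0 !(addr0, mulr0, if_same) add0r.
Qed.

Let corner_scale (a : C) s x y : corner (s, x, y) -> corner (s, a *: x, y).
Proof.
by move=> [[/= h1 h2 h3]|[/= h1 h2 h3]|[/= h1 h2 h3]];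
  [apply: Or31|apply: Or32|apply: Or33]; split=> //=; rewrite h2 scaler0.
Qed.

(** Write x = a + b with a and b in the two summands; the parallelogram identity makes twice the sum
    of the squares of a and b minus the square of x equal to the square of a - b. *)
Let corners_majorise (x : V) : exists t, corners t /\
  block_cone (D := D) (test t - test [:: (1%g, x, x)]).
Proof.
pose a : V := (x.1, 0); pose b : V := (0, x.2).
exists (scale_test 2 [:: (1%g, a, a); (1%g, b, b)]); split.
  by move=> _ /mapP[q + ->]; rewrite !inE => /orP[] /eqP->; apply: corner_scale;
    [apply: Or31|apply: Or32].
have -> : test (scale_test 2 [:: (1%g, a, a); (1%g, b, b)]) - test [:: (1%g, x, x)] =
    test (D := D) [:: (1%g, a - b, a - b)]; last exact: block_cone1.
apply/funext => f; have [Bs Bh _] := svalP f.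
rewrite test_scale -[LHS]/(2 * test [:: (1%g, a, a); (1%g, b, b)] f - test [:: (1%g, x, x)] f).
have -> : x = a + b.
  rewrite [LHS]surjective_pairing /a /b.
  by rewrite -[RHS]/(x.1 + 0, 0 + x.2) addr0 add0r.
rewrite /test -cat1s eval_cat !eval1 -(scaleN1r b) !(sesquiDl (Bs _)) !(sesquiDr (Bs _)).
rewrite !(sesquiZl (Bs _)) !(sesquiZr (Bs _)) conjN1 !mulN1r !ReD !ReN opprK; ring.
Qed.

Lemma tmx_units n (phi : 'I_n -> H -> C) (L : hilbert R) (w : G -> bop L)
    (l : seq (H * H)) : w 1%g = 1 ->
  lcmx w (tmx phi [seq (1%g, q.1, q.2) | q <- l]) =
  smx L (\matrix_(a, a') \sum_(q <- l) phi a' q.1 * (phi a q.2)^*).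
Proof.
move=> w1; apply/matrixP => a a'; rewrite !mxE /lc /tmx !big_map scaler_suml.
by apply: eq_bigr => q _; rewrite /= w1.
Qed.

Let corners_pos t : corners t -> block_cone (D := D) (test t) -> 0 <= evalt t B0.
Proof.
move=> tc [k kD tk].
have [n [h [phi [phil phih]]]] := dual_family
  ([seq p.1.2.1 | p <- t] ++ [seq p.1.2.2 | p <- t] ++
   [seq p.2.1 | p <- t] ++ [seq p.2.2 | p <- t]).
have phi0 a : phi a 0 = 0 by have := phil a (-1) 0 0; rewrite scaler0 addr0 mulN1r addNr.
pose psi (i : 'I_(n + n)) (x : V) : C :=
  match fintype.split i with inl a => phi a x.1 | inr a => phi a x.2 end.
have psil i (a : C) x y : psi i (a *: x + y) = a * psi i x + psi i y.
  by rewrite /psi; case: fintype.split => b; exact: phil.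
pose l1 := [seq (p.1.2.1, p.2.1) | p : G * V * V <- t].
pose l2 := [seq (p.1.2.2, p.2.2) | p : G * V * V <- t].
pose t12 := [seq (p.1.1, p.1.2.2, p.2.1) | p : G * V * V <- t].
pose P : 'M[C]_n := \matrix_(a, a') \sum_(q <- l1) phi a' q.1 * (phi a q.2)^*.
pose Q : 'M[C]_n := \matrix_(a, a') \sum_(q <- l2) phi a' q.1 * (phi a q.2)^*.
pose Z := tmx phi t12.
have psil_ a x : psi (lshift n a) x = phi a x.1 by rewrite /psi (unsplitK (inl a)).
have psir_ a x : psi (rshift n a) x = phi a x.2 by rewrite /psi (unsplitK (inr a)).
have d1 := delta1 A.
(* The corner conditions leave only the identity of G in the diagonal blocks, which are therefore
   scalar, and nothing in the lower left one. *)
have XE : lcmx delta (tmx psi t) = block_mx (smx K P) (lcmx delta Z) 0 (smx K Q).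
  apply/matrixP => i j; rewrite -(splitK i) -(splitK j).
  case: (fintype.split i) => a; case: (fintype.split j) => b /=;
    rewrite ?block_mxEul ?block_mxEur ?block_mxEdl ?block_mxEdr !mxE /lc /tmx !big_map
      ?scaler_suml /=.
  - rewrite big_seq [RHS]big_seq; apply: eq_bigr => p /tc pc /=; rewrite !psil_.
    by case: pc => -[h0 h1 h2]; rewrite ?h1 ?phi0 ?mul0r ?scale0r// h0 d1.
  - by apply: eq_bigr => p _ /=; rewrite psir_ psil_.
  - rewrite big_seq big1// => p /tc pc /=; rewrite psil_ psir_.
    by case: pc => -[h0 h1 h2]; rewrite ?h1 ?h2 ?phi0 ?rmorph0 ?mulr0 ?mul0r ?scale0r.
  - rewrite big_seq [RHS]big_seq; apply: eq_bigr => p /tc pc /=; rewrite !psir_.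
    by case: pc => -[h0 h1 h2]; rewrite ?h2 ?phi0 ?rmorph0 ?mulr0 ?scale0r// h0 d1.
have ZD : supported_mx D Z.
  by move=> i j _ /mapP[_ /mapP[p pt ->] ->] /=; exact: (corner_supported tc pt).
have S := blocks_squares A psi kD.
(* The test fixes real parts of forms only, so the matrix of t is added to its adjoint; this doubles
   the sum of squares on the other side. *)
have SE : lcmx delta (tmx psi (blocks_test k)) + lcmx delta (tmx psi (blocks_test k)) =
    block_mx (smx K (P + P^t*)) (lcmx delta Z) (mxadj (lcmx delta Z)) (smx K (Q + Q^t*)).
  transitivity (lcmx delta (tmx psi t) + mxadj (lcmx delta (tmx psi t))).
    apply: mxform_polar => z; rewrite !mxformD mxadj_form.
    have E := test_eq_matrix (A := A) psil hD (corner_supported tc) (blocks_supported kD) tk z.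
    have := sum_of_squares_pos S z; rewrite -/(mxform _ z z) ge0_complexE => /andP[/eqP i1 _].
    apply: complex_eq; rewrite !(ReD, ImD) ?Re_conjc ?Im_conjc ?E// i1 addr0.
    by rewrite subrr.
  rewrite XE mxadj_block !smx_adj add_block_mx -!smxD add0r.
  by rewrite -(smx0 n n) smx_adj trmx0 map_mx0 smx0 addr0.
have := block_inequality hD c0 uc h h ZD (_ : sum_of_squares D _) => /(_ (P + P^t*) (Q + Q^t*)).
rewrite -SE => /(_ (sum_of_squaresD S S)).
have formE (l : seq (H * H)) : (forall q, q \in l -> \sum_a phi a q.1 *: h a = q.1 /\
    \sum_a phi a q.2 *: h a = q.2) ->
    mxform (smx H (\matrix_(a, a') \sum_(q <- l) phi a' q.1 * (phi a q.2)^*)) h h =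
    \sum_(q <- l) hdot q.1 q.2.
  move=> hl; rewrite -(tmx_units _ (w := fun=> 1))// mxform_tmx big_map big_seq [RHS]big_seq.
  by apply: eq_bigr => q /hl[/= -> ->].
have ReP (M : 'M[C]_n) : complex.Re (mxform (smx H (M + M^t*)) h h) =
    2 * complex.Re (mxform (smx H M) h h).
  by rewrite smxD mxformD -smx_adj mxadj_form ReD Re_conjc; ring.
have mem p : p \in t -> [/\ \sum_a phi a p.1.2.1 *: h a = p.1.2.1,
    \sum_a phi a p.1.2.2 *: h a = p.1.2.2, \sum_a phi a p.2.1 *: h a = p.2.1
    & \sum_a phi a p.2.2 *: h a = p.2.2].
  move=> pt; split; apply: phih; rewrite !mem_cat.
  - by rewrite (map_f (fun p : G * V * V => p.1.2.1) pt).
  - by rewrite (map_f (fun p : G * V * V => p.1.2.2) pt) orbT.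
  - by rewrite (map_f (fun p : G * V * V => p.2.1) pt) !orbT.
  - by rewrite (map_f (fun p : G * V * V => p.2.2) pt) !orbT.
rewrite !ReP !formE; last 2 first.
- by move=> _ /mapP[p /mem[? ? ? ?] ->].
- by move=> _ /mapP[p /mem[? ? ? ?] ->].
rewrite mxform_tmx !big_map /=.
have -> : \sum_(p <- t) hdot (u p.1.1 (\sum_a phi a p.1.2.2 *: h a)) (\sum_a phi a p.2.1 *: h a) =
    \sum_(p <- t) hdot (u p.1.1 p.1.2.2) p.2.1.
  by rewrite big_seq [RHS]big_seq; apply: eq_bigr => p /mem[_ -> -> _].
set a1 := \sum_(p <- t) hdot p.1.2.1 _; set a2 := \sum_(p <- t) hdot p.1.2.2 _.
set a3 := \sum_(p <- t) hdot (u _ _) _ => hh.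
have -> : evalt t B0 = complex.Re (c%:C * (a1 + a2) + a3).
  rewrite -big_split mulr_sumr -big_split Re_sum /evalt big_seq [RHS]big_seq.
  by apply: eq_bigr => p /tc/corner_B0 ->.
rewrite ReD Re_scale ReD.
have := normr_Re_le a3; rewrite ler_norml => /andP[h3 _]; lra.
Qed.

Lemma dominating_extension : exists B, [/\ forall s, sesquiform (B s), fpsd D B,
  forall x y : H, B 1%g (x, 0) (y, 0) = c%:C * hdot x y,
  forall x y : H, B 1%g (0, x) (0, y) = c%:C * hdot x y
  & forall s, D s -> forall x y : H, B s (0, x) (y, 0) = hdot (u s x) y].
Proof.
have FD t t' : corners t -> corners t' -> corners (t ++ t').
  by move=> h h' p; rewrite mem_cat => /orP[/h|/h'].
have FZ (a : R) t : corners t -> corners (scale_test a t).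
  by move=> h _ /mapP[[[s x] y] pt ->]; apply: corner_scale; exact: h pt.
have F0 : corners [::] by [].
have [B [Bh Bp BF _]] := form_extension hD (@block_coneD R G V D)
  (fun a f => @block_coneZ R G V D a f hD) (fun k kD => ex_intro2 _ _ k kD erefl)
  F0 FD FZ corners_majorise B0_herm corners_pos.
have [Bs _ _] := Bh; have [B0s _ _] := B0_herm.
have BE s x y : corner (s, x, y) -> B s x y = B0 s x y.
  move=> sc; have E z : corner (s, z, y) -> complex.Re (B s z y) = complex.Re (B0 s z y).
    move=> zc; rewrite -!eval1; have h : corners [:: (s, z, y)].
      by move=> q; rewrite inE => /eqP->.
    by apply: BF => //; exact: corner_supported.
  apply: complex_eq; first exact: E.
  (* Corners are stable under multiplication by 'i, which supplies the imaginary parts. *)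
  have := E _ (corner_scale 'i sc); rewrite (sesquiZl (Bs _)) (sesquiZl (B0s _)) !Re_imag.
  exact: oppr_inj.
have D1 := hD.1.
exists B; split=> // [x y|x y|s Ds x y]; rewrite BE.
- by rewrite (@corner_B0 (1%g, (x, 0), (y, 0))) /= ?bop0r ?hdot0l ?addr0//; apply: Or31.
- by apply: Or31.
- by rewrite (@corner_B0 (1%g, (0, x), (0, y))) /= ?hdot0l ?hdot0r ?addr0 ?add0r//; apply: Or32.
- by apply: Or32.
- by rewrite (@corner_B0 (s, (0, x), (y, 0))) /= ?hdot0l ?hdot0r ?addr0 ?mulr0 ?add0r//; apply: Or33.
- by apply: Or33.
Qed.

End dominated_forms.

Section positive_to_bounded.
Context {R : realType} {G : groupType} (A : group_cstar R G).
Context (D : set G) (hD : positivity_domain D).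
Local Notation C := R[i].
Local Notation K := (gc_space A).
Local Notation delta := (delta A).

Lemma BDH_UOS_bound (H : hilbert R) (u : G -> bop H) : BDH D u ->
  exists2 M, 0 <= M & forall n (X : 'M[bop K]_n), mxin (span_delta D) X ->
    (UOS_norm D X <= 1)%E -> mxbound (map_mx (phi_UOS D u) X) M.
Proof.
move=> [r [c [w [wp uE]]]].
have hw k : exists M, 0 <= M /\ forall n (X : 'M[bop K]_n), mxin (span_delta D) X ->
    (UOS_norm D X <= 1)%E -> mxbound (map_mx (phi_UOS D (w k)) X) M.
  have [M M0 hM] := bop_bounded (w k 1%g); exists M; split=> // n X hX X1.
  exact: psd_UOS_bound.
have [M hM] := choice hw; exists (\sum_k normc (c k) * M k).
  by rewrite sumr_ge0// => k _; rewrite mulr_ge0 ?normc_ge0 ?(hM _).1.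
move=> n X hX X1; have [Z [XE ZD]] := span_lists hX.
apply: (mxbound_comb (T := fun k => map_mx (phi_UOS D (w k)) X)) => [k|k|x y].
- exact: (hM k).1.
- exact: (hM k).2.
- rewrite XE phi_UOS_lcmx//; under [RHS]eq_bigr do rewrite phi_UOS_lcmx//.
  by apply: mxform_lcmx_comb => i j p /ZD; exact: uE.
Qed.

(** The 0 x 0 matrix takes part in the supremum and contributes 0. *)
Lemma BDH_norm_ge0 (H : hilbert R) (u : G -> bop H) : (0 <= BDH_norm A D u)%E.
Proof.
pose X : 'M[bop K]_0 := 0; apply: le_trans (_ : (mxopnorm (map_mx (phi_UOS D u) X) <= _)%E).
  apply: ereal_sup_ge; exists 0%E => //; exists (fun=> 0).
    by rewrite /= /l2norm big_ord0 sqrtr0.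
  by rewrite /l2norm big_ord0 sqrtr0.
apply: ereal_sup_ubound; exists 0%N, X; split=> //; first by case.
apply: (UOS_norm_le1 hD).
have -> : block_mx (scalar_unit A 0 1) X (mxadj X) (scalar_unit A 0 1) = 0.
  by apply/matrixP => -[].
exact: sum_of_squares0.
Qed.

(** [delta] itself is positive semi-definite with value 1 at the identity, so the inclusion of
    UOS(D) in C^*(G) is a complete contraction. *)
Lemma UOS_norm_contractive n (X : 'M[bop K]_n) : mxin (span_delta D) X ->
  (UOS_norm D X <= 1)%E -> mxbound X 1.
Proof.
move=> hX X1; have dp : psd D delta.
  apply/psdP => l _; exact: (rep_fpsd (delta_unitary A) idfun).
have h x : hnorm (delta 1%g x) <= 1 * hnorm x by rewrite delta1 mul1r.
have := psd_UOS_bound hD dp ler01 h hX X1.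
by have [Z [-> ZD]] := span_lists hX; rewrite phi_UOS_lcmx.
Qed.

Lemma BDH_norm_le (H : hilbert R) (u v : G -> bop H) : BDH setT v ->
  (forall s, D s -> v s = u s) -> (BDH_norm A D u <= BGH_norm A v)%E.
Proof.
move=> vB vu; have [M M0 vM] := BDH_cbbound A vB.
apply: ge_ereal_sup => _ [n [X [hX X1 ->]]]; apply: ereal_sup_ubound; exists n, X.
have [Z [XE ZD]] := span_lists hX; split.
- by move=> i j; rewrite XE mxE; exact: cstar_lc.
- exact/(mxboundP _ ler01)/UOS_norm_contractive.
- congr mxopnorm; rewrite XE phi_UOS_lcmx//; apply/matrixP => i j; rewrite !mxE.
  rewrite (phi_cstar_lc _ M0 vM) /lc big_seq [RHS]big_seq.
  by apply: eq_bigr => p /ZD/vu ->.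
Qed.

(* The matrix coefficient is a combination of the four positive semi-definite functions
   [(J1 + a J2)^* pi(s) (J1 + a J2)], where [a] is a fourth root of unity. *)
Lemma coefficient_BDH (H L : hilbert R) (pi : G -> bop L) (J1 J2 : H -> L) (c : R)
    (v : G -> bop H) : unitary_rep pi -> linear J1 -> linear J2 -> 0 <= c ->
  (forall x, hnorm (J1 x) <= c * hnorm x) -> (forall x, hnorm (J2 x) <= c * hnorm x) ->
  (forall s x y, hdot (v s x) y = hdot (pi s (J1 x)) (J2 y)) -> BDH setT v.
Proof.
move=> piU J1l J2l c0 hJ1 hJ2 vE.
pose a (k : 'I_4) : C := 'i ^+ k; pose J k x := J1 x + a k *: J2 x.
have aa k : (a k)^* * a k = 1.
  by rewrite /a rmorphXn /= conj_imag -exprMn mulNr mul_imag opprK expr1n.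
have na k : normc (a k) = 1.
  have := congr1 (@complex.Re R) (aa k); rewrite conjc_mul /= => h.
  by apply/eqP; rewrite -(@eqrXn2 _ 2) ?normc_ge0// h expr1n.
have Jl k : linear (J k).
  move=> b x y; rewrite /J J1l J2l scalerDr !scalerDr !scalerA [a k * b]mulrC.
  by rewrite addrACA.
have hw k : exists w : G -> bop H, psd setT w /\
    forall s x y, hdot (w s x) y = hdot (pi s (J k x)) (J k y).
  apply: (@fpsd_operators R G H _ ((c + c) ^+ 2)) => [s|||x].
  - exact: (sesqui_comp (bform_sesqui pi s) (Jl k)).
  - exact: (rep_fpsd piU).
  - exact: sqr_ge0.
  - rewrite (rep1 piU) hdotxx -exprMn le_sqr ?mulr_ge0 ?addr_ge0 ?hnorm_ge0//.
    rewrite (le_trans (ler_hnormD _ _))// hnormZ na mul1r mulrDl lerD//.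
have [w hw'] := choice hw.
exists 4%N, (fun k => 4^-1 * a k), w; split=> [k|s _]; first exact: (hw' k).1.
apply: bop_ext => x; apply: hdot_injl => y; rewrite vE bop_sumE hdot_suml.
have E k : hdot (((4^-1 * a k) *: w k s) x) y = 4^-1 * (a k * hdot (pi s (J1 x)) (J1 y) +
    hdot (pi s (J1 x)) (J2 y) + a k ^+ 2 * hdot (pi s (J2 x)) (J1 y) +
    a k * hdot (pi s (J2 x)) (J2 y)).
  rewrite bopZE hdotZl (hw' k).2 /J bopDr bopZr !hdotDl !hdotDr !hdotZl !hdotZr.
  rewrite -!mulrA. congr (_ * _).
  set x1 := hdot _ _; set x2 := hdot _ _; set x3 := hdot _ _; set x4 := hdot _ _.
  transitivity (a k * x1 + ((a k)^* * a k) * x2 + a k ^+ 2 * x3 + a k * ((a k)^* * a k) * x4).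
    by ring.
  by rewrite aa mul1r mulr1 expr2 -mulrA.
under eq_bigr do rewrite E.
rewrite -mulr_sumr !big_ord_recl big_ord0 /a /= /bump /= addn0 !add1n.
have i2 : ('i : C) ^+ 2 = -1 by rewrite expr2 mul_imag.
have i3 : ('i : C) ^+ 3 = - 'i by rewrite exprS i2 mulrN1.
rewrite expr0 expr1 i2 i3 !sqrrN i2 !expr1n.
by field.
Qed.

Lemma positive_to_bounded : positive_extension_property R D ->
  bounded_extension_property A D.
Proof.
move=> ext H u uB; have [M M0 hM] := BDH_UOS_bound uB.
(* The norm is an extended real a priori; it is finite because u is a combination of positive
   semi-definite functions. *)
have [c [c0 cE]] : exists c : R, 0 <= c /\ BDH_norm A D u = c%:E.
  have : (BDH_norm A D u <= M%:E)%E.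
    by apply: ge_ereal_sup => _ [n [X [hX X1 ->]]]; apply/(mxboundP _ M0)/hM.
  have := BDH_norm_ge0 u.
  by case: (BDH_norm A D u) => // c; rewrite lee_fin => c0 _; exists c.
have uc n (X : 'M[bop K]_n) : mxin (span_delta D) X -> (UOS_norm D X <= 1)%E ->
    mxbound (map_mx (phi_UOS D u) X) c.
  move=> hX X1; apply/(mxboundP _ c0); rewrite -cE.
  by apply: ereal_sup_ubound; exists n, X.
have [B [Bs Bp B11 B22 B21]] := dominating_extension hD c0 uc.
have [L [j [u' [jl u'p _ u'E]]]] := Kolmogorov hD (fun s _ => Bs s) Bp.
have [v' [v'p v'u]] := ext L u' u'p.
have [||N [pi [J [piU Jl JE]]]] := @GNS R G L (bform v').
- by move=> s; exact: bform_sesqui.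
- exact/psdP.
pose J1 (x : H) := J (j (x, 0)); pose J2 (x : H) := J (j (0, x)).
have J1l : linear J1.
  move=> a x y; rewrite /J1 -Jl -jl; congr (J (j (_, _))).
  by rewrite /= scaler0 addr0.
have J2l : linear J2.
  move=> a x y; rewrite /J2 -Jl -jl; congr (J (j (_, _))).
  by rewrite /= scaler0 addr0.
have coefE s X Y : D s -> hdot (pi s (J (j X))) (J (j Y)) = B s X Y.
  by move=> Ds; rewrite JE /bform v'u// u'E.
have norm_J (F : H -> H * H) : (forall x, B 1%g (F x) (F x) = c%:C * hdot x x) ->
    forall x, hnorm (J (j (F x))) <= Num.sqrt c * hnorm x.
  move=> hF x; rewrite -le_sqr ?mulr_ge0 ?sqrtr_ge0 ?hnorm_ge0// exprMn sqr_sqrtr//.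
  rewrite sqr_hnorm -{1}(rep1 piU (J _)) coefE ?hF; last exact: hD.1.
  by rewrite Re_scale -sqr_hnorm.
have hJ1 := norm_J (fun x => (x, 0)) (fun x => B11 x x).
have hJ2 := norm_J (fun x => (0, x)) (fun x => B22 x x).
have s0 : 0 <= Num.sqrt c by exact: sqrtr_ge0.
have hv s : exists T : bop H, forall x y, hdot (T x) y = hdot (pi s (J2 x)) (J1 y).
  apply: (@form_bop _ _ _ c) => // [a x y z|a x y z|x y].
  - by rewrite J2l bop_linear hdotDl hdotZl.
  - by rewrite J1l hdotDr hdotZr.
  rewrite (le_trans (Cauchy_Schwarz _ _))//.
  have -> : hnorm (pi s (J2 x)) = hnorm (J2 x).
    have [_ _ iso] := piU; apply/eqP; rewrite -(@eqrXn2 _ 2) ?hnorm_ge0//.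
    by rewrite !sqr_hnorm iso.
  rewrite (le_trans (ler_pM (hnorm_ge0 _) (hnorm_ge0 _) (hJ2 x) (hJ1 y)))//.
  by rewrite mulrACA -expr2 sqr_sqrtr// mulrA.
have [v {}hv] := choice hv; exists v.
have vB : BDH setT v by exact: (coefficient_BDH piU J2l J1l s0 hJ2 hJ1 hv).
have vu s : D s -> v s = u s.
  move=> Ds; apply: bop_ext => x; apply: hdot_injl => y.
  by rewrite hv coefE// B21.
(* Restriction to UOS(D) cannot increase the norm; conversely, [J1] and [J2] are bounded by sqrt c,
   and the product of the two bounds is exactly c. *)
split=> //; apply/eqP; rewrite eq_le BDH_norm_le// andbT cE; apply: BGH_norm_le => //.
have := rep_cbbound (A := A) piU s0 s0 hJ2 hJ1 hv.
by rewrite -expr2 sqr_sqrtr.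
Qed.

End positive_to_bounded.

Theorem theorem5p21 (R : realType) (G : groupType) (A : group_cstar R G)
    (D : set G) (hD : positivity_domain D) :
  (positive_extension_property R D <-> bounded_extension_property A D) /\
  (bounded_extension_property A D <-> complete_factorisation_property A D).
Proof.
have i_ii := @positive_to_bounded R G A D hD.
have ii_i := @bounded_to_positive R G A D hD.
have i_iii := @positive_to_factorisation R G A D hD.
have iii_i := @factorisation_to_positive R G A D hD.
by split; [split=> [/i_ii|/ii_i]|split=> [/ii_i/i_iii|/iii_i/i_ii]].
Qed.
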